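(* (1) Let $L=A_2(-1)\oplus II_{1,1}(3)\oplus II_{1,1}(3)$ (genus $II_{2,4}(3^{+5})$), $D=L'/L$, and let $\gamma\in D$ be an element with $Q(\gamma)\equiv-1/3\bmod 1$. Put $$f(\tau)=\frac{\eta(\tau)}{\eta(3\tau)^3}.$$ Then the lift $F=F_{\Gamma_1(3),f,\gamma}$ is the weakly holomorphic modular form of weight $-1$ for $\rho_L$ with principal part $e(-\tau/3)\mathfrak{e}_\gamma+e(-\tau/3)\mathfrak{e}_{-\gamma}$ (the one whose automorphic product has singular weight $1$). (2) Let $L=D_4(-1)\oplus II_{1,1}(2)\oplus II_{1,1}(2)$ (genus $II_{2,6}(2_{II}^{-6})$), $D=L'/L$, and let $\gamma\in D$ be an element with $Q(\gamma)\equiv 1/2\bmod 1$. Put $$f(\tau)=\frac{\eta(\tau)^4}{\eta(2\tau)^8}.$$ Then the lift $F=F_{\Gamma_1(2),f,\gamma}$ is the weakly holomorphic modular form of weight $-2$ for $\rho_L$ with principal part $e(-\tau/2)\mathfrak{e}_\gamma$ (the one whose automorphic product has singular weight $2$).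
   Context: Write $e(x)=e^{2\pi i x}$, and let $\eta(\tau)=e(\tau/24)\prod_{m\ge1}(1-e(m\tau))$. $II_{1,1}$ is the even unimodular hyperbolic plane, $A_2,D_4$ are root lattices, and $M(t)$ denotes the lattice $M$ with quadratic form multiplied by $t$. For an even lattice $L$ of signature $(2,n)$ with quadratic form $q$ and dual $L'$, put $r=2-n$; $D=L'/L$ carries the quadratic form $Q=q\bmod1$ and the bilinear form $(\cdot,\cdot)$ with values in $\mathbb{Q}/\mathbb{Z}$. The Weil representation $\rho_L$ of $\mathrm{SL}_2(\mathbb{Z})$ on $\mathbb{C}[D]$ (basis $\mathfrak{e}_\gamma$) is given by $\rho_L(T)\mathfrak{e}_\gamma=e(Q(\gamma))\mathfrak{e}_\gamma$, $\rho_L(S)\mathfrak{e}_\gamma=\frac{e(-r/8)}{\sqrt{|D|}}\sum_{\beta\in D}e(-(\beta,\gamma))\mathfrak{e}_\beta$, with $T=\begin{pmatrix}1&1\\0&1\end{pmatrix}$, $S=\begin{pmatrix}0&-1\\1&0\end{pmatrix}$. A weakly holomorphic modular form of weight $k$ for $\rho_L$ is a holomorphic $F=\sum_\gamma f_\gamma\mathfrak{e}_\gamma:\mathbb{H}\to\mathbb{C}[D]$ with $F(M\tau)=(c\tau+d)^k\rho_L(M)F(\tau)$ for all $M=\begin{pmatrix}a&b\\c&d\end{pmatrix}\in\mathrm{SL}_2(\mathbb{Z})$ and expansions $f_\gamma(\tau)=\sum_{m\in\mathbb{Z}+Q(\gamma),\,m\gg-\infty}c(\gamma,m)e(m\tau)$.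 Its principal part is $\sum_\gamma\sum_{m<0}c(\gamma,m)e(m\tau)\mathfrak{e}_\gamma$; for $k<0$ the form is determined by its principal part. If $k=1-n/2$, the automorphic (Borcherds) product attached to $F$ has weight $c(0,0)/2$, and singular weight means $n/2-1$, i.e. $c(0,0)=n-2$. Lift: let $N$ be the level of $L$ and let $f$ be a weakly holomorphic (poles at cusps allowed) modular form of weight $k$ for $\Gamma_1(N)$ with character $\chi_\gamma(M)=e(bQ(\gamma))$ for $M=\begin{pmatrix}a&b\\c&d\end{pmatrix}$. With $f|_kM(\tau)=(c\tau+d)^{-k}f(M\tau)$, $$F_{\Gamma_1(N),f,\gamma}(\tau)=\sum_{M\in\Gamma_1(N)\backslash\mathrm{SL}_2(\mathbb{Z})}f|_kM(\tau)\,\rho_L(M^{-1})\mathfrak{e}_\gamma.$$ In (1), $N=3$ and $k=-1$; in (2), $N=2$ and $k=-2$. *)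

(* Defs.v *)
From HB Require Import structures.
From mathcomp Require Import all_boot all_order all_algebra.
From mathcomp Require Import all_classical all_reals all_analysis.
From mathcomp Require Import complex.
Set Implicit Arguments.
Unset Strict Implicit.
Unset Printing Implicit Defensive.
Import Order.TTheory GRing.Theory Num.Theory numFieldNormedType.Exports.
Local Open Scope classical_set_scope.
Local Open Scope ring_scope.

Definition eqmod1 (x y : rat) : Prop := x - y \is a Num.int.

Section GramMatrices.

Definition gramQ m (G : 'M[int]_m) : 'M[rat]_m := map_mx intr G.

Definition bilQ m (G : 'M[int]_m) (x y : 'rV[rat]_m) : rat :=
  (x *m gramQ G *m y^T) 0 0.

Definition has_signature m (G : 'M[int]_m) (p q : nat) : Prop :=
  exists (P : 'M[rat]_m) (d : 'rV[rat]_m),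
    [/\ P \in unitmx, P *m gramQ G *m P^T = diag_mx d,
        #|[set i | 0 < d 0 i]%SET| = p & #|[set i | d 0 i < 0]%SET| = q].

Definition even_gram m (G : 'M[int]_m) : Prop :=
  G^T = G /\ forall i, (2 %| G i i)%Z.

Definition dsum m1 m2 (G1 : 'M[int]_m1) (G2 : 'M[int]_m2) : 'M[int]_(m1 + m2) :=
  block_mx G1 0 0 G2.

Lemma even_dsum m1 m2 (G1 : 'M[int]_m1) (G2 : 'M[int]_m2) :
  even_gram G1 -> even_gram G2 -> even_gram (dsum G1 G2).
Proof.
move=> [s1 e1] [s2 e2]; split; first by rewrite /dsum tr_block_mx s1 s2 !trmx0.
move=> i; rewrite -(splitK i); case: (fintype.split i) => j /=.
  by rewrite block_mxEul.
by rewrite block_mxEdr.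
Qed.

Lemma even_scale m t (G : 'M[int]_m) : even_gram G -> even_gram (t *: G).
Proof.
by move=> [s e]; split=> [|i]; [rewrite linearZ /= s | rewrite mxE dvdz_mull].
Qed.

Lemma card_split m1 m2 (p : pred rat) (d1 : 'rV[rat]_m1) (d2 : 'rV[rat]_m2) :
  #|[set i | p (row_mx d1 d2 0 i)]%SET| =
  addn #|[set i | p (d1 0 i)]%SET| #|[set i | p (d2 0 i)]%SET|.
Proof.
rewrite -!sum1_card big_split_ord /=; congr addn.
  by apply: eq_bigl => i; rewrite !inE row_mxEl.
by apply: eq_bigl => i; rewrite !inE row_mxEr.
Qed.

Lemma signature_dsum m1 m2 (G1 : 'M[int]_m1) (G2 : 'M[int]_m2) p1 q1 p2 q2 :
  has_signature G1 p1 q1 -> has_signature G2 p2 q2 ->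
  has_signature (dsum G1 G2) (p1 + p2) (q1 + q2).
Proof.
move=> [P1 [d1 [U1 E1 <- <-]]] [P2 [d2 [U2 E2 <- <-]]].
exists (block_mx P1 0 0 P2), (row_mx d1 d2); split.
- by rewrite unitmxE det_ublock unitrM -!unitmxE U1.
- rewrite /gramQ /dsum map_block_mx !raddf0 tr_block_mx !trmx0 !mulmx_block.
  by rewrite !(mulmx0, mul0mx, addr0, add0r) E1 E2 diag_mx_row.
- exact: (card_split (fun x => 0 < x)).
- exact: (card_split (fun x => x < 0)).
Qed.

Lemma signature_pos m (G : 'M[int]_m) t p q : 0 < t ->
  has_signature G p q -> has_signature (t *: G) p q.
Proof.
move=> t0 [P [d [U E <- <-]]].
have t0' : 0 < t%:~R :> rat by rewrite ltr0z.
exists P, (t%:~R *: d); split => //.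
- rewrite /gramQ map_mxZ -scalemxAr -scalemxAl -[map_mx _ G]/(gramQ G) E.
  by apply/matrixP => i j; rewrite !mxE mulrnAr.
- by apply: eq_card => i; rewrite !inE mxE pmulr_rgt0.
- by apply: eq_card => i; rewrite !inE mxE pmulr_rlt0.
Qed.

Lemma signature_neg m (G : 'M[int]_m) t p q : t < 0 ->
  has_signature G p q -> has_signature (t *: G) q p.
Proof.
move=> t0 [P [d [U E <- <-]]].
have t0' : t%:~R < 0 :> rat by rewrite ltrz0.
exists P, (t%:~R *: d); split => //.
- rewrite /gramQ map_mxZ -scalemxAr -scalemxAl -[map_mx _ G]/(gramQ G) E.
  by apply/matrixP => i j; rewrite !mxE mulrnAr.
- by apply: eq_card => i; rewrite !inE mxE nmulr_rgt0.
- by apply: eq_card => i; rewrite !inE mxE nmulr_rlt0.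
Qed.

Definition A2 : 'M[int]_2 := \matrix_(i, j) if i == j then 2 else -1.

(* Index 0 is the central node of the Dynkin diagram. *)
Definition D4 : 'M[int]_4 :=
  \matrix_(i, j) if i == j then 2 else if (i == 0) || (j == 0) then -1 else 0.

Definition II11 : 'M[int]_2 := \matrix_(i, j) (i != j)%:R.

Lemma even_A2 : even_gram A2.
Proof.
split=> [|i]; last by rewrite mxE eqxx.
by apply/matrixP => i j; rewrite !mxE eq_sym.
Qed.

Lemma even_D4 : even_gram D4.
Proof.
split=> [|i]; last by rewrite mxE eqxx.
by apply/matrixP => i j; rewrite !mxE eq_sym orbC.
Qed.

Lemma even_II11 : even_gram II11.
Proof.
split=> [|i]; last by rewrite mxE eqxx.
by apply/matrixP => i j; rewrite !mxE eq_sym.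
Qed.

Lemma signature_A2 : has_signature A2 2 0.
Proof.
exists (\matrix_(i, j) if i == j then 1 else if i == 0 then 0 else 2^-1).
exists (\row_i if i == 0 then 2 else 3 / 2); split.
- rewrite unitmxE (expand_det_row _ 0) !big_ord_recr big_ord0 /= !mxE /=.
  by rewrite /cofactor !det_mx11 !mxE.
- apply/matrixP => -[[|[|//]] ?] [[|[|//]] ?];
  rewrite ?(mxE, big_ord_recr, big_ord0) /=; exact/eqP.
- by rewrite -sum1_card big_mkcond /= !big_ord_recr big_ord0 /= !inE !mxE.
- by rewrite -sum1_card big_mkcond /= !big_ord_recr big_ord0 /= !inE !mxE.
Qed.

Lemma signature_II11 : has_signature II11 1 1.
Proof.
exists (\matrix_(i, j) if (i == 1) && (j == 1) then -1 else 1).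
exists (\row_i if i == 0 then 2 else -2); split.
- rewrite unitmxE (expand_det_row _ 0) !big_ord_recr big_ord0 /= !mxE /=.
  by rewrite /cofactor !det_mx11 !mxE.
- apply/matrixP => -[[|[|//]] ?] [[|[|//]] ?];
  rewrite ?(mxE, big_ord_recr, big_ord0) /=; exact/eqP.
- by rewrite -sum1_card big_mkcond /= !big_ord_recr big_ord0 /= !inE !mxE.
- by rewrite -sum1_card big_mkcond /= !big_ord_recr big_ord0 /= !inE !mxE.
Qed.

Lemma signature_D4 : has_signature D4 4 0.
Proof.
exists (\matrix_(i, j) if i == j then 1 else if i == 0 then 2^-1 else 0).
exists (\row_i if i == 0 then 2^-1 else 2); split.
- rewrite unitmxE -det_tr det_trig; last first.
    apply/is_trig_mxP => i j ij; rewrite !mxE.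
    by case: i j ij => [[|i] ?] [[|j] ?] //=; rewrite -val_eqE /=; case: eqP => // ->; rewrite ltnn.
  by rewrite big1 // => i _; rewrite !mxE eqxx.
- set PG := \matrix_(i < 4, j < 4) if i == j then (if i == 0 then 2^-1 else 2)
    else if (i != 0) && (j == 0) then -1 else 0 : rat.
  have -> : (\matrix_(i, j) if i == j then 1 else if i == 0 then 2^-1 else 0)
      *m gramQ D4 = PG.
    apply/matrixP => -[[|[|[|[|//]]]] ?] [[|[|[|[|//]]]] ?];
    rewrite ?(mxE, big_ord_recr, big_ord0) /=; exact/eqP.
  apply/matrixP => -[[|[|[|[|//]]]] ?] [[|[|[|[|//]]]] ?];
  rewrite ?(mxE, big_ord_recr, big_ord0) /=; exact/eqP.
- by rewrite -sum1_card big_mkcond /= !big_ord_recr big_ord0 /= !inE !mxE.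
- by rewrite -sum1_card big_mkcond /= !big_ord_recr big_ord0 /= !inE !mxE.
Qed.

End GramMatrices.

(* An even lattice of signature (2,n): Z^(n+2) with the quadratic form
   q(x) = x G x^T / 2 given by its Gram matrix G. *)
Record even_lattice (n : nat) := EvenLattice {
  gram : 'M[int]_n.+2;
  gram_even : even_gram gram;
  gram_signature : has_signature gram 2 n }.

Section Discriminant.
Variables (n : nat) (L : even_lattice n).

Definition bil (x y : 'rV[rat]_n.+2) : rat := bilQ (gram L) x y.
Definition quad (x : 'rV[rat]_n.+2) : rat := bil x x / 2.

Definition dual_pred : {pred 'rV[rat]_n.+2} :=
  [pred x | `[< forall y : 'rV[int]_n.+2, bil x (map_mx intr y) \is a Num.int >]].

Lemma dual_zmod_closed : zmod_closed dual_pred.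
Proof.
split=> [|x y].
  by apply/asboolP => y; rewrite /bil /bilQ !mul0mx mxE.
move=> /asboolP dx /asboolP dy; apply/asboolP => z.
have := rpredB (dx z) (dy z).
by rewrite /bil /bilQ !mulmxBl !mxE.
Qed.
HB.instance Definition _ :=
  GRing.isZmodClosed.Build _ dual_pred dual_zmod_closed.

Record dual := Dual { dual_val :> 'rV[rat]_n.+2; _ : dual_val \in dual_pred }.
HB.instance Definition _ := [isSub for dual_val].
HB.instance Definition _ := [Choice of dual by <:].
HB.instance Definition _ := [SubChoice_isSubZmodule of dual by <:].

Definition lat_pred : {pred dual} := [pred x | val x \is a mxOver Num.int].

Lemma lat_zmod_closed : zmod_closed lat_pred.
Proof.
split=> [|x y]; rewrite !inE.
  by rewrite GRing.val0; apply/mxOverP => i j; rewrite mxE rpred0.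
move=> /mxOverP lx /mxOverP ly; rewrite GRing.valB.
by apply/mxOverP => i j; rewrite !mxE rpredB ?lx ?ly.
Qed.
HB.instance Definition _ := GRing.isZmodClosed.Build _ lat_pred lat_zmod_closed.

Definition disc := Quotient.quot (lat_pred : zmodClosed dual).

HB.instance Definition _ := Choice.on disc.
HB.instance Definition _ := GRing.Zmodule.on disc.
HB.instance Definition _ := EqQuotient.on disc.

Lemma gram_det_neq0 : \det (gram L) != 0.
Proof.
have [P [d [U E pd nd]]] := gram_signature L.
have d0 i : d 0 i != 0.
  have : i \in ([set i | (0 < d 0 i)%R] :|: [set i | (d 0 i < 0)%R])%SET.
    suff -> : ([set i | (0 < d 0 i)%R] :|: [set i | (d 0 i < 0)%R])%SET
      = [set: 'I_n.+2]%SET by rewrite inE.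
    apply/eqP; rewrite eqEcard finset.subsetT cardsT card_ord cardsU pd nd.
    have -> : ([set i | (0 < d 0 i)%R] :&: [set i | (d 0 i < 0)%R])%SET
        = finset.set0.
      apply/setP => j; rewrite !inE; apply/negP => /andP[p q].
      by move: (lt_trans p q); rewrite ltxx.
    by rewrite cards0 add2n subn0 leqnn.
  by rewrite !inE => /orP[] h; rewrite ?(gt_eqF h) // (lt_eqF h).
apply/eqP => D0; have := congr1 determinant E.
rewrite !det_mulmx det_diag /gramQ det_map_mx D0 mulr0 mul0r => /esym/eqP.
by rewrite prodf_seq_eq0 => /hasP[i _ /=]; rewrite (negPf (d0 i)).
Qed.

Let G : 'M[rat]_n.+2 := gramQ (gram L).
Let k : nat := `|\det (gram L)|%N.-1.

Lemma gramQ_unit : G \in unitmx.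
Proof. by rewrite unitmxE det_map_mx unitfE intr_eq0 gram_det_neq0. Qed.

Lemma dual_int (x : dual) : exists w : 'rV[int]_n.+2, map_mx intr w = val x *m G.
Proof.
exists (\row_j numq ((val x *m G) 0 j)); apply/matrixP => i j.
rewrite !mxE ord1; case: x => x /= /asboolP /(_ (delta_mx 0 j)).
rewrite /bil /bilQ -/G map_delta_mx trmx_delta.
have -> : (x *m G *m delta_mx j (0 : 'I_1)) 0 0 = (x *m G) 0 j.
  rewrite [LHS]mxE (bigD1 j) //= big1 => [|l lj].
    by rewrite [X in _ * X]mxE !eqxx mulr1 addr0.
  by rewrite [X in _ * X]mxE (negPf lj) mulr0.
by move=> /intrP[z zE]; move: zE; rewrite !mxE => ->; rewrite numq_int.
Qed.

Lemma lat_dual (y : 'rV[int]_n.+2) : (map_mx intr y : 'rV[rat]_n.+2) \in dual_pred.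
Proof.
apply/asboolP => z; rewrite /bil /bilQ /gramQ map_trmx -!map_mxM mxE.
exact: rpred_int.
Qed.

Definition disc_of_row (u : 'rV['I_k.+1]_n.+2) : disc :=
  \pi_disc%qT (insubd (0 : dual) (map_mx (fun i : 'I_k.+1 => (nat_of_ord i)%:R) u *m invmx G)).

Lemma disc_of_row_surj (x : disc) : exists u, disc_of_row u == x.
Proof.
have [w wE] := dual_int (repr x).
set D : int := \det (gram L).
exists (map_mx (fun z => inord `|(z %% D)%Z|%N) w).
rewrite /disc_of_row.
have -> : map_mx (fun i : 'I_k.+1 => (nat_of_ord i)%:R) (map_mx (fun z => inord `|(z %% D)%Z|%N) w)
   = val (repr x) *m G - D%:~R *: map_mx intr (map_mx (fun z => (z %/ D)%Z) w) :> 'rV[rat]_n.+2.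
  apply/matrixP => i j; rewrite -wE !mxE inordK; last first.
    have D0 : (0 < `|D|)%N by rewrite absz_gt0 gram_det_neq0.
    rewrite /k prednK // -ltz_nat gez0_abs ?modz_ge0 ?gram_det_neq0 //.
    by rewrite ltz_mod ?gram_det_neq0.
  rewrite natr_absz ger0_norm ?modz_ge0 ?gram_det_neq0 //.
  apply/eqP; rewrite eq_sym subr_eq -intrM -intrD eqr_int addrC mulrC.
  exact/eqP/divz_eq.
rewrite mulmxBl mulmxK ?gramQ_unit // -scalemxAl scalemxAr.
have -> : D%:~R *: invmx G = map_mx intr (\adj (gram L)).
  rewrite /invmx gramQ_unit scalerA det_map_mx mulfV ?intr_eq0 ?gram_det_neq0 //.
  by rewrite scale1r map_mx_adj.
rewrite -map_mxM; set v := _ *m _.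
have -> : insubd 0 (val (repr x) - map_mx intr v) = repr x - Dual (lat_dual v).
  by apply: val_inj; rewrite GRing.valB /= insubdK // rpredB ?lat_dual ?(valP (repr x)).
rewrite -{2}[x]reprK -Quotient.idealrBE addrAC subrr add0r rpredN inE /=.
by apply/mxOverP => i j; rewrite mxE rpred_int.
Qed.

Definition row_of_disc (x : disc) := xchoose (disc_of_row_surj x).
Lemma row_of_discK : cancel row_of_disc disc_of_row.
Proof. by move=> x; apply/eqP/(xchooseP (disc_of_row_surj x)). Qed.

HB.instance Definition _ := Countable.copy disc (can_type row_of_discK).

Lemma disc_enumP :
  Finite.axiom (undup (map disc_of_row (enum 'rV['I_k.+1]_n.+2)) : seq disc).
Proof.
move=> x; rewrite count_uniq_mem ?undup_uniq // mem_undup.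
by rewrite -[x]row_of_discK map_f // mem_enum.
Qed.
HB.instance Definition _ := fintype.isFinite.Build disc disc_enumP.

End Discriminant.

Section DiscriminantForm.
Variables (n : nat) (L : even_lattice n).

(* Rational representatives: Q(gamma) and (beta,gamma) are classes in Q/Z, so
   discQ and discB are only meaningful modulo 1. *)
Definition discQ (g : disc L) : rat := quad L (val (repr g)).
Definition discB (b g : disc L) : rat := bil L (val (repr b)) (val (repr g)).

Definition annihilates_discQ (N : nat) : Prop :=
  forall g : disc L, N%:R * discQ g \is a Num.int.

Definition is_level (N : nat) : Prop :=
  [/\ (0 < N)%N, annihilates_discQ N &
      forall M : nat, (0 < M)%N -> annihilates_discQ M -> (N <= M)%N].

End DiscriminantForm.

(* A numClosedFieldType, so that the topology and the derivative over C are
   those attached by MathComp-Analysis to a numFieldType. *)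
Definition Cplx (R : realType) : numClosedFieldType := R[i]%C.

Section ModularForms.
Variable R : realType.
Local Notation C := (Cplx R).

Definition ee (z : C) : C :=
  (let x := complex.Re z in let y := complex.Im z in
   let r := expR (- (2 * pi * y)) in
   (r * cos (2 * pi * x)) +i* (r * sin (2 * pi * x)))%C.

Definition eeQ (q : rat) : C := ee (ratr q).

Definition upper_half (t : C) : Prop := 0 < complex.Im t.

Definition holomorphic_H (f : C -> C) : Prop :=
  forall t, upper_half t -> derivable f t 1.

Definition eta (t : C) : C :=
  ee (t / 24) * lim ((fun n => \prod_(1 <= m < n.+1) (1 - ee (m%:R * t))) @ \oo).

Definition SL2Z : set 'M[int]_2 := [set M | \det M = 1].

Definition Gamma1 (N : nat) : set 'M[int]_2 :=
  [set M | [/\ SL2Z M, ((M 0 0)%R = 1 %[mod N])%Z, ((M 1 1)%R = 1 %[mod N])%Z &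
               ((M 1 0)%R = 0 %[mod N])%Z]].

Definition matT : 'M[int]_2 :=
  \matrix_(i, j) if (i == 1) && (j == 0) then 0 else 1.
Definition matS : 'M[int]_2 :=
  \matrix_(i, j) if i == j then 0 else if i == 0 then -1 else 1.

Definition autj (M : 'M[int]_2) (t : C) : C := (M 1 0)%:~R * t + (M 1 1)%:~R.

Definition mobius (M : 'M[int]_2) (t : C) : C :=
  ((M 0 0)%:~R * t + (M 0 1)%:~R) / autj M t.

Definition slash (k : int) (f : C -> C) (M : 'M[int]_2) (t : C) : C :=
  autj M t ^ (- k) * f (mobius M t).

(* f(t) = sum of c(m) e(m t) over m in a + (1/h)Z, with finitely many m < 0. *)
Definition fourier_expansion (h : nat) (a : rat) (c : rat -> C) (f : C -> C) :=
  (forall m, c m != 0 -> (m - a) * h%:R \is a Num.int) /\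
  exists n0 : int,
    let idx (j : nat) : rat := a + (n0%:~R + j%:R) / h%:R in
    (forall m, m < idx 0%N -> c m = 0) /\
    forall t, upper_half t ->
      (fun n => \sum_(0 <= j < n) c (idx j) * ee (ratr (idx j) * t)) @ \oo
        --> f t.

(* The expansion of f|M at the cusp M(oo) is in powers of e(t/N): this is the
   period of f|M when chi(M T^N M^-1) = 1 for all M, as for the characters
   chi_gamma below with N the level. *)
Record weakly_holomorphic_Gamma1 (N : nat) (k : int) (chi : 'M[int]_2 -> C)
    (f : C -> C) : Prop := {
  whG_holomorphic : holomorphic_H f;
  whG_modular : forall M, Gamma1 N M -> forall t, upper_half t ->
    f (mobius M t) = chi M * autj M t ^ k * f t;
  whG_cusps : forall M, SL2Z M ->
    exists c, fourier_expansion N 0 c (slash k f M) }.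

Section VectorValued.
Variables (n : nat) (L : even_lattice n).

Local Notation group_ring := {ffun disc L -> C}.

Definition basis_elt (g : disc L) : group_ring := [ffun b => (b == g)%:R].

Record weil_representation (rho : 'M[int]_2 -> {linear group_ring -> group_ring})
    : Prop := {
  weil_1 : forall v, rho 1 v = v;
  weil_M : forall M N, SL2Z M -> SL2Z N ->
    forall v, rho (M * N) v = rho M (rho N v);
  weil_T : forall g, rho matT (basis_elt g) = eeQ (discQ g) *: basis_elt g;
  weil_S : forall g, rho matS (basis_elt g) =
    (ee (- (2 - n%:R) / 8) / sqrtC #|{: disc L}|%:R) *:
      \sum_(b : disc L) eeQ (- discB b g) *: basis_elt b }.

Variable rho : 'M[int]_2 -> {linear group_ring -> group_ring}.

Definition has_coefficients (F : C -> group_ring) (c : disc L -> rat -> C) :=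
  forall g, fourier_expansion 1 (discQ g) (c g) (fun t => F t g).

Record weakly_holomorphic (k : int) (F : C -> group_ring) : Prop := {
  wh_holomorphic : forall g, holomorphic_H (fun t => F t g);
  wh_modular : forall M, SL2Z M -> forall t, upper_half t ->
    F (mobius M t) = autj M t ^ k *: rho M (F t);
  wh_expansion : exists c, has_coefficients F c }.

(* P g m is the coefficient of e(m t) e_g, for m < 0. *)
Definition has_principal_part (F : C -> group_ring) (P : disc L -> rat -> C) :=
  exists c, has_coefficients F c /\ forall g m, m < 0 -> c g m = P g m.

(* The coefficients of e(m0 t) e_g0. *)
Definition principal_monomial (m0 : rat) (g0 : disc L) (g : disc L) (m : rat) : C :=
  ((g == g0) && (m == m0))%:R.

Definition is_form_with_principal_part (k : int) (P : disc L -> rat -> C)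
    (F : C -> group_ring) : Prop :=
  [/\ weakly_holomorphic k F, has_principal_part F P &
      forall F', weakly_holomorphic k F' -> has_principal_part F' P ->
        forall t, upper_half t -> F' t = F t].

Definition product_weight (F : C -> group_ring) (w : C) : Prop :=
  exists c, has_coefficients F c /\ w = c 0 0 / 2.

Definition singular_weight : C := n%:R / 2 - 1.

Definition chi (g : disc L) (M : 'M[int]_2) : C := eeQ ((M 0 1)%:~R * discQ g).

Definition Gamma1_cosets (N : nat) : set (set 'M[int]_2) :=
  [set [set A *m M | A in Gamma1 N] | M in SL2Z].

Definition coset_section (N : nat) (s : set 'M[int]_2 -> 'M[int]_2) : Prop :=
  forall K, Gamma1_cosets N K -> K (s K).

Definition Gamma1_lift (N : nat) (k : int) (f : C -> C) (g : disc L)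
    (s : set 'M[int]_2 -> 'M[int]_2) (t : C) : group_ring :=
  \sum_(K \in Gamma1_cosets N)
    slash k f (s K) t *: rho (invmx (s K)) (basis_elt g).

End VectorValued.
End ModularForms.

Notation group_ring R L := {ffun disc L -> Cplx R}.

Lemma latticeA2_subproof (G := dsum (-1 *: A2) (dsum (3 *: II11) (3 *: II11))) :
  even_gram G /\ has_signature G 2 4.
Proof.
split; first by do ![apply: even_dsum | apply: even_scale];
  exact: even_A2 || exact: even_II11.
rewrite -[2%N]/(0 + (1 + 1))%N -[4%N]/(2 + (1 + 1))%N.
apply: signature_dsum; first exact: signature_neg signature_A2.
by apply: signature_dsum; apply: signature_pos => //; exact: signature_II11.
Qed.

Lemma latticeD4_subproof (G := dsum (-1 *: D4) (dsum (2 *: II11) (2 *: II11))) :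
  even_gram G /\ has_signature G 2 6.
Proof.
split; first by do ![apply: even_dsum | apply: even_scale];
  exact: even_D4 || exact: even_II11.
rewrite -[2%N]/(0 + (1 + 1))%N -[6%N]/(4 + (1 + 1))%N.
apply: signature_dsum; first exact: signature_neg signature_D4.
by apply: signature_dsum; apply: signature_pos => //; exact: signature_II11.
Qed.

Definition latticeA2 : even_lattice 4 :=
  EvenLattice (proj1 latticeA2_subproof) (proj2 latticeA2_subproof).

Definition latticeD4 : even_lattice 6 :=
  EvenLattice (proj1 latticeD4_subproof) (proj2 latticeD4_subproof).

(* Main.v *)
(* The heart of the matter is eta(-1/t)^2 = -i t eta(t)^2. The logarithmic derivative of eta is an
   Eisenstein series of weight 2 by the Lipschitz formula; exchanging the two conditionally
   convergent sums produces the anomaly 1/(2t), so that r(t) = eta(-1/t)/eta(t) satisfies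
   r' = r/(2t). Hence f|S is a constant times eta(t)^a/eta(t/N)^b, which is holomorphic at infinity
   and N-periodic, and f transforms under T and U = S T^-N S^-1, which generate Gamma_1(N), by the
   character through which Gamma_1(N) acts on e_gamma.

   The cosets of Gamma_1(N) are represented by 1 and the S T^j (together with their negatives if
   N = 3). Only the representatives 1 and -1 contribute to the principal part, and the others
   contribute to the constant term of the zero component through |D| and rho(S).

   A form of negative weight with trivial principal part vanishes: its invariant norm is bounded,
   so that the form tends to 0 at the real line and Cauchy's estimate applies. *)

Require Import Defs.
From mathcomp Require Import all_boot all_order all_algebra.
From mathcomp Require Import all_classical all_reals all_analysis.
From mathcomp Require Import complex.
From mathcomp Require Import ring lra zify.
Set Implicit Arguments.
Unset Strict Implicit.
Unset Printing Implicit Defensive.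
Import Order.TTheory GRing.Theory Num.Theory numFieldNormedType.Exports.
Local Open Scope classical_set_scope.
Local Open Scope ring_scope.

Local Notation re := complex.Re.
Local Notation im := complex.Im.
Local Notation normc := ComplexField.Normc.normc.
Local Notation "x %:C" := (real_complex _ x) (format "x %:C") : ring_scope.

(** * Limits, series and dominated convergence over the complex numbers *)

(** No contour integral occurs. Every infinite process is a series with an explicit summable
    majorant, and limits are exchanged by Tannery's theorem: products become power series in q
    majorized by partition numbers, and partial fractions come from iterating duplication formulas.

    No branch of the square root of t is chosen either. The weight being an integer, it suffices to
    know r(t)^2 = -i t and, for positive a, r(t) = sqrt(a) r(t/a); the latter makes f|S a constant
    sqrt(N)^b i^K times an eta quotient.

    Both cases of the theorem are instances of one argument with parameters N, a, b, K. The singular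
    weight then is a numerical identity between this constant, the order 3^5 or 2^6 of D, and the
    eighth root of unity in rho(S). *)

Section ComplexLimits.
Variable R : realType.
Local Notation C := (Cplx R).
Implicit Types (z w : C) (x y : R).

Lemma normE z : `|z| = (normc z)%:C.
Proof. by case: z. Qed.

Lemma lecR' x y : ((x%:C : C) <= y%:C) = (x <= y).
Proof. exact: lecR. Qed.

Lemma normc_ge0 z : 0 <= normc z.
Proof. by case: z => a b; rewrite /= sqrtr_ge0. Qed.

Lemma normcD z w : normc (z + w) <= normc z + normc w.
Proof. by rewrite -lecR' raddfD /= -!normE ler_normD. Qed.

Lemma normcN z : normc (- z) = normc z.
Proof. by apply: complexI; rewrite -!normE normrN. Qed.

Lemma normcB z w : normc (z - w) <= normc z + normc w.
Proof. by rewrite (le_trans (normcD _ _)) // normcN. Qed.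

Lemma normc_distC z w : normc (z - w) = normc (w - z).
Proof. by rewrite -normcN opprB. Qed.

Lemma normcM z w : normc (z * w) = normc z * normc w.
Proof. exact: ComplexField.Normc.normcM. Qed.

Lemma normc0 : normc (0 : C) = 0.
Proof. exact: ComplexField.Normc.normc0. Qed.

Lemma normc1 : normc (1 : C) = 1.
Proof. exact: ComplexField.Normc.normc1. Qed.

Lemma normcV z : normc z^-1 = (normc z)^-1.
Proof. exact: ComplexField.Normc.normcV. Qed.

Lemma normcX z n : normc (z ^+ n) = normc z ^+ n.
Proof. by elim: n => [|n IH]; rewrite ?expr0 ?normc1 // !exprS normcM IH. Qed.

Lemma normc_eq0 z : (normc z == 0) = (z == 0).
Proof.
apply/eqP/eqP => [|->]; last exact: normc0.
exact: ComplexField.Normc.eq0_normc.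
Qed.

Lemma normc_gt0 z : (0 < normc z) = (z != 0).
Proof. by rewrite lt0r normc_eq0 normc_ge0 andbT. Qed.

Lemma normc_real x : normc (x%:C : C) = `|x|.
Proof. by rewrite /= expr0n addr0 sqrtr_sqr. Qed.

Lemma normc_nat n : normc (n%:R : C) = n%:R.
Proof. by rewrite -(rmorph_nat (real_complex R)) normc_real ger0_norm. Qed.

Lemma normc_sum (I : Type) (r : seq I) (P : pred I) (F : I -> C) :
  normc (\sum_(i <- r | P i) F i) <= \sum_(i <- r | P i) normc (F i).
Proof.
elim/big_rec2: _ => [|i y z _ IH]; first by rewrite normc0.
by rewrite (le_trans (normcD _ _)) // lerD2l.
Qed.

Lemma normcE z : normc z ^+ 2 = re z ^+ 2 + im z ^+ 2.
Proof. by case: z => a b /=; rewrite sqr_sqrtr // addr_ge0 ?sqr_ge0. Qed.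

Lemma re_le z : `|re z| <= normc z.
Proof.
rewrite -[leRHS]ger0_norm ?normc_ge0 // -ler_sqr ?nnegrE // !real_normK ?num_real //.
by rewrite normcE lerDl sqr_ge0.
Qed.

Lemma im_le z : `|im z| <= normc z.
Proof.
rewrite -[leRHS]ger0_norm ?normc_ge0 // -ler_sqr ?nnegrE // !real_normK ?num_real //.
by rewrite normcE lerDr sqr_ge0.
Qed.

Lemma normc_le z : normc z <= `|re z| + `|im z|.
Proof.
case: z => a b; rewrite (_ : a +i* b = a%:C + b%:C * 'i)%C; last by simpc.
rewrite (le_trans (normcD _ _)) // normcM !normc_real.
by rewrite [normc 'i%C]/= expr0n expr1n add0r sqrtr1 mulr1 /=; simpc.
Qed.

(** Convergence is sealed in an inductive type so that it stays folded and is handled through the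
    lemmas below. *)
Variant cvC T (F : set_system T) (f : T -> C) (l : C) : Prop :=
  CvC of f @ F --> l.

(** The radii of balls in [Cplx R] are complex numbers; a positive one is real, which allows a real
    epsilon. *)
Lemma cvgCP T (F : set_system T) {FF : Filter F} (f : T -> C) (l : C) :
  cvC F f l <-> forall e : R, 0 < e -> \forall t \near F, normc (l - f t) < e.
Proof.
split=> [[/cvgrPdist_lt H] e e0 | H].
  have := H (e%:C) _; rewrite ltcR => /(_ e0).
  by apply: filterS => t; rewrite normE ltcR.
split; apply/cvgrPdist_lt => e e0.
have Ee : e = (re e)%:C by rewrite RRe_real // gtr0_real.
have := H (re e) _; rewrite Ee ltcR in e0 *; move=> /(_ e0).
by apply: filterS => t; rewrite normE ltcR.
Qed.

#[global] Instance nbhsC_filter (z : C) : ProperFilter (nbhs z).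
Proof. exact: nbhs_pfilter. Qed.

#[global] Instance dnbhsC_filter (z : C) : ProperFilter (z^').
Proof. exact: Proper_dnbhs_numFieldType. Qed.

Lemma nearC_all (z : C) (P : C -> Prop) : (forall w, P w) -> \forall w \near z, P w.
Proof. by move=> H; exact: (@filterE _ (nbhs z)). Qed.

Lemma cvC_near T (F : set_system T) {FF : Filter F} (f g : T -> C) (l : C) :
  (\forall t \near F, f t = g t) -> cvC F f l -> cvC F g l.
Proof.
by move=> E /cvgCP H; apply/cvgCP => e /H; apply: filterS2 E => t ->.
Qed.

Lemma cvC_comp T (F : set_system T) {FF : Filter F} (g : T -> C) (f : C -> C) z (l : C) :
  cvC F g z -> cvC (nbhs z) f l -> cvC F (fun t => f (g t)) l.
Proof.
move=> [gz] /cvgCP H; apply/cvgCP => e /H K; exact: (gz _ K).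
Qed.

Lemma cvC_nbhs T (F : set_system T) {FF : Filter F} (g : T -> C) z (P : C -> Prop) :
  cvC F g z -> (\forall w \near z, P w) -> \forall t \near F, P (g t).
Proof. by move=> [gz] K; exact: (gz _ K). Qed.

Lemma cvgC_norm T (F : set_system T) {FF : Filter F} (f : T -> C) (l : C) :
  cvC F f l <-> (fun t => normc (l - f t)) @ F --> (0 : R).
Proof.
rewrite cvgCP; split=> H.
  apply/cvgrPdist_lt => e /H; apply: filterS => t.
  by rewrite sub0r normrN ger0_norm ?normc_ge0.
move=> e e0; move/cvgrPdist_lt: H => /(_ e e0).
by apply: filterS => t; rewrite sub0r normrN ger0_norm ?normc_ge0.
Qed.

Lemma cvgC_normc T (F : set_system T) {FF : Filter F} (f : T -> C) (l : C) :
  cvC F f l -> (fun t => normc (f t)) @ F --> normc l.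
Proof.
move/cvgCP=> H; apply/cvgrPdist_lt => e /H; apply: filterS => t.
apply: le_lt_trans; rewrite ler_norml; apply/andP; split.
  have := normcD (f t - l) l; rewrite subrK normc_distC; lra.
by have := normcD (l - f t) (f t); rewrite subrK; lra.
Qed.

Lemma cvg_re T (F : set_system T) {FF : Filter F} (f : T -> C) (l : C) :
  cvC F f l -> (fun t => re (f t)) @ F --> re l.
Proof.
move/cvgCP=> H; apply/cvgrPdist_lt => e /H; apply: filterS => t.
by apply: le_lt_trans; rewrite -[re l - _](raddfB (@complex.Re R : Rcomplex R -> R)) re_le.
Qed.

Lemma cvg_im T (F : set_system T) {FF : Filter F} (f : T -> C) (l : C) :
  cvC F f l -> (fun t => im (f t)) @ F --> im l.
Proof.
move/cvgCP=> H; apply/cvgrPdist_lt => e /H; apply: filterS => t.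
by apply: le_lt_trans; rewrite -[im l - _](raddfB (@complex.Im R : Rcomplex R -> R)) im_le.
Qed.

Lemma cvg_reim T (F : set_system T) {FF : Filter F} (f : T -> C) (a b : R) :
  (fun t => re (f t)) @ F --> a -> (fun t => im (f t)) @ F --> b ->
  cvC F f (a +i* b)%C.
Proof.
move=> /cvgrPdist_lt Ha /cvgrPdist_lt Hb; apply/cvgCP => e e0.
have e2 : 0 < e / 2 by rewrite divr_gt0.
near=> t.
have h1 : `|a - re (f t)| < e / 2 by near: t; exact: Ha.
have h2 : `|b - im (f t)| < e / 2 by near: t; exact: Hb.
apply: le_lt_trans (normc_le _) _.
by case: (f t) h1 h2 => c d /= h1 h2; lra.
Unshelve. all: by end_near. Qed.

Lemma limC_unique T (F : set_system T) {FF : ProperFilter F} (f : T -> C) (a b : C) :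
  cvC F f a -> cvC F f b -> a = b.
Proof. by move=> [Ha] [Hb]; apply: cvg_unique Ha Hb; exact: norm_hausdorff. Qed.

Lemma limCE T (F : set_system T) {FF : ProperFilter F} (f : T -> C) (a : C) :
  cvC F f a -> lim (f @ F) = a.
Proof. by case; apply: cvg_lim; exact: norm_hausdorff. Qed.

Section CvgAlgebra.
Variables (T : Type) (F : set_system T).
Context {FF : Filter F}.
Implicit Types (f g : T -> C) (a b : C).

Lemma cvgCB f g a b :
  cvC F f a -> cvC F g b -> cvC F (fun t => f t - g t) (a - b).
Proof. by move=> [fa] [gb]; split; exact: (cvgB fa gb). Qed.

Lemma cvgCD f g a b :
  cvC F f a -> cvC F g b -> cvC F (fun t => f t + g t) (a + b).
Proof. by move=> [fa] [gb]; split; exact: (cvgD fa gb). Qed.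

Lemma cvgCN f a : cvC F f a -> cvC F (fun t => - f t) (- a).
Proof. by move=> [fa]; split; exact: (cvgN fa). Qed.

Lemma cvgCM f g a b :
  cvC F f a -> cvC F g b -> cvC F (fun t => f t * g t) (a * b).
Proof. by move=> [fa] [gb]; split; exact: (cvgM fa gb). Qed.

Lemma cvgCV f a : a != 0 -> cvC F f a -> cvC F (fun t => (f t)^-1) a^-1.
Proof. by move=> a0 [fa]; split; exact: (cvgV a0 fa). Qed.

Lemma cvgC_cst a : cvC F (fun _ : T => a) a.
Proof. by split; exact: cvg_cst. Qed.

Lemma cvgCX f a n : cvC F f a -> cvC F (fun t => f t ^+ n) (a ^+ n).
Proof.
move=> fa; elim: n => [|n IH]; first exact: cvgC_cst.
under eq_fun do rewrite exprS.
by rewrite exprS; exact: (cvgCM fa IH).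
Qed.

Lemma cvgC_sum n (f : nat -> T -> C) (a : nat -> C) :
  (forall i, cvC F (f i) (a i)) ->
  cvC F (fun t => \sum_(i < n) f i t) (\sum_(i < n) a i).
Proof.
move=> fa; elim: n => [|n IH].
  by under eq_fun do rewrite big_ord0; rewrite big_ord0; exact: cvgC_cst.
under eq_fun do rewrite big_ord_recr.
by rewrite big_ord_recr; exact: (cvgCD IH (fa n)).
Qed.

End CvgAlgebra.

Lemma normc_lim_le T (F : set_system T) {FF : ProperFilter F} (f : T -> C) (l : C) (B : R) :
  cvC F f l -> (\forall t \near F, normc (f t) <= B) -> normc l <= B.
Proof. by move=> /cvgC_normc fl H; exact: cvgr_to_le fl H. Qed.

Definition psum (a : nat -> C) (n : nat) : C := \sum_(i < n) a i.
Definition dominated_by (a : nat -> C) (M : nat -> R) := forall n, normc (a n) <= M n.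
Definition bounded_sums (M : nat -> R) := exists B, forall n, \sum_(i < n) M i <= B.
(** A sum only when the partial sums converge; convergence comes from a summable majorant or from an
    exhibited limit. *)
Definition csum (a : nat -> C) : C := lim (psum a @ \oo).

Lemma bounded_sums_cvg (M : nat -> R) : (forall n, 0 <= M n) -> bounded_sums M ->
  cvgn (fun n => \sum_(i < n) M i).
Proof.
move=> M0 [B MB]; apply: nondecreasing_is_cvgn.
  apply/nondecreasing_seqP => n.
  by rewrite big_ord_recr /= lerDl.
by exists B => _ [n _ <-].
Qed.

Lemma bounded_sums_le (M M' : nat -> R) : (forall n, M n <= M' n) ->
  bounded_sums M' -> bounded_sums M.
Proof.
by move=> MM [B HB]; exists B => n; apply: le_trans (HB n); exact: ler_sum.
Qed.

Lemma bounded_sumsZ (M : nat -> R) k : 0 <= k -> bounded_sums M ->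
  bounded_sums (fun n => k * M n).
Proof.
by move=> k0 [B HB]; exists (k * B) => n; rewrite -mulr_sumr ler_wpM2l.
Qed.

Lemma bounded_sums_tail (M : nat -> R) (e : R) : (forall n, 0 <= M n) ->
  bounded_sums M -> 0 < e ->
  exists N, forall n, \sum_(i < n) M (N + i)%N <= e.
Proof.
move=> M0 bM e0; have cM := bounded_sums_cvg M0 bM.
set l := lim _ in cM.
have /cvgrPdist_lt/(_ e e0) [N _ HN] := cM.
exists N => n; have := HN N (leqnn _).
have nd : nondecreasing_seq (fun n => \sum_(i < n) M i).
  by apply/nondecreasing_seqP => k; rewrite big_ord_recr /= lerDl.
have := nondecreasing_cvgn_le nd cM (N + n)%N.
rewrite big_split_ord /= => h1 /ltW; rewrite ler_norml => /andP[_].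
rewrite -/l in h1; lra.
Qed.

(** Completeness is used over the reals: the real and imaginary parts converge absolutely, and the
    limit is assembled from theirs. *)
Lemma psum_cvg (a : nat -> C) (M : nat -> R) :
  dominated_by a M -> bounded_sums M -> cvC \oo (psum a) (csum a).
Proof.
move=> aM bM.
have M0 n : 0 <= M n by apply: le_trans (normc_ge0 _) (aM n).
suff [l Hl] : exists l : C, cvC \oo (psum a) l.
  by rewrite (_ : csum a = l) //; exact: limCE Hl.
have aux (g : C -> R) : (forall z, `|g z| <= normc z) -> g 0 = 0 -> {morph g : x y / x + y} ->
    exists l : R, (fun n => g (psum a n)) @ \oo --> l.
  move=> gl g0 gD.
  have Hc : cvgn (series (fun n => g (a n))).
    apply: normed_cvg; apply: nondecreasing_is_cvgn.
      by apply/nondecreasing_seqP => n; rewrite /normed_series_of /= !seriesEnat /= big_nat_recr //= lerDl.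
    case: bM => B HB; exists B => _ [n _ <-]; rewrite /normed_series_of seriesEord /=.
    by apply: le_trans (HB n); apply: ler_sum => i _; exact: le_trans (gl _) (aM _).
  exists (limn (series (fun n => g (a n)))).
  rewrite (_ : (fun n => _) = series (fun n => g (a n))) //.
  by apply/funext => n; rewrite /series /psum /= big_mkord (big_morph g gD g0).
have [x Hx] := aux (@complex.Re R) re_le erefl (raddfD (@complex.Re R : Rcomplex R -> R)).
have [y Hy] := aux (@complex.Im R) im_le erefl (raddfD (@complex.Im R : Rcomplex R -> R)).
by exists ((x +i* y)%C); apply: cvg_reim.
Qed.

Lemma psum_shift (a : nat -> C) N n :
  psum a (N + n) = psum a N + \sum_(i < n) a (N + i)%N.
Proof. by rewrite /psum big_split_ord. Qed.

Lemma csum_tail (a : nat -> C) (M : nat -> R) N (e : R) :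
  dominated_by a M -> bounded_sums M ->
  (forall n, \sum_(i < n) M (N + i)%N <= e) -> normc (csum a - psum a N) <= e.
Proof.
move=> aM bM H; have ca := psum_cvg aM bM.
apply: (normc_lim_le (cvgCB ca (@cvgC_cst _ _ _ (psum a N)))).
exists N => // n /= /subnKC <-; rewrite psum_shift addrAC subrr add0r.
by apply: le_trans (H (n - N)%N); apply: le_trans (normc_sum _ _ _) _; exact: ler_sum.
Qed.

Lemma csum_le (a : nat -> C) (M : nat -> R) B :
  dominated_by a M -> (forall n, \sum_(i < n) M i <= B) -> normc (csum a) <= B.
Proof.
move=> aM bM; have := @csum_tail a M 0 B aM _ bM.
by rewrite /psum big_ord0 subr0; apply; exists B.
Qed.

(** Dominated convergence for series. Beyond some N the common majorant sums to at most e / 3, so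
    only finitely many terms have to converge. *)
Lemma tannery T (F : set_system T) {FF : ProperFilter F} (a : T -> nat -> C)
    (al : nat -> C) (M : nat -> R) :
  (forall n, cvC F (fun u => a u n) (al n)) ->
  (\forall u \near F, dominated_by (a u) M) -> bounded_sums M ->
  cvC F (fun u => csum (a u)) (csum al).
Proof.
move=> cva domM bM.
have M0 n : 0 <= M n.
  by have /filter_ex [u /(_ n)] := domM; apply: le_trans; exact: normc_ge0.
have alM : dominated_by al M.
  move=> n; apply: (normc_lim_le (cva n)).
  by apply: filterS domM => u; exact.
apply/cvgCP => e e0; have e3 : 0 < e / 3 by rewrite divr_gt0.
have [N HN] := bounded_sums_tail M0 bM e3.
have /cvgCP/(_ _ e3) Hp : cvC F (fun u => psum (a u) N) (psum al N).
  exact: (@cvgC_sum _ _ _ N (fun i u => a u i)).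
near=> u.
have dx : dominated_by (a u) M by near: u; exact: domM.
have h1 := csum_tail dx bM HN; have h2 := csum_tail alM bM HN.
have h3 : normc (psum al N - psum (a u) N) < e / 3 by near: u; exact: Hp.
rewrite (_ : csum al - csum (a u) = (csum al - psum al N) +
  (psum al N - psum (a u) N) - (csum (a u) - psum (a u) N)); last by ring.
apply: le_lt_trans (normcB _ _) _.
have := normcD (csum al - psum al N) (psum al N - psum (a u) N).
lra.
Unshelve. all: by end_near. Qed.

End ComplexLimits.
Arguments cvgC_cst {R T F FF} a.

(** * Complex derivatives *)

Section Derivatives.
Variable R : realType.
Local Notation C := (Cplx R).

(* Caratheodory's form of differentiability, for which the chain rule is immediate. *)
Definition has_deriv (f : C -> C) (z d : C) :=
  exists2 phi : C -> C,
    (\forall w \near z, f w - f z = (w - z) * phi w) & cvC (nbhs z) phi d.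

Lemma nbhsC_ball (z : C) (P : set C) :
  nbhs z P <-> exists2 e : R, 0 < e & forall w, normc (w - z) < e -> P w.
Proof.
split=> [|[e e0 H]].
  move=> /nbhs_ballP[e /= e0 He].
  have Ee : e = (re e)%:C by rewrite RRe_real // gtr0_real.
  exists (re e); first by rewrite Ee ltcR in e0.
  move=> w wz; apply: He; rewrite /ball /= normE Ee ltcR.
  by rewrite normc_distC.
apply/nbhs_ballP; exists (e%:C); first by rewrite /= ltcR.
by move=> w; rewrite /ball /= normE ltcR normc_distC; exact: H.
Qed.

Lemma cvgC_id (z : C) : cvC (nbhs z) (fun w => w) z.
Proof. by split; exact: cvg_id. Qed.

Lemma has_deriv_cvg f z d : has_deriv f z d -> cvC (nbhs z) f (f z).
Proof.
move=> [phi H cphi].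
pose proof (cvgCD (cvgC_cst (f z)) (cvgCM (cvgCB (cvgC_id z) (cvgC_cst z)) cphi)) as K.
move: K.
have -> : f z + (z - z) * d = f z by rewrite subrr mul0r addr0.
by apply: cvC_near; apply: filterS H => w <-; rewrite addrC subrK.
Qed.

Lemma has_deriv_near f g z d : (\forall w \near z, f w = g w) -> has_deriv f z d -> has_deriv g z d.
Proof.
move=> E [phi H cphi]; exists phi => //.
have Ez : f z = g z by exact: nbhs_singleton E.
by near=> w; rewrite -Ez -(near E w) //; near: w.
Unshelve. all: by end_near. Qed.

Lemma has_deriv_cst c z : has_deriv (fun=> c) z 0.
Proof.
exists (fun=> 0); last exact: (cvgC_cst 0).
by apply: nearC_all => w; rewrite subrr mulr0.
Qed.

Lemma has_deriv_id z : has_deriv id z 1.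
Proof.
exists (fun=> 1); last exact: (cvgC_cst 1).
by apply: nearC_all => w; rewrite mulr1.
Qed.

Lemma has_derivD f g z d e :
  has_deriv f z d -> has_deriv g z e -> has_deriv (fun w => f w + g w) z (d + e).
Proof.
move=> [phi Hf cf] [psi Hg cg].
exists (fun w => phi w + psi w); last exact: (cvgCD cf cg).
near=> w; rewrite opprD addrACA mulrDr; congr (_ + _); near: w; [exact: Hf|exact: Hg].
Unshelve. all: by end_near. Qed.

Lemma has_derivM f g z d e :
  has_deriv f z d -> has_deriv g z e ->
  has_deriv (fun w => f w * g w) z (d * g z + f z * e).
Proof.
move=> Df Dg; have cG := has_deriv_cvg Dg.
move: Df Dg => [phi Hf cf] [psi Hg cg].
exists (fun w => phi w * g w + f z * psi w).
  near=> w; rewrite (_ : f w * g w - _ = (f w - f z) * g w + f z * (g w - g z)); last by ring.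
  have -> : f w - f z = (w - z) * phi w by near: w.
  have -> : g w - g z = (w - z) * psi w by near: w.
  by ring.
exact: (cvgCD (cvgCM cf cG) (cvgCM (cvgC_cst (f z)) cg)).
Unshelve. all: by end_near. Qed.

Lemma has_derivZ f z d c : has_deriv f z d -> has_deriv (fun w => c * f w) z (c * d).
Proof.
by move=> Df; have := has_derivM (has_deriv_cst c z) Df; rewrite mul0r add0r.
Qed.

Lemma has_derivN f z d : has_deriv f z d -> has_deriv (fun w => - f w) z (- d).
Proof.
move=> /(has_derivZ (-1)); rewrite mulN1r; apply: has_deriv_near.
by apply: nearC_all => w; rewrite mulN1r.
Qed.

Lemma has_derivB f g z d e :
  has_deriv f z d -> has_deriv g z e -> has_deriv (fun w => f w - g w) z (d - e).
Proof. by move=> Df /has_derivN; exact: has_derivD. Qed.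

Lemma has_deriv_comp f g z d e :
  has_deriv g z d -> has_deriv f (g z) e -> has_deriv (fun w => f (g w)) z (e * d).
Proof.
move=> Dg [psi Hf cf]; have cG := has_deriv_cvg Dg.
move: Dg => [phi Hg cg].
exists (fun w => psi (g w) * phi w).
  near=> w.
  have -> : f (g w) - f (g z) = (g w - g z) * psi (g w).
    by near: w; exact: (cvC_nbhs cG Hf).
  have -> : g w - g z = (w - z) * phi w by near: w.
  by rewrite -mulrA; congr (_ * _); rewrite mulrC.
exact: (cvgCM (cvC_comp cG cf) cg).
Unshelve. all: by end_near. Qed.

Lemma near_neq (z : C) (c : C) (f : C -> C) : cvC (nbhs z) f c -> c != 0 ->
  \forall w \near z, f w != 0.
Proof.
move=> /cvgCP fc c0; have := fc (normc c); rewrite normc_gt0 => /(_ c0).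
by apply: filterS => w; apply: contraTneq => ->; rewrite subr0 ltxx.
Qed.

Lemma has_derivV f z d : has_deriv f z d -> f z != 0 ->
  has_deriv (fun w => (f w)^-1) z (- d / f z ^+ 2).
Proof.
move=> Df fz0; have cF := has_deriv_cvg Df; have nz := near_neq cF fz0.
move: Df => [phi Hf cf].
exists (fun w => - phi w / (f w * f z)).
  near=> w.
  have fw0 : f w != 0 by near: w.
  have E : f w - f z = (w - z) * phi w by near: w.
  rewrite (_ : (w - z) * (- phi w / (f w * f z)) = - (f w - f z) / (f w * f z)).
    by field; rewrite fw0 fz0.
  by rewrite E mulrA mulrN.
rewrite expr2; apply: (cvgCM (cvgCN cf) (cvgCV _ (cvgCM cF (cvgC_cst (f z))))).
by rewrite mulf_neq0.
Unshelve. all: by end_near. Qed.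

Lemma has_derivX f z d n : has_deriv f z d ->
  has_deriv (fun w => f w ^+ n) z (n%:R * f z ^+ n.-1 * d).
Proof.
move=> Df; elim: n => [|n IH].
  by rewrite !mul0r; exact: (has_deriv_cst 1).
have := has_derivM Df IH.
rewrite (_ : d * _ + _ = n.+1%:R * f z ^+ n * d).
  by apply: has_deriv_near; apply: nearC_all => w; rewrite exprS.
case: n {IH} => [|n]; first by rewrite expr0 mul0r mul0r mulr0; ring.
by rewrite /= -[n.+2%:R]natr1 exprS; ring.
Qed.

(** The bridge to difference quotients, which gives both [derivable] and the uniqueness of the
    derivative. *)
Lemma has_deriv_quot_cvg f z d : has_deriv f z d ->
  cvC (0 : C)^' (fun h => h^-1 * (f (h + z) - f z)) d.
Proof.
move=> [phi Hf cf].
have S : cvC (0 : C)^' (fun h : C => h + z) z.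
  have W : cvC (0 : C)^' id 0 by split; exact: cvg_within.
  pose proof (cvgCD W (cvgC_cst z)) as K.
  move: K.
  have -> : 0 + z = z by rewrite add0r.
  exact.
pose proof (cvC_comp S cf) as c2.
apply: (cvC_near _ c2); near=> h.
have h0 : h != 0 by near: h; exact: nbhs_dnbhs_neq.
have -> : f (h + z) - f z = (h + z - z) * phi (h + z).
  by near: h; exact: (cvC_nbhs S Hf).
by rewrite /= addrK mulKf.
Unshelve. all: by end_near. Qed.

Lemma has_deriv_derivable f z d : has_deriv f z d -> derivable f z 1.
Proof.
move=> /has_deriv_quot_cvg H; apply/cvg_ex; exists d.
have [] : cvC (0 : C)^' (fun h => h^-1 *: ((f \o shift z) (h *: 1) - f z)) d.
  by apply: (cvC_near _ H); apply: (@filterE _ (0^' : set_system C)) => h; rewrite /= [h *: 1]mulr1.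
exact.
Qed.

Lemma has_deriv_unique f z d e : has_deriv f z d -> has_deriv f z e -> d = e.
Proof.
move=> /has_deriv_quot_cvg H1 /has_deriv_quot_cvg H2; exact: (limC_unique H1 H2).
Qed.

End Derivatives.

(** * The function e(z), its derivative, and functions with zero derivative *)

Section Exponential.
Variable R : realType.
Local Notation C := (Cplx R).
Implicit Types (z w : C).

Definition twopii : C := (0 +i* (2 * pi))%C.

Lemma reD z w : re (z + w) = re z + re w.
Proof. by case: z; case: w. Qed.
Lemma imD z w : im (z + w) = im z + im w.
Proof. by case: z; case: w. Qed.
Lemma reN z : re (- z) = - re z.
Proof. by case: z. Qed.
Lemma imN z : im (- z) = - im z.
Proof. by case: z. Qed.
Lemma reM z w : re (z * w) = re z * re w - im z * im w.
Proof. by case: z; case: w. Qed.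
Lemma imM z w : im (z * w) = re z * im w + im z * re w.
Proof. by case: z; case: w. Qed.
Lemma re_nat n : re (n%:R : C) = n%:R.
Proof. by rewrite -(rmorph_nat (real_complex R)). Qed.
Lemma im_nat n : im (n%:R : C) = 0.
Proof. by rewrite -(rmorph_nat (real_complex R)). Qed.

Lemma eqC z w : re z = re w -> im z = im w -> z = w.
Proof. by case: z; case: w => /= ? ? ? ? -> ->. Qed.

Lemma eeD z w : ee (z + w) = ee z * ee w.
Proof.
rewrite /ee reD imD !mulrDr opprD expRD cosD sinD.
by apply: eqC => /=; ring.
Qed.

Lemma ee0 : ee (0 : C) = 1.
Proof. by rewrite /ee /= !mulr0 oppr0 expR0 cos0 sin0 !mulr1 mulr0. Qed.

Lemma eeN z : ee (- z) = (ee z)^-1.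
Proof.
have H : ee z * ee (- z) = 1 by rewrite -eeD subrr ee0.
have nz : ee z != 0 by apply: contra_eq_neq H => ->; rewrite mul0r eq_sym oner_eq0.
by apply: (mulfI nz); rewrite H mulfV.
Qed.

Lemma ee_neq0 z : ee z != 0.
Proof.
apply/eqP => z0; have := eeD z (- z); rewrite subrr ee0 z0 mul0r => /eqP.
by rewrite oner_eq0.
Qed.

Lemma eeB z w : ee (z - w) = ee z / ee w.
Proof. by rewrite eeD eeN. Qed.

Lemma eeMn n z : ee (n%:R * z) = ee z ^+ n.
Proof.
elim: n => [|n IH]; first by rewrite mul0r ee0.
by rewrite -natr1 mulrDl mul1r eeD IH exprSr.
Qed.

Lemma ee1 : ee (1 : C) = 1.
Proof.
rewrite /ee /= !mulr0 oppr0 expR0 !mul1r !mulr1 mulrC mulr_natr cos2pi sin2pi.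
by [].
Qed.

Lemma ee_half : ee (2^-1 : C) = -1.
Proof.
have -> : (2^-1 : C) = (2^-1 : R)%:C by rewrite fmorphV rmorph_nat.
rewrite /ee /= !mulr0 oppr0 expR0 !mul1r mulrAC divff ?pnatr_eq0 // mul1r.
by rewrite cospi sinpi; apply: eqC => /=; rewrite ?oppr0.
Qed.

Lemma ee_nat n : ee (n%:R : C) = 1.
Proof. by rewrite -[n%:R]mulr1 eeMn ee1 expr1n. Qed.

Lemma ee_int (n : int) : ee (n%:~R : C) = 1.
Proof. by case: n => n; rewrite ?NegzE ?intrN ?eeN ee_nat ?invr1. Qed.

Lemma ee_shift z n : ee (z + n%:R) = ee z.
Proof. by rewrite eeD ee_nat mulr1. Qed.

Lemma normc_ee z : normc (ee z) = expR (- (2 * pi * im z)).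
Proof.
rewrite /ee; set r := expR _ ; set v := 2 * pi * re z => /=.
rewrite !exprMn -mulrDr cos2Dsin2 mulr1 sqrtr_sqr ger0_norm //.
exact: expR_ge0.
Qed.

Lemma normc_ee_lt1 z : 0 < im z -> normc (ee z) < 1.
Proof.
by move=> z0; rewrite normc_ee expR_lt1 oppr_lt0 !mulr_gt0 ?pi_gt0.
Qed.

Lemma real_quotient (f : R -> R) (d : R) : is_derive (0 : R) (1 : R) f d ->
  exists2 phi : R -> R, (forall h, f h - f 0 = h * phi h) & phi @ (0 : R) --> d.
Proof.
move=> [fd fE].
exists (fun h => if h == 0 then d else h^-1 * (f h - f 0)).
  by move=> h; case: eqP => [->|/eqP h0]; rewrite ?subrr ?mul0r // mulVKf.
apply/cvgrPdist_lt => e e0.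
have /cvgrPdist_lt/(_ e e0) : (fun h => h^-1 *: ((f \o shift 0) (h *: 1) - f 0)) @ 0^' --> d.
  by rewrite -fE; exact: fd.
rewrite near_withinE; apply: filterS => h /=; case: eqP => [_ _|_ /(_ isT)].
  by rewrite subrr normr0.
by rewrite addr0 [h *: 1]mulr1.
Qed.

(** With u = -2 pi im h, v = 2 pi re h, and E, K, S the difference quotients at 0 of exp, cos, sin,
    the error e(h) - 1 - 2 pi i h has real part u (E(u) - 1) + exp(u) v K(v) and imaginary part v
    (exp(u) S(v) - 1). Since |u| and |v| are at most 2 pi |h|, dividing by |h| leaves [bnd h], which
    tends to 0. *)
Lemma ee_quotient : exists2 phi : C -> C,
  (forall h, ee h - 1 = h * phi h) & cvC (nbhs (0 : C)) phi twopii.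
Proof.
have dE : is_derive (0 : R) (1 : R) (@expR R) 1 by apply: is_derive_eq; exact: expR0.
have dS : is_derive (0 : R) (1 : R) (@sin R) 1 by apply: is_derive_eq; exact: cos0.
have dK : is_derive (0 : R) (1 : R) (@cos R) 0.
  by apply: is_derive_eq; rewrite sin0 oppr0.
have [E HE cE] := real_quotient dE.
have [S HS cS] := real_quotient dS.
have [K HK cK] := real_quotient dK.
pose u (h : C) : R := - (2 * pi * im h).
pose v (h : C) : R := 2 * pi * re h.
pose bnd (h : C) : R := 2 * pi * (`|E (u h) - 1| + expR (u h) * `|K (v h)| + `|expR (u h) * S (v h) - 1|).
exists (fun h => if h == 0 then twopii else h^-1 * (ee h - 1)).
  by move=> h; case: eqP => [->|/eqP h0]; rewrite ?ee0 ?subrr ?mul0r // mulVKf.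
have bound h : normc (twopii - (if h == 0 then twopii else h^-1 * (ee h - 1))) <= bnd h.
  case: eqP => [->|/eqP h0].
    by rewrite subrr normc0 mulr_ge0 ?addr_ge0 ?mulr_ge0 ?normr_ge0 ?expR_ge0 // ltW ?pi_gt0.
  rewrite (_ : twopii - _ = - (ee h - 1 - twopii * h) / h); last by field.
  rewrite normcM normcN normcV ler_pdivrMr ?normc_gt0 //.
  apply: le_trans (normc_le _) _.
  have Hu : `|u h| <= 2 * pi * normc h.
    rewrite /u normrN normrM ger0_norm ?ler_wpM2l ?im_le // ?mulr_ge0 ?ltW ?pi_gt0 //.
  have Hv : `|v h| <= 2 * pi * normc h.
    rewrite /v normrM ger0_norm ?ler_wpM2l ?re_le // ?mulr_ge0 ?ltW ?pi_gt0 //.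
  have Er : re (ee h - 1 - twopii * h) = u h * (E (u h) - 1) + expR (u h) * (v h * K (v h)).
    rewrite !reD !reN reM /= -/(u h) -/(v h) mul0r sub0r.
    have := HE (u h); rewrite expR0 => h1; have := HK (v h); rewrite cos0 => h2.
    rewrite -h2 mulrBr mulr1 -h1 /u; ring.
  have Ei : im (ee h - 1 - twopii * h) = v h * (expR (u h) * S (v h) - 1).
    rewrite !imD !imN imM /= -/(u h) -/(v h) mul0r add0r.
    have := HS (v h); rewrite sin0 subr0 => ->; rewrite -/(v h); ring.
  rewrite Er Ei; apply: le_trans (lerD (ler_normD _ _) (lexx _)) _.
  rewrite (normrM (u h)) (normrM (expR (u h))) (normrM (v h) (K _)) (normrM (v h)) (ger0_norm (expR_ge0 _)) /bnd.
  have a1 := ler_wpM2r (normr_ge0 (E (u h) - 1)) Hu.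
  have a2 := ler_wpM2r (normr_ge0 (K (v h))) Hv.
  have a3 := ler_wpM2r (normr_ge0 (expR (u h) * S (v h) - 1)) Hv.
  have a4 := ler_wpM2l (expR_ge0 (u h)) a2.
  lra.
have cu : u h @[h --> (0 : C)] --> (0 : R).
  have H := cvg_im (@cvgC_id R 0).
  have -> : (0 : R) = - (2 * pi * im (0 : C)) by rewrite /= mulr0 oppr0.
  apply: cvgN; apply: cvgM; [exact: cvg_cst|exact: H].
have cv : v h @[h --> (0 : C)] --> (0 : R).
  have H := cvg_re (@cvgC_id R 0).
  have -> : (0 : R) = 2 * pi * re (0 : C) by rewrite /= mulr0.
  apply: cvgM; [exact: cvg_cst|exact: H].
have ce : expR (u h) @[h --> (0 : C)] --> (1 : R).
  rewrite -expR0; apply: (continuous_cvg _ _ cu); exact: continuous_expR.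
have cEu : E (u h) @[h --> (0 : C)] --> (1 : R) by apply: (cvg_comp _ _ cu cE).
have cKv : K (v h) @[h --> (0 : C)] --> (0 : R) by apply: (cvg_comp _ _ cv cK).
have cSv : S (v h) @[h --> (0 : C)] --> (1 : R) by apply: (cvg_comp _ _ cv cS).
have cb : bnd h @[h --> (0 : C)] --> (0 : R).
  have -> : (0 : R) = 2 * pi * (`|1 - 1 : R| + 1 * `|0 : R| + `|1 * 1 - 1 : R|).
    by rewrite mulr1 subrr !normr0 mulr0 !addr0 mulr0.
  apply: cvgM; first exact: cvg_cst.
  apply: cvgD; first apply: cvgD.
  - by apply: cvg_norm; apply: cvgB => //; exact: cvg_cst.
  - by apply: cvgM => //; exact: cvg_norm.
  - by apply: cvg_norm; apply: cvgB; [exact: cvgM|exact: cvg_cst].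
apply/cvgC_norm; apply: (@squeeze_cvgr _ _ _ _ (cst 0) bnd) => //; last exact: cvg_cst.
by apply: nearC_all => h; rewrite normc_ge0 bound.
Qed.

Lemma has_deriv_ee z : has_deriv (@ee R) z (twopii * ee z).
Proof.
have [phi H cphi] := ee_quotient.
exists (fun w => phi (w - z) * ee z).
  apply: nearC_all => w; rewrite mulrA -H mulrBl mul1r -eeD subrK //.
apply: cvgCM; last exact: cvgC_cst.
pose proof (cvgCB (cvgC_id z) (cvgC_cst z)) as S; rewrite subrr in S.
exact: (cvC_comp S cphi).
Qed.

Lemma has_deriv_eeZ c z : has_deriv (fun w => ee (c * w)) z (twopii * c * ee (c * z)).
Proof.
have := has_deriv_comp (has_derivZ c (has_deriv_id z)) (has_deriv_ee (c * z)).
by rewrite mulr1 mulrAC.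
Qed.

Lemma is_deriveP (f : R -> R) (s d : R) :
  (fun h : R => h^-1 * (f (h + s) - f s)) @ (0 : R)^' --> d -> is_derive s (1 : R) f d.
Proof.
move=> H; have H' : (fun h : R => h^-1 *: ((f \o shift s) (h *: 1) - f s)) @ (0 : R)^' --> d.
  by rewrite (_ : (fun h => _) = fun h : R => h^-1 * (f (h + s) - f s)) //;
     apply/funext => h; rewrite /= [h *: 1]mulr1.
by apply: DeriveDef; [apply/cvg_ex; exists d|exact: cvg_lim H'].
Qed.

(** The real mean value theorem along the segment, applied separately to the real and the imaginary
    part. *)
Lemma has_deriv0_const (f : C -> C) z w :
  (forall t : R, 0 <= t <= 1 -> has_deriv f (z + t%:C * (w - z)) 0) -> f z = f w.
Proof.
move=> df.
pose g (s : R) : C := z + s%:C * (w - z).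
have key (pr : C -> R) : (forall a, `|pr a| <= normc a) -> pr 0 = 0 ->
    (forall a b, pr (a - b) = pr a - pr b) ->
    forall s : R, 0 <= s <= 1 -> is_derive s (1 : R) (fun s => pr (f (g s))) 0.
  move=> prn pr0 prB s s01; have [phi Hphi cphi] := df s s01.
  have gc : cvC (0 : R)^' (fun h => g (h + s)) (g s).
    apply/cvgCP => e e0; pose e' := e / (normc (w - z) + 1).
    have n0 : 0 < normc (w - z) + 1 by rewrite ltr_wpDl ?normc_ge0.
    have e'0 : 0 < e' by rewrite divr_gt0.
    near=> h.
    rewrite (_ : g s - g (h + s) = (- h)%:C * (w - z)); last first.
      by rewrite /g rmorphD rmorphN /=; ring.
    rewrite normcM normc_real normrN.
    have h1 : `|h| < e'.
      near: h; rewrite near_withinE; near=> h => _.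
      have : ball (0 : R) e' h by near: h; exact: nbhsx_ballx.
      by rewrite /ball /= sub0r normrN.
    have h2 : `|h| * (normc (w - z) + 1) < e by rewrite -ltr_pdivlMr.
    by have := normr_ge0 h; lra.
  pose proof (cvgC_normc (cvC_comp gc cphi)) as c2; rewrite normc0 in c2.
  apply: is_deriveP; apply/cvgr0Pnorm_le => e e0.
  have K : 0 < e / (normc (w - z) + 1).
    by rewrite divr_gt0 // ltr_wpDl ?normc_ge0.
  near=> h.
  have h0 : h != 0 by near: h; exact: nbhs_dnbhs_neq.
  rewrite -prB.
  have -> : f (g (h + s)) - f (g s) = (g (h + s) - g s) * phi (g (h + s)).
    by near: h; exact: (cvC_nbhs gc Hphi).
  have -> : g (h + s) - g s = h%:C * (w - z) by rewrite /g rmorphD /=; ring.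
  rewrite normrM normfV ler_pdivrMl ?normr_gt0 //; apply: le_trans (prn _) _.
  rewrite !normcM normc_real -mulrA ler_wpM2l ?normr_ge0 //.
  have : normc (phi (g (h + s))) < e / (normc (w - z) + 1).
    near: h; move/cvgrPdist_lt: c2 => /(_ _ K); apply: filterS => h.
    by rewrite sub0r normrN ger0_norm ?normc_ge0.
  rewrite ltr_pdivlMr; last by rewrite ltr_wpDl ?normc_ge0.
  have := normc_ge0 (phi (g (h + s))); lra.
have fin (pr : C -> R) : (forall a, `|pr a| <= normc a) -> pr 0 = 0 ->
    (forall a b, pr (a - b) = pr a - pr b) -> pr (f z) = pr (f w).
  move=> prn pr0 prB; have D := key pr prn pr0 prB.
  have [||c _] := @MVT_segment R (fun s => pr (f (g s))) (fun=> 0) 0 1 ler01.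
  - by move=> t; rewrite in_itv /= => /andP[/ltW t0 /ltW t1]; apply: D; rewrite t0.
  - apply: continuous_in_subspaceT => t; rewrite inE /= in_itv /= => /D H.
    by apply: differentiable_continuous; apply/derivable1_diffP.
  - rewrite mul0r /g /= => /eqP; rewrite subr_eq0 => /eqP.
    by rewrite rmorph1 rmorph0 mul0r addr0 mul1r addrC subrK.
apply: eqC; apply: fin; rewrite ?raddf0 //.
- exact: re_le.
- by move=> a b; rewrite reD reN.
- exact: im_le.
- by move=> a b; rewrite imD imN.
Unshelve. all: by end_near. Qed.

End Exponential.

(** * Power series and the Euler product *)

Section Convolution.
Variable K : comNzRingType.
Implicit Types (a b : nat -> K).

Definition conv a b (n : nat) : K := \sum_(i < n.+1) a i * b (n - i)%N.
Definition delta (m n : nat) : K := (n == m)%:R.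
(** Coefficients of 1 / (1 - q^m); [one_minus] has those of 1 - q^m. *)
Definition multiples (m n : nat) : K := (m %| n)%:R.
Definition one_minus (m n : nat) : K := delta 0 n - delta m n.

(** The triangle is cut into rows that are partial sums of b, into which a bound or a limit for b
    can be inserted. *)
Lemma triangle_sum a b N :
  \sum_(n < N) conv a b n = \sum_(i < N) a i * \sum_(j < N - i) b j.
Proof.
elim: N => [|N IH]; first by rewrite !big_ord0.
rewrite big_ord_recr /= IH /conv !big_ord_recr /= subnn subSnn.
rewrite big_ord1 addrA; congr (_ + _).
rewrite -big_split /=; apply: eq_bigr => i _.
by rewrite subSn ?big_ord_recr ?mulrDr //= ltnW.
Qed.

Lemma conv_pow a b (q : K) n :
  conv a b n * q ^+ n = conv (fun i => a i * q ^+ i) (fun i => b i * q ^+ i) n.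
Proof.
rewrite /conv mulr_suml; apply: eq_bigr => i _.
have -> : q ^+ n = q ^+ (n - i) * q ^+ i by rewrite -exprD subnK // -ltnS.
by ring.
Qed.

Lemma conv_multiples_small a m n : (n < m)%N -> conv a (multiples m) n = a n.
Proof.
move=> nm; rewrite /conv big_ord_recr /= subnn /multiples dvdn0 mulr1.
rewrite big1 ?add0r // => i _; rewrite gtnNdvd ?mulr0 ?subn_gt0 //.
by rewrite (leq_ltn_trans (leq_subr _ _)).
Qed.

Lemma conv_delta a m n : conv a (delta m) n = if (m <= n)%N then a (n - m)%N else 0.
Proof.
rewrite /conv /delta; case: leqP => mn.
  have k : (n - m < n.+1)%N by rewrite ltnS leq_subr.
  rewrite (bigD1 (Ordinal k)) //= subKn // eqxx mulr1 big1 ?addr0 // => i.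
  rewrite -val_eqE /= => ne; have := ltn_ord i; rewrite ltnS => lin.
  case: eqP => [E|]; last by rewrite mulr0.
  by rewrite -E subKn ?eqxx in ne.
rewrite big1 // => i _; case: eqP => [E|]; last by rewrite mulr0.
by move: mn; rewrite -E ltnNge leq_subr.
Qed.

Lemma conv_one_minus a m n :
  conv a (one_minus m) n = a n - if (m <= n)%N then a (n - m)%N else 0.
Proof.
have -> : conv a (one_minus m) n = conv a (delta 0) n - conv a (delta m) n.
  by rewrite /conv -sumrB; apply: eq_bigr => i _; rewrite mulrBr.
by rewrite !conv_delta /= subn0.
Qed.

Lemma multiples_inverse m n : (0 < m)%N -> conv (multiples m) (one_minus m) n = delta 0 n.
Proof.
move=> m0; rewrite conv_one_minus /multiples /delta; case: leqP => mn.
  rewrite dvdn_subl // subrr; case: eqP => // n0.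
  by move: mn m0; rewrite n0 leqn0 => /eqP ->.
by case: n mn => [|n] mn; rewrite ?dvdn0 ?subr0 // gtnNdvd // subrr.
Qed.

End Convolution.

Section Partitions.
Variable R : realType.
Local Notation C := (Cplx R).

(* Partitions of [n] into parts at most [M], as coefficients of
   1 / ((1 - q) ... (1 - q^M)). *)
Fixpoint parts (M : nat) : nat -> R :=
  if M is M'.+1 then conv (parts M') (multiples R M) else delta R 0.
(** Coefficients of (1 - q) ... (1 - q^M). *)
Fixpoint euler_coef (M : nat) : nat -> C :=
  if M is M'.+1 then conv (euler_coef M') (one_minus C M) else delta C 0.

Lemma parts_ge0 M n : 0 <= parts M n.
Proof.
elim: M n => [|M IH] n; first by rewrite /= /delta ler0n.
by apply: sumr_ge0 => i _; rewrite mulr_ge0 ?ler0n.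
Qed.

Lemma parts_leS M n : parts M n <= parts M.+1 n.
Proof.
rewrite [leRHS]/= /conv big_ord_recr /= subnn /multiples dvdn0 mulr1 lerDr.
by apply: sumr_ge0 => i _; rewrite mulr_ge0 ?ler0n ?parts_ge0.
Qed.

(** A factor 1 / (1 - q^m) with m > n leaves the coefficient of q^n alone. *)
Lemma parts_stable M n : (n <= M)%N -> parts M n = parts n n.
Proof.
move=> /subnKC <-; elim: (M - n)%N => [|k IH]; first by rewrite addn0.
by rewrite addnS /= conv_multiples_small // ltnS leq_addr.
Qed.

Lemma parts_le M n : parts M n <= parts n n.
Proof.
have [/parts_stable ->//|/ltnW /subnKC {2}<-] := leqP n M.
elim: (n - M)%N => [|k IH]; first by rewrite addn0.
by rewrite addnS (le_trans IH) ?parts_leS.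
Qed.

Lemma euler_coef_stable M n : (n <= M)%N -> euler_coef M n = euler_coef n n.
Proof.
move=> /subnKC <-; elim: (M - n)%N => [|k IH]; first by rewrite addn0.
by rewrite addnS /= conv_one_minus ltnNge leq_addr /= subr0.
Qed.

(** Coefficientwise, 1 - q^m is dominated by 1 / (1 - q^m), and convolution preserves domination.
    Partition numbers thus majorize the Euler products as well as their inverses. *)
Lemma euler_coef_le M n : normc (euler_coef M n) <= parts M n.
Proof.
elim: M n => [|M IH] n.
  by rewrite /= /delta normc_nat.
apply: le_trans (normc_sum _ _ _) _; apply: ler_sum => i _.
rewrite normcM ler_pM ?normc_ge0 // /one_minus /delta /multiples.
case: (eqVneq (n - i)%N 0%N) => [->|ne]; first by rewrite dvdn0 eq_sym; case: eqP => _; rewrite ?subr0 ?subrr ?normc1 ?normc0.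
case: eqP => [->|_]; first by rewrite dvdnn sub0r normcN normc1.
by rewrite subrr normc0 ler0n.
Qed.

End Partitions.

(** * Power series on the unit disc *)

Section PowerSeries.
Variable R : realType.
Local Notation C := (Cplx R).
Implicit Types (a b : nat -> C) (q : C) (r : R).

Definition disc_conv a :=
  forall r, 0 <= r < 1 -> bounded_sums (fun n => normc (a n) * r ^+ n).
Definition pser a q : C := csum (fun n => a n * q ^+ n).
(** The truncated exponent [n.-1] at n = 0 is cancelled by the factor n. *)
Definition dpser a q : C := csum (fun n => a n * (n%:R * q ^+ n.-1)).

Lemma psum_lim_csum a l : cvC \oo (psum a) l -> csum a = l.
Proof. exact: limCE. Qed.

Lemma pser_cvg a q : disc_conv a -> normc q < 1 ->
  cvC \oo (psum (fun n => a n * q ^+ n)) (pser a q).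
Proof.
move=> da q1; apply: (@psum_cvg _ _ (fun n => normc (a n) * normc q ^+ n)).
  by move=> n; rewrite normcM normcX.
by apply: da; rewrite normc_ge0.
Qed.

Lemma eq_csum (a b : nat -> C) : a =1 b -> csum a = csum b.
Proof. by move=> /funext ->. Qed.

Lemma psumD a b n : psum (fun i => a i + b i) n = psum a n + psum b n.
Proof. exact: big_split. Qed.

Lemma psumZ (c : C) a n : psum (fun i => c * a i) n = c * psum a n.
Proof. by rewrite /psum mulr_sumr. Qed.

Lemma csumD a b (M M' : nat -> R) :
  dominated_by a M -> bounded_sums M -> dominated_by b M' -> bounded_sums M' ->
  csum (fun i => a i + b i) = csum a + csum b.
Proof.
move=> aM bM bM' bM''; apply: psum_lim_csum.
apply: cvC_near (cvgCD (psum_cvg aM bM) (psum_cvg bM' bM'')).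
by exists 0%N => // n _; rewrite psumD.
Qed.

Lemma csumZ (c : C) a (M : nat -> R) : dominated_by a M -> bounded_sums M ->
  csum (fun i => c * a i) = c * csum a.
Proof.
move=> aM bM; apply: psum_lim_csum.
apply: cvC_near (cvgCM (cvgC_cst c) (psum_cvg aM bM)).
by exists 0%N => // n _; rewrite psumZ.
Qed.

Lemma csumB a b (M M' : nat -> R) :
  dominated_by a M -> bounded_sums M -> dominated_by b M' -> bounded_sums M' ->
  csum (fun i => a i - b i) = csum a - csum b.
Proof.
move=> aM bM bM' bM''; apply: psum_lim_csum.
apply: cvC_near (cvgCB (psum_cvg aM bM) (psum_cvg bM' bM'')).
by exists 0%N => // n _; rewrite /psum sumrB.
Qed.

Lemma csum_fin a N : (forall i, (N <= i)%N -> a i = 0) -> csum a = psum a N.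
Proof.
move=> a0; apply: psum_lim_csum; apply: (@cvC_near _ _ _ _ (fun=> psum a N)); last exact: cvgC_cst.
exists N => // n /= /subnKC <-; rewrite psum_shift big1 ?addr0 // => i _.
by rewrite a0 ?leq_addr.
Qed.

(* Bernoulli: [(s / r)^n >= n (s / r - 1)] absorbs the factor [n]. *)
Lemma nat_pow_le r s n : 0 < r -> r < s ->
  n%:R * r ^+ n.-1 <= (r * (s / r - 1))^-1 * s ^+ n.
Proof.
move=> r0 rs; set d := s / r - 1.
have d0 : 0 < d by rewrite subr_gt0 ltr_pdivlMr ?mul1r.
have E : s ^+ n = r ^+ n * (1 + d) ^+ n.
  by rewrite -exprMn /d; congr (_ ^+ n); field; exact: lt0r_neq0.
have B : n%:R * d <= (1 + d) ^+ n.
  elim: (n) => [|k IH]; first by rewrite mul0r expr0 ler01.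
  rewrite exprS -natr1; have : 1 <= (1 + d) ^+ k by rewrite exprn_ege1 // lerDl ltW.
  nra.
rewrite ler_pdivlMl ?mulr_gt0 // E.
case: n B {E} => [|n] B; first by rewrite !mul0r mulr0 mul1r expr0 ler01.
rewrite [_.+1.-1]/= (_ : r * d * (n.+1%:R * r ^+ n) = r ^+ n.+1 * (n.+1%:R * d)); last first.
  by rewrite exprS; ring.
by rewrite ler_wpM2l // exprn_ge0 // ltW.
Qed.

Lemma disc_conv_deriv a r : disc_conv a -> 0 < r < 1 ->
  bounded_sums (fun n => normc (a n) * (n%:R * r ^+ n.-1)).
Proof.
move=> da /andP[r0 r1]; pose s := (1 + r) / 2.
have rs : r < s by rewrite /s; lra.
have s01 : 0 <= s < 1 by rewrite /s; lra.
have k0 : 0 <= (r * (s / r - 1))^-1.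
  rewrite invr_ge0; apply: mulr_ge0; first exact: ltW.
  by rewrite subr_ge0 ler_pdivlMr // mul1r ltW.
apply: (bounded_sums_le _ (bounded_sumsZ k0 (da s s01))) => n.
by rewrite [leRHS]mulrCA ler_wpM2l ?normc_ge0 ?nat_pow_le.
Qed.

(** Factoring w^n - q^n by w - q turns the Caratheodory quotient into a series [T w], dominated by
    |a_n| n r^(n-1) on |w| < r. Its limit at q is the termwise one. *)
Lemma has_deriv_pser a q : disc_conv a -> normc q < 1 ->
  has_deriv (pser a) q (dpser a q).
Proof.
move=> da q1; pose r := (1 + normc q) / 2.
have q0 := normc_ge0 q.
have r01 : 0 < r < 1 by rewrite /r; lra.
have r01' : 0 <= r < 1 by lra.
have qr : normc q < r by rewrite /r; lra.
have near_r : \forall w \near q, normc w < r.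
  apply/nbhsC_ball; exists (r - normc q); first by rewrite subr_gt0.
  by move=> w; have := normcD (w - q) q; rewrite subrK; lra.
pose T w n : C := a n * \sum_(i < n) w ^+ (n.-1 - i) * q ^+ i.
have X w n : normc w < r -> normc (w ^+ n) <= r ^+ n.
  by move=> wr; rewrite normcX lerXn2r ?nnegrE ?normc_ge0 // ltW //; lra.
have DT w : normc w < r -> dominated_by (T w) (fun n => normc (a n) * (n%:R * r ^+ n.-1)).
  move=> wr n; rewrite /T normcM ler_wpM2l ?normc_ge0 //.
  apply: le_trans (normc_sum _ _ _) _.
  apply: (@le_trans _ _ (\sum_(i < n) r ^+ n.-1)); last by rewrite sumr_const card_ord mulr_natl.
  apply: ler_sum => i _; rewrite normcM.
  have -> : r ^+ n.-1 = r ^+ (n.-1 - i) * r ^+ i.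
    by rewrite -exprD subnK //; case: (n) i => [[]//|m] i; rewrite -ltnS.
  by rewrite ler_pM ?normc_ge0 ?X.
exists (fun w => csum (T w)).
  apply: filterS near_r => w wr.
  have D x : normc x < r -> dominated_by (fun n => a n * x ^+ n) (fun n => normc (a n) * r ^+ n).
    by move=> xr n; rewrite normcM ler_wpM2l ?normc_ge0 ?X.
  rewrite /pser -(csumB (D _ wr) (da _ r01') (D _ qr) (da _ r01')).
  rewrite -(csumZ _ (DT _ wr) (disc_conv_deriv da r01)).
  by apply: eq_csum => n; rewrite -mulrBr subrXX /T; ring.
apply: (tannery _ _ (disc_conv_deriv da r01)); last by apply: filterS near_r; exact: DT.
move=> n; rewrite /T.
have -> : n%:R * q ^+ n.-1 = \sum_(i < n) q ^+ (n.-1 - i) * q ^+ i.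
  rewrite -[n in n%:R]card_ord -sum1_card natr_sum mulr_suml; apply: eq_bigr => i _.
  by rewrite mul1r -exprD subnK //; case: (n) i => [[]//|m] i; rewrite -ltnS.
apply: cvgCM; first exact: cvgC_cst.
apply: (@cvgC_sum _ _ (nbhs q) _ n (fun i w => w ^+ (n.-1 - i) * q ^+ i) (fun i => q ^+ (n.-1 - i) * q ^+ i)) => i.
apply: cvgCM; last exact: cvgC_cst.
exact: cvgCX (cvgC_id q).
Qed.

Lemma disc_conv_conv a b : disc_conv a -> disc_conv b -> disc_conv (conv a b).
Proof.
move=> da db r r01; have [A HA] := da r r01; have [B HB] := db r r01.
have [r0 _] := andP r01.
exists (A * B) => n.
pose A' i : R := normc (a i) * r ^+ i; pose B' i : R := normc (b i) * r ^+ i.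
have H i : normc (conv a b i) * r ^+ i <= conv A' B' i.
  rewrite -conv_pow ler_wpM2r ?exprn_ge0 //; apply: le_trans (normc_sum _ _ _) _.
  by apply: ler_sum => k _; rewrite normcM.
apply: (@le_trans _ _ (\sum_(i < n) conv A' B' i)); first by apply: ler_sum => i _; exact: H.
rewrite triangle_sum.
apply: (@le_trans _ _ (\sum_(i < n) (normc (a i) * r ^+ i) * B)).
  by apply: ler_sum => i _; rewrite ler_wpM2l ?HB // mulr_ge0 ?normc_ge0 ?exprn_ge0.
rewrite -mulr_suml ler_wpM2r ?HA //.
by apply: le_trans (HB 0%N); rewrite big_ord0.
Qed.

Lemma pser_conv a b q : disc_conv a -> disc_conv b -> normc q < 1 ->
  pser (conv a b) q = pser a q * pser b q.
Proof.
move=> da db q1; have cb := pser_cvg db q1.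
have q01 : 0 <= normc q < 1 by rewrite normc_ge0.
have [B HB] := db _ q01.
(* Row i of the triangle of size N, extended by 0; as N grows it tends to a_i q^i times the full
   series of b. *)
pose T N i : C := if (i < N)%N then (a i * q ^+ i) * psum (fun j => b j * q ^+ j) (N - i) else 0.
have B0 : 0 <= B by apply: le_trans (HB 0%N); rewrite big_ord0.
have TM N : dominated_by (T N) (fun i => B * (normc (a i) * normc q ^+ i)).
  move=> i; rewrite /T; case: ltnP => _; last first.
    by rewrite normc0 !mulr_ge0 ?normc_ge0 ?exprn_ge0 ?normc_ge0.
  rewrite normcM mulrC normcM normcX ler_wpM2r ?mulr_ge0 ?exprn_ge0 ?normc_ge0 //.
  apply: le_trans (normc_sum _ _ _) _; apply: le_trans (HB (N - i)%N).
  by apply: ler_sum => j _; rewrite normcM normcX.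
have lim1 : cvC \oo (fun N => csum (T N)) (csum (fun i => (a i * q ^+ i) * pser b q)).
  apply: (tannery _ _ (bounded_sumsZ B0 (da _ q01))); last by exists 0%N => // N _; exact: TM.
  move=> i.
  have sh : cvC \oo (fun N => psum (fun j => b j * q ^+ j) (N - i)) (pser b q).
    apply/cvgCP => e e0; move/cvgCP: cb => /(_ e e0) [N0 _ HN0].
    by exists (N0 + i)%N => // N /= HN; apply: HN0; rewrite /= leq_subRL ?(leq_trans (leq_addl _ _) HN) // addnC.
  apply: cvC_near (cvgCM (cvgC_cst (a i * q ^+ i)) sh).
  by exists i.+1 => // N /= iN; rewrite /T iN.
have E : csum (fun i => (a i * q ^+ i) * pser b q) = pser a q * pser b q.
  have Da : dominated_by (fun n => a n * q ^+ n) (fun n => normc (a n) * normc q ^+ n).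
    by move=> n; rewrite normcM normcX.
  by rewrite [RHS]mulrC -(csumZ _ Da (da _ q01)); apply: eq_csum => i; rewrite mulrC.
refine (limC_unique (pser_cvg (disc_conv_conv da db) q1) _); rewrite -E.
apply: cvC_near lim1; exists 0%N => // N _.
rewrite (@csum_fin _ N) /psum; last by move=> i Ni; rewrite /T ltnNge Ni.
under eq_bigr => i _ do rewrite /T ltn_ord.
under [RHS]eq_bigr => i _ do rewrite conv_pow.
by rewrite triangle_sum.
Qed.

End PowerSeries.

(** * Euler's product and its inverse *)

Section EulerProduct.
Variable R : realType.
Local Notation C := (Cplx R).
Implicit Types (q : C) (r : R).

Lemma multiples_sum_le r m K : 0 <= r < 1 -> (0 < m)%N ->
  \sum_(j < K) multiples R m j * r ^+ j <= (1 - r ^+ m)^-1.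
Proof.
move=> /andP[r0 r1] m0; have rm : r ^+ m < 1 by rewrite exprn_ilt1 // -lt0n.
have rm0 : 0 <= r ^+ m by rewrite exprn_ge0.
(* Strong induction: the first m indices contribute at most 1, and the remaining sum is r^m times a
   shorter one. *)
have [k] := ubnP K; elim: k K => // k IH K; rewrite ltnS => Kk.
have small K' : (K' <= m)%N -> \sum_(j < K') multiples R m j * r ^+ j <= 1.
  case: K' => [|K'] Km; first by rewrite big_ord0 ler01.
  rewrite big_ord_recl /multiples dvdn0 mul1r expr0 big1 ?addr0 // => j _.
  rewrite gtnNdvd ?mul0r //= /bump /= add1n.
  by apply: leq_trans Km; rewrite ltnS.
have [Km|mK] := leqP K m.
  apply: le_trans (small _ Km) _; rewrite invr_ge1 ?unitfE; lra.
have -> : K = (m + (K - m))%N by rewrite subnKC // ltnW.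
rewrite big_split_ord /=.
have -> : \sum_(i < K - m) multiples R m (m + i) * r ^+ (m + i) =
    r ^+ m * \sum_(i < K - m) multiples R m i * r ^+ i.
  rewrite mulr_sumr; apply: eq_bigr => i _.
  by rewrite /multiples dvdn_addr // exprD; ring.
have h1 := small m (leqnn _).
have h2 : \sum_(i < K - m) multiples R m i * r ^+ i <= (1 - r ^+ m)^-1.
  by apply: IH; rewrite (leq_trans _ Kk) // ltn_subrL m0 (leq_trans _ mK).
have h3 := ler_wpM2l rm0 h2.
have E : (1 - r ^+ m)^-1 = 1 + r ^+ m * (1 - r ^+ m)^-1 by field; lra.
by rewrite E; lra.
Qed.

Lemma parts_sum_le r M N : 0 <= r < 1 ->
  \sum_(i < N) parts R M i * r ^+ i <= \prod_(m < M) (1 - r ^+ m.+1)^-1.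
Proof.
move=> r01; have [r0 r1] := andP r01.
elim: M N => [|M IH] N.
  rewrite big_ord0; case: N => [|N]; first by rewrite big_ord0 ler01.
  by rewrite big_ord_recl /= /delta mul1r expr0 big1 ?addr0 // => i _; rewrite mul0r.
rewrite big_ord_recr /=.
under eq_bigr do rewrite conv_pow.
rewrite triangle_sum.
have p0 : 0 <= (1 - r ^+ M.+1)^-1.
  by rewrite invr_ge0 subr_ge0 exprn_ile1 // ltW.
apply: (@le_trans _ _ (\sum_(i < N) parts R M i * r ^+ i * (1 - r ^+ M.+1)^-1)).
  apply: ler_sum => i _; rewrite ler_wpM2l ?mulr_ge0 ?parts_ge0 ?exprn_ge0 //.
  exact: multiples_sum_le.
by rewrite -mulr_suml ler_wpM2r.
Qed.

(** For 0 <= x <= r one has 1/(1-x) <= 1 + x/(1-r) <= exp(x/(1-r)). Over x = r^(m+1) the exponents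
    form a geometric sum, bounded independently of M. *)
Lemma inv_prod_le r M : 0 <= r < 1 ->
  \prod_(m < M) (1 - r ^+ m.+1)^-1 <= expR ((1 - r)^-2).
Proof.
move=> /andP[r0 r1].
have r1' : 0 < 1 - r by rewrite subr_gt0.
have fac m : 0 <= (1 - r ^+ m.+1)^-1 <= expR (r ^+ m.+1 / (1 - r)).
  have x1 : r ^+ m.+1 <= r by rewrite exprS ler_piMr // exprn_ile1 // ltW.
  have x0 : 0 <= r ^+ m.+1 by rewrite exprn_ge0.
  have x1' : 0 < 1 - r ^+ m.+1 by lra.
  rewrite invr_ge0 ltW //=.
  apply: le_trans (expR_ge1Dx _).
  rewrite -[leLHS]mul1r ler_pdivrMr //.
  have : (1 - r ^+ m.+1) / (1 - r) >= 1 by rewrite ler_pdivlMr // mul1r; lra.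
  set y := (1 - r)^-1; nra.
apply: (@le_trans _ _ (\prod_(m < M) expR (r ^+ m.+1 / (1 - r)))).
  by apply: ler_prod => m _; exact: fac.
rewrite -expR_sum ler_expR -mulr_suml expr2 invfM ler_wpM2r //; first by rewrite invr_ge0 ltW.
have -> : \sum_(i < M) r ^+ i.+1 = r * ((1 - r ^+ M) / (1 - r)).
  rewrite -[1 - r ^+ M](opprB (r ^+ M)) subrX1.
  rewrite [r * _]mulrC -mulrA.
  under eq_bigr do rewrite exprSr.
  rewrite -mulr_suml; field; lra.
rewrite mulrA ler_pdivrMr // mulVf ?gt_eqF //.
have : r ^+ M <= 1 by rewrite exprn_ile1 // ltW.
have : 0 <= r ^+ M by rewrite exprn_ge0.
nra.
Qed.

Definition partsC M n : C := (parts R M n)%:C.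
(** By stability in M, the diagonal values are the coefficients of the infinite products: the
    partition numbers here, the coefficients of Euler's function in [pentagonal]. *)
Definition partition n : C := partsC n n.
Definition pentagonal n : C := euler_coef R n n.

(** For i < N the partition number of i is already a coefficient of the product with N factors,
    whose value is bounded uniformly in N. *)
Lemma parts_bounded r : 0 <= r < 1 -> bounded_sums (fun n => parts R n n * r ^+ n).
Proof.
move=> r01; exists (expR ((1 - r)^-2)) => N.
apply: le_trans (inv_prod_le N r01); apply: le_trans (parts_sum_le N N r01).
apply: ler_sum => i _; rewrite ler_wpM2r ?exprn_ge0 //; first by case/andP: r01.
by rewrite (@parts_stable _ N i) // ltnW.
Qed.

Lemma disc_conv_le (a : nat -> C) : (forall n, normc (a n) <= parts R n n) -> disc_conv a.
Proof.
move=> H r r01; apply: bounded_sums_le (parts_bounded r01) => n.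
by rewrite ler_wpM2r ?exprn_ge0 //; case/andP: r01.
Qed.

Lemma disc_conv_partsC M : disc_conv (partsC M).
Proof.
by apply: disc_conv_le => n; rewrite normc_real ger0_norm ?parts_ge0 ?parts_le.
Qed.

Lemma disc_conv_partition : disc_conv partition.
Proof.
by apply: disc_conv_le => n; rewrite normc_real ger0_norm ?parts_ge0.
Qed.

Lemma disc_conv_euler M : disc_conv (euler_coef R M).
Proof.
by apply: disc_conv_le => n; exact: le_trans (euler_coef_le _ _ _) (parts_le _ _ _).
Qed.

Lemma disc_conv_pentagonal : disc_conv pentagonal.
Proof. by apply: disc_conv_le => n; exact: euler_coef_le. Qed.

Lemma disc_conv_bounded1 (a : nat -> C) : (forall n, normc (a n) <= 1) -> disc_conv a.
Proof.
move=> H r /andP[r0 r1]; exists ((1 - r)^-1) => n.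
apply: (@le_trans _ _ (\sum_(i < n) r ^+ i)).
  by apply: ler_sum => i _; rewrite ler_piMl ?exprn_ge0.
have r1' : 0 < 1 - r by rewrite subr_gt0.
rewrite -[leRHS]mul1r ler_pdivlMr // mulrC -[_ * _]opprK -mulNr opprB -subrX1 opprB.
by rewrite lerBlDr lerDl exprn_ge0.
Qed.

Lemma disc_conv_multiples m : disc_conv (multiples C m).
Proof.
by apply: disc_conv_bounded1 => n; rewrite /multiples; case: dvdn;
  rewrite ?normc1 ?normc0.
Qed.

Lemma disc_conv_one_minus m : (0 < m)%N -> disc_conv (one_minus C m).
Proof.
move=> m0; apply: disc_conv_bounded1 => n; rewrite /one_minus /delta.
case: n => [|n]; first by rewrite eq_sym (gtn_eqF m0) subr0 normc1.
by rewrite sub0r normcN; case: eqP => _; rewrite ?normc1 ?normc0.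
Qed.

Lemma pser_delta0 q : pser (delta C 0) q = 1.
Proof.
rewrite /pser (@csum_fin _ _ 1) /psum; last by case=> // i _; rewrite mul0r.
by rewrite big_ord1 expr0 mulr1.
Qed.

Lemma pser_one_minus m q : (0 < m)%N -> pser (one_minus C m) q = 1 - q ^+ m.
Proof.
move=> m0; rewrite /pser (@csum_fin _ _ m.+1) /psum; last first.
  move=> i mi; rewrite /one_minus /delta (gtn_eqF mi) gtn_eqF ?subrr ?mul0r //.
  exact: leq_ltn_trans mi.
rewrite big_ord_recr /= /one_minus /delta eqxx (gtn_eqF m0) sub0r mulN1r.
congr (_ - _); case: m m0 => // m _; rewrite big_ord_recl /= subr0 mul1r expr0.
rewrite big1 ?addr0 // => i _; rewrite /= /bump /= add1n eqSS ltn_eqF // subrr mul0r //.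
Qed.

Lemma pser_euler M q : normc q < 1 ->
  pser (euler_coef R M) q = \prod_(m < M) (1 - q ^+ m.+1).
Proof.
move=> q1; elim: M => [|M IH]; first by rewrite big_ord0 pser_delta0.
rewrite big_ord_recr /= pser_conv ?IH ?pser_one_minus //; first exact: disc_conv_euler.
exact: disc_conv_one_minus.
Qed.

Lemma pser_parts_euler M q : normc q < 1 ->
  pser (partsC M) q * pser (euler_coef R M) q = 1.
Proof.
move=> q1; elim: M => [|M IH].
  have -> : partsC 0 = delta C 0.
    by apply/funext => n; rewrite /partsC /= /delta rmorph_nat.
  by rewrite pser_delta0 mulr1.
have -> : partsC M.+1 = conv (partsC M) (multiples C M.+1).
  apply/funext => n; rewrite /partsC /= /conv rmorph_sum; apply: eq_bigr => i _.
  by rewrite rmorphM /multiples rmorph_nat.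
have dm := disc_conv_multiples M.+1; have d1 := disc_conv_one_minus (ltn0Sn M).
rewrite /= (pser_conv (disc_conv_partsC M) dm q1) (pser_conv (disc_conv_euler M) d1 q1).
rewrite mulrACA IH mul1r -(pser_conv dm d1 q1).
have -> : conv (multiples C M.+1) (one_minus C M.+1) = delta C 0.
  by apply/funext => n; exact: multiples_inverse.
exact: pser_delta0.
Qed.

Definition euler_fun q : C := pser pentagonal q.

(** Each coefficient is eventually constant in M and all are majorized by partition numbers, so
    Tannery's theorem applies. *)
Lemma pser_stable_cvg (a : nat -> nat -> C) (al : nat -> C) q : normc q < 1 ->
  (forall M n, (n <= M)%N -> a M n = al n) -> (forall M n, normc (a M n) <= parts R n n) ->
  cvC \oo (fun M => pser (a M) q) (pser al q).
Proof.
move=> q1 st le; have q01 : 0 <= normc q < 1 by rewrite normc_ge0.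
apply: (tannery _ _ (parts_bounded q01)).
  move=> n; apply: (@cvC_near _ _ _ _ (fun=> al n * q ^+ n)); last exact: cvgC_cst.
  by exists n => // M /= nM; rewrite st.
exists 0%N => // M _ n; rewrite normcM normcX ler_wpM2r ?exprn_ge0 ?normc_ge0 //.
Qed.

Lemma euler_prod_cvg q : normc q < 1 ->
  cvC \oo (fun M => \prod_(m < M) (1 - q ^+ m.+1)) (euler_fun q).
Proof.
move=> q1.
have H : cvC \oo (fun M => pser (euler_coef R M) q) (euler_fun q).
  apply: pser_stable_cvg => // M n; first exact: euler_coef_stable.
  exact: le_trans (euler_coef_le _ _ _) (parts_le _ _ _).
by apply: cvC_near H; exists 0%N => // M _; rewrite pser_euler.
Qed.

(** The limit of the finite identity. It gives at once the nonvanishing of Euler's function and the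
    power series of its inverse. *)
Lemma partition_euler q : normc q < 1 -> pser partition q * euler_fun q = 1.
Proof.
move=> q1.
have H : cvC \oo (fun M => pser (partsC M) q) (pser partition q).
  apply: pser_stable_cvg => // M n; first by move=> nM; rewrite /partsC parts_stable.
  by rewrite normc_real ger0_norm ?parts_ge0 ?parts_le.
refine (limC_unique (cvgCM H (euler_prod_cvg q1)) _).
apply: (@cvC_near _ _ _ _ (fun=> 1)); last exact: cvgC_cst.
by exists 0%N => // M _; rewrite -pser_euler // pser_parts_euler.
Qed.

Lemma euler_fun_neq0 q : normc q < 1 -> euler_fun q != 0.
Proof.
move=> /partition_euler; apply: contra_eq_neq => ->.
by rewrite mulr0 eq_sym oner_eq0.
Qed.

End EulerProduct.

(** * The logarithmic derivative of eta *)

Section LogDerivative.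
Variable R : realType.
Local Notation C := (Cplx R).
Implicit Types (q t z : C) (r : R).

Lemma bounded_sums_shift (M : nat -> R) : 0 <= M 0%N ->
  bounded_sums M -> bounded_sums (fun n => M n.+1).
Proof.
move=> M0 [B HB]; exists B => n; apply: le_trans (HB n.+1).
by rewrite big_ord_recl lerDr.
Qed.

Lemma bounded_nat_pow r : 0 < r < 1 -> bounded_sums (fun n => n.+1%:R * r ^+ n).
Proof.
move=> r01; have := @disc_conv_deriv R (fun=> 1) r _ r01.
move=> /(_ (disc_conv_bounded1 _)) H; apply: bounded_sums_le (bounded_sums_shift _ (H _)).
- by move=> n; rewrite normc1 mul1r.
- by rewrite mul0r mulr0.
- by move=> n; rewrite normc1.
Qed.

Lemma bounded_geometric r : 0 <= r < 1 -> bounded_sums (fun n => r ^+ n).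
Proof.
move=> r01; have := @disc_conv_bounded1 R (fun=> 1) _ r r01.
move=> H; apply: bounded_sums_le (H _) => n; last by rewrite normc1.
by rewrite normc1 mul1r.
Qed.

(** The sum over k < K is exchanged as a finite sum; the product majorant then lets K tend to
    infinity on both sides. *)
Lemma csum_fubini (d : nat -> nat -> C) (A B : nat -> R) :
  (forall m k, normc (d m k) <= A m * B k) ->
  (forall m, 0 <= A m) -> (forall k, 0 <= B k) ->
  bounded_sums A -> bounded_sums B ->
  csum (fun m => csum (d m)) = csum (fun k => csum (fun m => d m k)).
Proof.
move=> dAB A0 B0 [SA HA] [SB HB].
have bA : bounded_sums A by exists SA.
have bB : bounded_sums B by exists SB.
have SA0 : 0 <= SA by apply: le_trans (HA 0%N); rewrite big_ord0.
have SB0 : 0 <= SB by apply: le_trans (HB 0%N); rewrite big_ord0.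
have dk k : dominated_by (fun m => d m k) (fun m => B k * A m).
  by move=> m; rewrite mulrC.
have bk k := bounded_sumsZ (B0 k) bA.
have lim1 : cvC \oo (fun K => csum (fun m => psum (d m) K)) (csum (fun m => csum (d m))).
  apply: (tannery _ _ (bounded_sumsZ SB0 bA)).
    by move=> m; exact: psum_cvg (dAB m) (bounded_sumsZ (A0 m) bB).
  exists 0%N => // K _ m; apply: le_trans (normc_sum _ _ _) _.
  apply: (@le_trans _ _ (\sum_(k < K) A m * B k)); first by apply: ler_sum => k _.
  by rewrite -mulr_sumr mulrC ler_wpM2r.
have E K : csum (fun m => psum (d m) K) = psum (fun k => csum (fun m => d m k)) K.
  apply: psum_lim_csum.
  pose proof (@cvgC_sum R nat \oo _ K (fun k N => psum (fun m => d m k) N)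
    (fun k => csum (fun m => d m k)) (fun k => psum_cvg (dk k) (bk k))) as H.
  by apply: cvC_near H; exists 0%N => // N _; rewrite /psum exchange_big.
refine (limC_unique lim1 _).
apply: (@cvC_near _ _ _ _ (psum (fun k => csum (fun m => d m k)))).
  by exists 0%N => // K _; rewrite E.
apply: (@psum_cvg _ _ (fun k => SA * B k)); last exact: bounded_sumsZ.
move=> k; apply: csum_le (dk k) _ => n.
by rewrite -mulr_sumr mulrC ler_wpM2r.
Qed.

Lemma csum_geometric q : normc q < 1 -> csum (fun n => q ^+ n) = (1 - q)^-1.
Proof.
move=> q1.
have m1 : pser (multiples C 1) q = csum (fun n => q ^+ n).
  by apply: eq_csum => n; rewrite /multiples dvd1n mul1r.
have := pser_conv (@disc_conv_multiples R 1) (@disc_conv_one_minus R 1 (ltn0Sn 0)) q1.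
rewrite pser_one_minus // expr1 m1.
have -> : conv (multiples C 1) (one_minus C 1) = delta C 0.
  by apply/funext => n; exact: multiples_inverse.
rewrite pser_delta0 => E; have q10 : 1 - q != 0.
  by apply: contra_eq_neq E => ->; rewrite mulr0 oner_eq0.
by apply: (mulIf q10); rewrite -E mulVf.
Qed.

Lemma csum_geometric2 q : normc q < 1 ->
  csum (fun n => n.+1%:R * q ^+ n) = (1 - q)^-1 ^+ 2.
Proof.
move=> q1; have d1 : disc_conv (fun=> 1 : C).
  by apply: disc_conv_bounded1 => n; rewrite normc1.
have E1 : pser (fun=> 1 : C) q = (1 - q)^-1.
  by rewrite -csum_geometric //; apply: eq_csum => n; rewrite mul1r.
rewrite expr2 -E1 -(pser_conv d1 d1 q1); apply: eq_csum => n; congr (_ * _).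
by rewrite /conv; under eq_bigr do rewrite mulr1; rewrite sumr_const card_ord.
Qed.

Lemma near_disc q : normc q < 1 -> \forall w \near q, normc w < 1.
Proof.
move=> q1; apply/nbhsC_ball; exists (1 - normc q); first by rewrite subr_gt0.
by move=> w; have := normcD (w - q) q; rewrite subrK; lra.
Qed.

Lemma one_minus_pow_ge q n : normc q < 1 -> 1 - normc q <= normc (1 - q ^+ n.+1).
Proof.
move=> q1; have := normcD (1 - q ^+ n.+1) (q ^+ n.+1).
rewrite subrK normc1 normcX.
have : normc q ^+ n.+1 <= normc q by rewrite exprS ler_piMr ?normc_ge0 // exprn_ile1 ?normc_ge0 // ltW.
lra.
Qed.

Lemma one_minus_pow_neq0 q n : normc q < 1 -> 1 - q ^+ n.+1 != 0.
Proof.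
move=> q1; rewrite -normc_gt0; apply: lt_le_trans (one_minus_pow_ge n q1).
by rewrite subr_gt0.
Qed.

(** Minus the logarithmic derivative of Euler's function. *)
Definition lambert q : C := csum (fun m => m.+1%:R * q ^+ m / (1 - q ^+ m.+1)).

Lemma lambert_dominated q : 0 < normc q < 1 ->
  dominated_by (fun m => m.+1%:R * q ^+ m / (1 - q ^+ m.+1))
    (fun m => (1 - normc q)^-1 * (m.+1%:R * normc q ^+ m)).
Proof.
move=> /andP[q0 q1] m; rewrite !normcM normcV normc_nat normcX [leRHS]mulrC.
rewrite ler_wpM2l ?mulr_ge0 ?exprn_ge0 ?normc_ge0 //.
have h := one_minus_pow_ge m q1.
rewrite lef_pV2 // posrE ?subr_gt0 //; apply: lt_le_trans h; by rewrite subr_gt0.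
Qed.

Lemma has_deriv_finprod q M : normc q < 1 ->
  has_deriv (fun w => \prod_(m < M) (1 - w ^+ m.+1)) q
    (- (\prod_(m < M) (1 - q ^+ m.+1)) * \sum_(m < M) m.+1%:R * q ^+ m / (1 - q ^+ m.+1)).
Proof.
move=> q1; elim: M => [|M IH].
  rewrite !big_ord0 mulr0; apply: has_deriv_near (has_deriv_cst 1 q).
  by apply: nearC_all => w; rewrite big_ord0.
have D : has_deriv (fun w : C => 1 - w ^+ M.+1) q (0 - M.+1%:R * q ^+ M * 1).
  exact: has_derivB (has_deriv_cst 1 q) (has_derivX M.+1 (has_deriv_id q)).
have := has_derivM IH D.
rewrite !big_ord_recr /= (_ : _ + _ * _ = - (\prod_(i < M) (1 - q ^+ i.+1) * (1 - q ^+ M.+1)) *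
   (\sum_(i < M) i.+1%:R * q ^+ i / (1 - q ^+ i.+1) + M.+1%:R * q ^+ M / (1 - q ^+ M.+1))).
  by apply: has_deriv_near; apply: nearC_all => w; rewrite big_ord_recr.
by field; exact: one_minus_pow_neq0.
Qed.

(** For the product of M factors the derivative is known both as a differentiated power series and
    by the product rule. Both expressions converge, the first one coefficient by coefficient. *)
Lemma has_deriv_euler_fun q : 0 < normc q < 1 ->
  has_deriv (@euler_fun R) q (- euler_fun q * lambert q).
Proof.
move=> /andP[q0 q1].
suff <- : dpser (@pentagonal R) q = - euler_fun q * lambert q.
  exact: has_deriv_pser (@disc_conv_pentagonal R) q1.
have E M : dpser (euler_coef R M) q =
    - (\prod_(m < M) (1 - q ^+ m.+1)) * psum (fun m => m.+1%:R * q ^+ m / (1 - q ^+ m.+1)) M.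
  apply: (has_deriv_unique (has_deriv_pser (disc_conv_euler M) q1)).
  apply: has_deriv_near (has_deriv_finprod M q1).
  by apply: filterS (near_disc q1) => w w1; rewrite pser_euler.
have lim1 : cvC \oo (fun M => dpser (euler_coef R M) q) (dpser (@pentagonal R) q).
  apply: (tannery _ _ (disc_conv_deriv (@disc_conv_partition R) (introT andP (conj q0 q1)))).
    move=> n; apply: (@cvC_near _ _ _ _ (fun=> pentagonal R n * (n%:R * q ^+ n.-1))); last exact: cvgC_cst.
    by exists n => // M /= nM; rewrite euler_coef_stable.
  exists 0%N => // M _ n; rewrite !normcM normcX normc_nat ler_wpM2r ?mulr_ge0 ?exprn_ge0 ?normc_ge0 //.
  rewrite normc_real ger0_norm ?parts_ge0 //.
  exact: le_trans (euler_coef_le _ _ _) (parts_le _ _ _).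
have q01 : 0 < normc q < 1 by rewrite q0.
have iv : 0 <= (1 - normc q)^-1 by rewrite invr_ge0 subr_ge0 ltW.
have cl := psum_cvg (lambert_dominated q01) (bounded_sumsZ iv (bounded_nat_pow q01)).
refine (limC_unique lim1 _).
apply: cvC_near (cvgCM (cvgCN (euler_prod_cvg q1)) cl).
by exists 0%N => // M _; rewrite E.
Qed.

(** The sum of m e(m z) over m >= 1 for z in the upper half plane; times (2 pi i)^2 it will be the
    sum of (z + n)^-2 over all integers n. *)
Definition phi z : C := ee z / (1 - ee z) ^+ 2.
(** The sum of sigma(n) e(n t) over n >= 1, so that 1/24 - [eisen t] is E_2(t) / 24. *)
Definition eisen t : C := csum (fun c => phi (c.+1%:R * t)).

(** Both sides sum m q^(m k) over m, k >= 1, one along k first and the other along m first. *)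
Lemma lambert_eisen t : 0 < im t -> ee t * lambert (ee t) = eisen t.
Proof.
move=> t0; have q1 := normc_ee_lt1 t0; set q := ee t in q1 *.
have q0 : 0 < normc q by rewrite normc_gt0 ee_neq0.
have q01 : 0 < normc q < 1 by rewrite q0.
pose d m k : C := m.+1%:R * q ^+ (m.+1 * k.+1).
have q1X n : normc (q ^+ n.+1) < 1 by rewrite normcX exprn_ilt1 // ltW.
have e1 m : m.+1%:R * q ^+ m / (1 - q ^+ m.+1) * q = csum (d m).
  rewrite -csum_geometric //.
  rewrite (_ : _ * q = m.+1%:R * q ^+ m.+1 * csum (fun n => (q ^+ m.+1) ^+ n)); last by rewrite exprSr; ring.
  rewrite -(@csumZ _ _ _ (fun n => normc (q ^+ m.+1) ^+ n)).
  - by apply: eq_csum => k; rewrite /d mulnS exprD exprM mulrA.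
  - by move=> n; rewrite normcX.
  - by apply: bounded_geometric; rewrite normc_ge0 q1X.
have e2 k : phi (k.+1%:R * t) = csum (fun m => d m k).
  rewrite /phi eeMn -/q -exprVn -csum_geometric2 //.
  rewrite -(@csumZ _ _ _ (fun n => n.+1%:R * normc (q ^+ k.+1) ^+ n)).
  - by apply: eq_csum => m; rewrite /d mulSn exprD mulnC exprM; ring.
  - by move=> n; rewrite normcM normc_nat normcX.
  - by apply: bounded_nat_pow; rewrite q1X normc_gt0 expf_neq0 ?ee_neq0.
rewrite /eisen (eq_csum e2) -(@csum_fubini _ (fun m => m.+1%:R * normc q ^+ m) (fun k => normc q ^+ k)).
- rewrite mulrC /lambert mulrC.
  rewrite -(csumZ _ (lambert_dominated q01)); last first.
    by apply: bounded_sumsZ; [rewrite invr_ge0 subr_ge0 ltW|exact: bounded_nat_pow].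
  by apply: eq_csum => m; rewrite mulrC e1.
- move=> m k; rewrite /d normcM normc_nat normcX -mulrA ler_wpM2l // -exprD.
  by rewrite ler_wiXn2l ?ltW // mulSn mulnS; lia.
- by move=> m; rewrite mulr_ge0 ?exprn_ge0 ?normc_ge0.
- by move=> k; rewrite exprn_ge0 ?normc_ge0.
- exact: bounded_nat_pow.
- by apply: bounded_geometric; rewrite normc_ge0.
Qed.

Lemma etaE t : 0 < im t -> eta t = ee (t / 24) * euler_fun (ee t).
Proof.
move=> t0; rewrite /eta; congr (_ * _).
have H := euler_prod_cvg (normc_ee_lt1 t0).
apply: limCE; apply: cvC_near H; exists 0%N => // M _.
by rewrite big_add1 /= big_mkord; apply: eq_bigr => m _; rewrite eeMn.
Qed.

Lemma eta_neq0 t : 0 < im t -> eta t != 0.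
Proof.
by move=> t0; rewrite etaE // mulf_neq0 ?ee_neq0 ?euler_fun_neq0 ?normc_ee_lt1.
Qed.

Lemma near_upper t : 0 < im t -> \forall w \near t, 0 < im w.
Proof.
move=> t0; apply/nbhsC_ball; exists (im t) => // w.
have := im_le (w - t); rewrite imD imN ler_norml => /andP[h _]; lra.
Qed.

Lemma has_deriv_eta t : 0 < im t ->
  has_deriv (@eta R) t (eta t * (twopii R * (24^-1 - eisen t))).
Proof.
move=> t0; have q1 := normc_ee_lt1 t0.
have q01 : 0 < normc (ee t) < 1 by rewrite q1 normc_gt0 ee_neq0.
have D1 := has_deriv_eeZ (24^-1 : C) t.
have D2 := has_deriv_comp (has_deriv_ee t) (has_deriv_euler_fun q01).
have := has_derivM D1 D2.
have -> : twopii R / 24 * ee (24^-1 * t) * euler_fun (ee t) +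
  ee (24^-1 * t) * (- euler_fun (ee t) * lambert (ee t) * (twopii R * ee t)) =
  eta t * (twopii R * (24^-1 - eisen t)).
  by rewrite -lambert_eisen // etaE // [t / 24]mulrC; ring.
apply: has_deriv_near; apply: filterS (near_upper t0) => w w0.
by rewrite etaE // [w / 24]mulrC.
Qed.

End LogDerivative.

(** * The Lipschitz formulas *)

Section Lipschitz.
Variable R : realType.
Local Notation C := (Cplx R).
Implicit Types (t z w : C) (x y : R).

(** With w = x / 2 <= pi / 4: sin x = 2 sin w cos w >= 2 w cos(w)^2 >= w. *)
Lemma sin_ge_half x : 0 <= x <= pi / 2 -> x / 2 <= sin x.
Proof.
move=> /andP[x0 xpi]; pose w := x / 2.
have w0 : 0 <= w by rewrite /w; lra.
have p0 := pi_gt0 R.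
have wpi : w <= pi / 4 by rewrite /w; lra.
have [c] : exists2 c, c \in `[0, w]%R & sin w - sin 0 = cos c * (w - 0).
  by apply: MVT_segment => //; apply: continuous_subspaceT => s; exact: continuous_sin.
rewrite in_itv /= => /andP[c0 cw]; rewrite sin0 !subr0 => sE.
have cc : cos w <= cos c.
  have [->//|ne] := eqVneq c w.
  by rewrite ltW // ltr_cos ?in_itv /= ?lt_neqAle ?ne //; lra.
have c2 : cos w ^+ 2 >= 1 / 2.
  have : 0 <= cos (w *+ 2) by apply: cos_ge0_pihalf; rewrite [w *+ 2]mulr2n; lra.
  rewrite cos_mulr2n; lra.
have cw0 : 0 <= cos w by apply: cos_ge0_pihalf; lra.
have -> : x = w *+ 2 by rewrite /w; lra.
rewrite sin_mulr2n sE [X in _ <= X]mulr2n [w *+ 2]mulr2n.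
have h : w * cos w ^+ 2 <= cos w * (cos c * w).
  by rewrite expr2 mulrCA ler_wpM2l // mulrC ler_wpM2r.
nra.
Qed.

Lemma normc_one_minus_ee z : normc (1 - ee z) ^+ 2 =
  (1 - expR (- (2 * pi * im z))) ^+ 2 +
  4 * expR (- (2 * pi * im z)) * sin (pi * re z) ^+ 2.
Proof.
rewrite normcE reD imD reN imN /= sub0r sqrrN.
set r := expR _; have -> : 2 * pi * re z = (pi * re z) *+ 2 by rewrite [RHS]mulr2n; ring.
rewrite cos_mulr2n sin_mulr2n; set c := cos _; set s := sin _.
have E : c ^+ 2 = 1 - s ^+ 2 by rewrite cos2sin2.
rewrite (_ : (r * ((c * s) *+ 2)) ^+ 2 = 4 * r ^+ 2 * s ^+ 2 * c ^+ 2); last by ring.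
by rewrite E; ring.
Qed.

(** Equivalent to |z| <= |sin(pi z)|, since |1 - e(z)|^2 = 4 |e(z)| |sin(pi z)|^2. With z = x + i y
    it splits into |x| <= |sin(pi x)| on the strip and |y| <= sinh(pi |y|). *)
Lemma one_minus_ee_ge z : `|re z| <= 1 / 2 ->
  4 * normc z ^+ 2 * normc (ee z) <= normc (1 - ee z) ^+ 2.
Proof.
move=> xh; rewrite normc_one_minus_ee normc_ee normcE.
have p2 := pi_ge2 R.
set r := expR _; have r0 : 0 < r by exact: expR_gt0.
have sn : re z ^+ 2 <= sin (pi * re z) ^+ 2.
  have H (u : R) : 0 <= u <= 1 / 2 -> u ^+ 2 <= sin (pi * u) ^+ 2.
    move=> /andP[u0 u1]; have h : pi * u / 2 <= sin (pi * u).
      by apply: sin_ge_half; apply/andP; split; nra.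
    have : u <= pi * u / 2 by nra.
    by move=> h2; apply: lerXn2r; rewrite ?nnegrE; nra.
  have [x0|x0] := leP 0 (re z); first by apply: H; rewrite x0 /= (le_trans (ler_norm _)).
  have := H (- re z); rewrite mulrN sinN !sqrrN; apply.
  by rewrite oppr_ge0 ltW //= (le_trans _ xh) // -normrN ler_norm.
have sy : 4 * im z ^+ 2 * r <= (1 - r) ^+ 2.
  pose a := expR (pi * im z); have a0 : 0 < a by exact: expR_gt0.
  have ra : r = (a^-1) ^+ 2.
    by rewrite /r /a -expRN -expRM_natl; congr expR; ring.
  have -> : (1 - r) ^+ 2 = (a - a^-1) ^+ 2 * r.
    by rewrite ra; field; rewrite gt_eqF.
  apply: ler_wpM2r; first exact: ltW.
  have K (u : R) : 0 <= u -> 2 * u <= expR (pi * u) - (expR (pi * u))^-1.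
    move=> u0; have h1 := expR_ge1Dx (pi * u).
    have h2 : (expR (pi * u))^-1 <= 1 by rewrite invf_le1 ?expR_gt0 //; nra.
    nra.
  have [y0|y0] := leP 0 (im z).
    have := K _ y0; rewrite -/a => h; nra.
  have := K (- im z); rewrite [pi * - _]mulrN expRN -/a invrK => h.
  have {}h : 2 * - im z <= a^-1 - a by apply: h; lra.
  nra.
nra.
Qed.

Lemma phi_le z : `|re z| <= 1 / 2 -> z != 0 -> normc (phi z) <= (4 * normc z ^+ 2)^-1.
Proof.
move=> xh z0; have := one_minus_ee_ge xh.
have n0 : 0 < normc z by rewrite normc_gt0.
have e0 : 0 < normc (ee z) by rewrite normc_gt0 ee_neq0.
move=> h; have h0 : 0 < 4 * normc z ^+ 2 by rewrite mulr_gt0 // exprn_gt0.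
have h1 : 0 < normc (1 - ee z) ^+ 2 by apply: lt_le_trans h; rewrite mulr_gt0.
rewrite /phi normcM normcV normcX ler_pdivrMr //.
by rewrite ler_pdivlMl.
Qed.

(** This is (i/2) cot(pi z), so that -2 pi i [kappa z] = pi cot(pi z). *)
Definition kappa z : C := (1 - ee z)^-1 - 2^-1.

Lemma ee_half_shift z : ee ((z + 1) / 2) = - ee (z / 2).
Proof. by rewrite mulrDl mul1r eeD ee_half mulrN1. Qed.

Lemma ee_half_sqr z : ee (z / 2) ^+ 2 = ee z.
Proof. by rewrite -eeMn; congr ee; field. Qed.

Lemma phi_double z : ee z != 1 -> phi z = 4^-1 * (phi (z / 2) + phi ((z + 1) / 2)).
Proof.
rewrite /phi ee_half_shift -ee_half_sqr; set u := ee (z / 2) => u1.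
have h1 : 1 - u != 0 by apply: contraNneq u1 => /eqP; rewrite subr_eq0 => /eqP <-; rewrite expr1n.
have h2 : 1 + u != 0.
  by apply: contraNneq u1 => /eqP; rewrite addrC addr_eq0 => /eqP ->; rewrite sqrrN expr1n.
have -> : 1 - u ^+ 2 = (1 - u) * (1 + u) by ring.
have -> : 1 - - u = 1 + u by ring.
by field; rewrite h2 h1.
Qed.

Lemma kappa_double z : ee z != 1 -> kappa z = 2^-1 * (kappa (z / 2) + kappa ((z + 1) / 2)).
Proof.
rewrite /kappa ee_half_shift -ee_half_sqr; set u := ee (z / 2) => u1.
have h1 : 1 - u != 0 by apply: contraNneq u1 => /eqP; rewrite subr_eq0 => /eqP <-; rewrite expr1n.
have h2 : 1 + u != 0.
  by apply: contraNneq u1 => /eqP; rewrite addrC addr_eq0 => /eqP ->; rewrite sqrrN expr1n.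
have -> : 1 - u ^+ 2 = (1 - u) * (1 + u) by ring.
have -> : 1 - - u = 1 + u by ring.
by field; rewrite h2 h1.
Qed.

Section Dyadic.
Variables (F : C -> C) (c : C).
Hypothesis F_periodic : forall z, F (z + 1) = F z.
Hypothesis F_double : forall z, ee z != 1 -> F z = c * (F (z / 2) + F ((z + 1) / 2)).

(* Iterating the duplication formula turns [F] into a sum over [2 ^ k] points; dominated
   convergence as [k] grows gives the partial fraction expansion. *)
Lemma dyadic_sum z k : ee z != 1 ->
  F z = c ^+ k * \sum_(j < 2 ^ k) F ((z + j%:R) / 2 ^+ k).
Proof.
move=> z1; elim: k => [|k IH].
  by rewrite !expr0 big_ord1 mul1r addr0 divr1.
rewrite IH exprSr -mulrA; congr (_ * _).
rewrite expnS mul2n -addnn big_split_ord /= -big_split /= mulr_sumr; apply: eq_bigr => j _.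
have n2 : (2 ^+ k : C) != 0 by rewrite expf_neq0 // pnatr_eq0.
rewrite F_double; last first.
  apply: contraNneq z1 => h; rewrite -(ee_shift z j).
  have -> : z + j%:R = (2 ^ k)%:R * ((z + j%:R) / 2 ^+ k).
    by rewrite natrX mulrC divfK.
  by rewrite eeMn h expr1n.
congr (c * (F _ + F _)); rewrite exprS ?natrD ?natrX; field; exact: n2.
Qed.

(** Periodicity moves the upper half of the points to the negative side. For 0 <= re z < 1 all
    arguments then satisfy |re| <= 1/2, where [one_minus_ee_ge] applies. *)
Lemma dyadic_pairs z k : ee z != 1 ->
  F z = c ^+ k.+1 * \sum_(n < 2 ^ k) (F ((z + n%:R) / 2 ^+ k.+1) + F ((z - n.+1%:R) / 2 ^+ k.+1)).
Proof.
move=> z1; rewrite (dyadic_sum k.+1 z1) expnS mul2n -addnn big_split_ord /= big_split /=.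
congr (_ * (_ + _)); rewrite (reindex_inj rev_ord_inj) /=; apply: eq_bigr => j _.
have n2 : (2 ^+ k.+1 : C) != 0 by rewrite expf_neq0 // pnatr_eq0.
rewrite -[RHS]F_periodic; congr F.
have -> : (2 ^ k + (2 ^ k - j.+1))%N%:R = 2 ^+ k.+1 - j.+1%:R :> C.
  by rewrite natrD natrB ?ltn_ord // natrX exprS; ring.
by field.
Qed.

End Dyadic.

Lemma phi_periodic z : phi (z + 1) = phi z.
Proof. by rewrite /phi eeD ee1 mulr1. Qed.

Lemma kappa_periodic z : kappa (z + 1) = kappa z.
Proof. by rewrite /kappa eeD ee1 mulr1. Qed.

Lemma half_pow_cvg (z : C) : cvC \oo (fun k => z / 2 ^+ k.+1) 0.
Proof.
have H : cvC \oo (fun k => ((2^-1 : R) ^+ k)%:C : C) 0.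
  apply/cvgCP => e e0.
  have := @cvg_expr R (2^-1) _; rewrite ger0_norm // => /(_ _)/cvgrPdist_lt/(_ e e0).
  move=> []; first by lra.
  move=> N _ HN; exists N => // n /HN; rewrite sub0r normrN => h.
  by rewrite sub0r normcN normc_real.
pose proof (cvgCM (cvgC_cst (z / 2)) H) as K; rewrite mulr0 in K.
apply: cvC_near K; exists 0%N => // k _.
have -> : ((2^-1 : R) ^+ k)%:C = (2 ^+ k)^-1 :> C.
  by rewrite rmorphXn fmorphV rmorph_nat exprVn.
by rewrite exprS; field; rewrite expf_neq0 // pnatr_eq0.
Qed.

Lemma pow4V (K : fieldType) n : (4^-1 : K) ^+ n = (2 ^+ n) ^- 2.
Proof.
rewrite exprVn; congr (_^-1); rewrite -exprM mulnC exprM; congr (_ ^+ _).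
by rewrite -natrX.
Qed.

Lemma twopii_neq0 : twopii R != 0.
Proof. by rewrite eq_complex /= negb_and mulf_neq0 ?orbT ?gt_eqF ?pi_gt0. Qed.

(** Since e(h) - 1 is asymptotic to 2 pi i h, each rescaled term tends to a term of the partial
    fraction expansion. *)
Lemma phi_scale w : w != 0 ->
  cvC \oo (fun k => twopii R ^+ 2 * (4^-1 ^+ k.+1 * phi (w / 2 ^+ k.+1))) (w ^- 2).
Proof.
move=> w0; have [p Hp cp] := ee_quotient R; have t0 := twopii_neq0.
pose proof (cvC_comp (half_pow_cvg w) cp) as c1.
pose proof (has_deriv_cvg (has_deriv_ee (0 : C))) as ce; rewrite ee0 in ce.
pose proof (cvC_comp (half_pow_cvg w) ce) as c2.
pose proof (cvgCM (cvgC_cst (twopii R ^+ 2 / w ^+ 2)) (cvgCM c2 (cvgCV (expf_neq0 2 t0) (cvgCX 2 c1)))) as K.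
have -> : w ^- 2 = twopii R ^+ 2 / w ^+ 2 * (1 * (twopii R ^+ 2)^-1).
  by field; rewrite w0 t0.
apply: cvC_near K; exists 0%N => // k _ /=.
set h := w / 2 ^+ k.+1.
have n2 : (2 ^+ k.+1 : C) != 0 by rewrite expf_neq0 // pnatr_eq0.
have h0 : h != 0 by rewrite mulf_neq0 ?invr_neq0.
rewrite /phi -(opprB (ee h)) sqrrN Hp exprMn invfM.
have -> : 4^-1 ^+ k.+1 = h ^+ 2 / w ^+ 2.
  by rewrite pow4V /h; field; rewrite n2 w0.
(* [p h] could vanish for small k; both sides are then 0 by the convention on the inverse of 0. *)
have [->|p0] := eqVneq (p h) 0; first by rewrite expr0n /= !(mulr0, invr0).
by field; rewrite h0 w0 p0.
Qed.

Lemma kappa_scale w : w != 0 ->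
  cvC \oo (fun k => - twopii R * (2^-1 ^+ k.+1 * kappa (w / 2 ^+ k.+1))) (w^-1).
Proof.
move=> w0; have [p Hp cp] := ee_quotient R; have t0 := twopii_neq0.
pose proof (cvC_comp (half_pow_cvg w) cp) as c1.
pose proof (cvgCM (cvgC_cst (- twopii R / w)) (cvgCB (cvgCN (cvgCV t0 c1)) (half_pow_cvg (w / 2)))) as K.
have -> : w^-1 = - twopii R / w * (- (twopii R)^-1 - 0).
  by field; rewrite w0 t0.
apply: cvC_near K; exists 0%N => // k _ /=.
have n2 : (2 ^+ k.+1 : C) != 0 by rewrite expf_neq0 // pnatr_eq0.
rewrite (_ : w / 2 / 2 ^+ k.+1 = (w / 2 ^+ k.+1) / 2); last by field.
set h := w / 2 ^+ k.+1.
have h0 : h != 0 by rewrite mulf_neq0 ?invr_neq0.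
rewrite /kappa -(opprB (ee h)) Hp invrN invfM.
have -> : 2^-1 ^+ k.+1 = h / w by rewrite /h exprVn; field; rewrite n2 w0.
have [->|p0] := eqVneq (p h) 0; first by rewrite !(mulr0, invr0); field; rewrite ?w0 ?h0.
by field; rewrite h0 w0 p0.
Qed.

Lemma bounded_inv_sqr : bounded_sums (fun n => (n.+1%:R : R) ^- 2).
Proof.
(* The sharper bound is inductive because 2/x - 2/(x+1) >= 1/x^2 for x >= 1. *)
exists 2 => n; suff : \sum_(i < n) (i.+1%:R : R) ^- 2 <= 2 - 2 / n.+1%:R.
  by move=> h; apply: le_trans h _; rewrite lerBlDr lerDl divr_ge0.
elim: n => [|n IH]; first by rewrite big_ord0 divr1 subrr.
rewrite big_ord_recr /=; apply: le_trans (lerD IH (lexx _)) _.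
have n0 : 0 < n.+1%:R :> R by rewrite ltr0n.
rewrite -[n.+2%:R]natr1; set x := n.+1%:R in n0 *.
have x1 : 1 <= x by rewrite ler1n.
have e : 2 - 2 / (x + 1) - (2 - 2 / x + x ^- 2) = (x - 1) / (x ^+ 2 * (x + 1)).
  by field; lra.
by rewrite -subr_ge0 e divr_ge0 ?subr_ge0 ?mulr_ge0 ?sqr_ge0 //; lra.
Qed.

(** Real z is allowed, because the expansion is also evaluated at z = 1/2, for zeta(2). *)
Lemma lattice_line_far z : 0 <= re z < 1 -> z != 0 ->
  exists2 d : R, 0 < d & forall n,
    d * n.+1%:R <= normc (z + n%:R) /\ d * n.+1%:R <= normc (z - n.+1%:R).
Proof.
move=> /andP[x0 x1] z0.
have z1 : z - 1 != 0.
  by rewrite subr_eq0; apply: contraTneq x1 => ->; rewrite /= ltxx.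
have n0 : 0 < normc z by rewrite normc_gt0.
have n1 : 0 < normc (z - 1) by rewrite normc_gt0.
exists (Num.min (1 / 2) (Num.min (normc z) (normc (z - 1)))).
  by rewrite !lt_min n0 n1 divr_gt0.
move=> n; set d := Num.min _ _.
have [d1 d2 d3] : [/\ d <= 1 / 2, d <= normc z & d <= normc (z - 1)].
  by rewrite /d !ge_min !lexx ?orbT.
case: n => [|n]; first by rewrite mulr1 addr0.
have h : d * n.+2%:R <= n.+1%:R.
  have := ler_wpM2r (ler0n R n.+2) d1 => h; apply: le_trans h _.
  by rewrite -[n.+2%:R]natr1 -[n.+1%:R]natr1; have := ler0n R n; lra.
split; apply: le_trans h _.
  apply: le_trans (re_le _); rewrite reD re_nat; apply: le_trans (ler_norm _); lra.
apply: le_trans (re_le _); rewrite reD reN re_nat -normrN.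
by apply: le_trans (ler_norm _); rewrite -[n.+2%:R]natr1; lra.
Qed.

Lemma half_strip z n k : 0 <= re z < 1 -> (n < 2 ^ k)%N ->
  `|re ((z + n%:R) / 2 ^+ k.+1)| <= 1 / 2 /\ `|re ((z - n.+1%:R) / 2 ^+ k.+1)| <= 1 / 2.
Proof.
move=> /andP[x0 x1] nk.
have reX (w : C) : re (w / 2 ^+ k.+1) = re w / 2 ^+ k.+1.
  have -> : ((2 : C) ^+ k.+1)^-1 = ((2 ^+ k.+1)^-1 : R)%:C.
    by rewrite fmorphV rmorphXn rmorph_nat.
  by rewrite reM /= mulr0 subr0.
have p0 : 0 < (2 : R) ^+ k.+1 by rewrite exprn_gt0.
have iv : 0 < ((2 : R) ^+ k.+1)^-1 by rewrite invr_gt0.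
rewrite !reX !normrM (gtr0_norm iv) !ler_pdivrMr //.
have -> : 1 / 2 * 2 ^+ k.+1 = (2 ^ k)%:R :> R by rewrite natrX exprS; field.
have h : n.+1%:R <= (2 ^ k)%:R :> R by rewrite ler_nat.
rewrite -natr1 in h; rewrite !reD reN !re_nat -natr1 !ler_norml.
by have := ler0n R n; split; lra.
Qed.

(** The bound [phi_le] is invariant under scaling: 4^-(k+1) |phi(w / 2^(k+1))| <= 1 / (4 |w|^2).
    This is a majorant independent of k. *)
Lemma phi_pairs z : 0 <= re z < 1 -> ee z != 1 ->
  twopii R ^+ 2 * phi z = csum (fun n => (z + n%:R) ^- 2 + (z - n.+1%:R) ^- 2).
Proof.
move=> x01 z1; have z0 : z != 0 by apply: contraNneq z1 => ->; rewrite ee0.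
have [d d0 Hd] := lattice_line_far x01 z0.
have znz n : z + n%:R != 0 /\ z - n.+1%:R != 0.
  have p : 0 < d * n.+1%:R by rewrite mulr_gt0.
  by have [h1 h2] := Hd n; rewrite -!normc_gt0; split; apply: lt_le_trans p _.
pose T k n : C := if (n < 2 ^ k)%N then twopii R ^+ 2 * (4^-1 ^+ k.+1 *
  phi ((z + n%:R) / 2 ^+ k.+1)) + twopii R ^+ 2 * (4^-1 ^+ k.+1 * phi ((z - n.+1%:R) / 2 ^+ k.+1)) else 0.
pose K := normc (twopii R) ^+ 2 * (2 * d ^+ 2)^-1.
have K0 : 0 <= K by rewrite mulr_ge0 ?exprn_ge0 ?normc_ge0 // invr_ge0 mulr_ge0 ?exprn_ge0 // ltW.
have scaled w k n : w != 0 -> `|re (w / 2 ^+ k.+1)| <= 1 / 2 -> d * n.+1%:R <= normc w ->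
    normc (4^-1 ^+ k.+1 * phi (w / 2 ^+ k.+1)) <= (4 * d ^+ 2)^-1 * n.+1%:R ^- 2.
  move=> w0 xh dw.
  have n2 : (2 ^+ k.+1 : C) != 0 by rewrite expf_neq0 // pnatr_eq0.
  have h0 : w / 2 ^+ k.+1 != 0 by rewrite mulf_neq0 ?invr_neq0.
  rewrite normcM normcX normcV normc_nat.
  have p4 : 0 <= (4^-1 : R) ^+ k.+1 by rewrite exprn_ge0 // invr_ge0.
  apply: le_trans (ler_wpM2l p4 (phi_le xh h0)) _.
  have wn : 0 < normc w by rewrite normc_gt0.
  rewrite normcM normcV normcX normc_nat.
  have -> : (4^-1 : R) ^+ k.+1 * (4 * (normc w / 2 ^+ k.+1) ^+ 2)^-1 = (4 * normc w ^+ 2)^-1.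
    by rewrite pow4V; field; rewrite expf_neq0 ?gt_eqF.
  have dn : 0 < d * n.+1%:R by rewrite mulr_gt0.
  rewrite -invfM -mulrA -exprMn lef_pV2 ?posrE ?mulr_gt0 ?exprn_gt0 //.
  by rewrite ler_wpM2l // lerXn2r // nnegrE ltW.
have TM k : dominated_by (T k) (fun n => K * n.+1%:R ^- 2).
  move=> n; rewrite /T; case: ltnP => nk; last first.
    by rewrite normc0 mulr_ge0 // invr_ge0 exprn_ge0.
  have [s1 s2] := half_strip x01 nk; have [h1 h2] := Hd n; have [y1 y2] := znz n.
  rewrite -mulrDr normcM normcX /K -mulrA ler_wpM2l ?exprn_ge0 ?normc_ge0 //.
  apply: le_trans (normcD _ _) _.
  have := lerD (scaled _ k n y1 s1 h1) (scaled _ k n y2 s2 h2).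
  by rewrite -mulrDl -[_^-1 + _^-1]mulr2n -mulr_natl; congr (_ <= _ * _); field; exact: lt0r_neq0.
have lim1 : cvC \oo (fun k => csum (T k)) (csum (fun n => (z + n%:R) ^- 2 + (z - n.+1%:R) ^- 2)).
  apply: (tannery _ _ (bounded_sumsZ K0 bounded_inv_sqr)); last by exists 0%N => // k _; exact: TM.
  move=> n; have [y1 y2] := znz n.
  apply: cvC_near (cvgCD (phi_scale y1) (phi_scale y2)).
  by exists n => // k /= nk; rewrite /T (leq_ltn_trans nk) // ltn_expl.
refine (limC_unique _ lim1).
apply: (@cvC_near _ _ _ _ (fun=> twopii R ^+ 2 * phi z)); last exact: cvgC_cst.
exists 0%N => // k _; rewrite (@csum_fin _ _ (2 ^ k)); last first.
  by move=> n nk; rewrite /T ltnNge nk.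
rewrite (dyadic_pairs phi_periodic phi_double k z1) /psum !mulr_sumr.
by apply: eq_bigr => n _; rewrite /T ltn_ord; ring.
Qed.

Lemma one_minus_ee_neq0 z : `|re z| <= 1 / 2 -> z != 0 -> 1 - ee z != 0.
Proof.
move=> xh z0; have h := one_minus_ee_ge xh.
apply: contraTneq h => ->; rewrite normc0 expr0n [_%:R]/= -ltNge.
by rewrite !mulr_gt0 ?exprn_gt0 ?normc_gt0 ?ee_neq0.
Qed.

(** Single terms of the cotangent series are not absolutely summable. The sum of a pair equals (1 -
    e(a+b)) / ((1 - e(a)) (1 - e(b))), and its numerator is small when a + b is. *)
Lemma kappa_add a b : `|re a| <= 1 / 2 -> `|re b| <= 1 / 2 -> a != 0 -> b != 0 ->
  1 / 4 <= normc (ee (a + b)) ->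
  normc (kappa a + kappa b) <= normc (1 - ee (a + b)) / (2 * (normc a * normc b)).
Proof.
move=> ah bh a0 b0 w4.
have [ua ub] := (one_minus_ee_neq0 ah a0, one_minus_ee_neq0 bh b0).
have -> : kappa a + kappa b = (1 - ee (a + b)) / ((1 - ee a) * (1 - ee b)).
  by rewrite /kappa eeD; field; rewrite ua ub.
have [na nb] : 0 < normc a /\ 0 < normc b by rewrite !normc_gt0.
have [ka kb] := (one_minus_ee_ge ah, one_minus_ee_ge bh).
rewrite !(normcM, normcV) ler_wpM2l ?normc_ge0 // lef_pV2 ?posrE ?mulr_gt0 ?normc_gt0 //.
rewrite -(@ler_pXn2r _ 2) ?nnegrE ?mulr_ge0 ?normc_ge0 // !exprMn.
have p : 0 <= 4 * normc b ^+ 2 * normc (ee b).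
  by rewrite !mulr_ge0 ?exprn_ge0 ?normc_ge0.
have q : 0 <= 4 * normc a ^+ 2 * normc (ee a).
  by rewrite !mulr_ge0 ?exprn_ge0 ?normc_ge0.
apply: le_trans (ler_pM q p ka kb).
rewrite eeD normcM in w4.
rewrite (_ : 4 * _ * _ * _ = 16 * (normc a ^+ 2 * normc b ^+ 2) * (normc (ee a) * normc (ee b))); last by ring.
have : 0 <= normc a ^+ 2 * normc b ^+ 2 by rewrite mulr_ge0 ?exprn_ge0 ?normc_ge0.
nra.
Qed.

Lemma kappa_pairs z : 0 <= re z < 1 -> ee z != 1 ->
  - twopii R * kappa z = csum (fun n => (z + n%:R)^-1 + (z - n.+1%:R)^-1).
Proof.
move=> x01 z1; have z0 : z != 0 by apply: contraNneq z1 => ->; rewrite ee0.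
have [d d0 Hd] := lattice_line_far x01 z0.
have znz n : z + n%:R != 0 /\ z - n.+1%:R != 0.
  have p : 0 < d * n.+1%:R by rewrite mulr_gt0.
  by have [h1 h2] := Hd n; rewrite -!normc_gt0; split; apply: lt_le_trans p _.
pose T k n : C := if (n < 2 ^ k)%N then - twopii R * (2^-1 ^+ k.+1 *
  kappa ((z + n%:R) / 2 ^+ k.+1)) + - twopii R * (2^-1 ^+ k.+1 * kappa ((z - n.+1%:R) / 2 ^+ k.+1)) else 0.
(* [L] bounds (e(h) - 1) / h for h near 0, the limit at 0 being 2 pi i. *)
pose L := normc (twopii R) + 1.
pose K := normc (twopii R) * (L * normc (2 * z - 1) / (2 * d ^+ 2)).
have L0 : 0 <= L by rewrite addr_ge0 ?normc_ge0.
have K0 : 0 <= K.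
  by rewrite !mulr_ge0 ?normc_ge0 // invr_ge0 mulr_ge0 ?exprn_ge0 // ltW.
have [p Hp cp] := ee_quotient R.
(* For every n the two arguments add up to (2 z - 1) / 2^(k+1). Once this is small enough for [L]
   and for |e(a + b)| >= 1/4, one majorant serves all n; hence it holds for large k. *)
have TM : \forall k \near \oo, dominated_by (T k) (fun n => K * n.+1%:R ^- 2).
  pose proof (cvgC_normc (cvC_comp (half_pow_cvg (2 * z - 1)) cp)) as c1.
  move/cvgrPdist_lt/(_ 1 ltr01) in c1.
  pose proof (has_deriv_cvg (has_deriv_ee (0 : C))) as ce; rewrite ee0 in ce.
  have h34 : 0 < 3 / 4 :> R by rewrite divr_gt0.
  pose proof (cvgC_normc (cvC_comp (half_pow_cvg (2 * z - 1)) ce)) as c2.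
  move/cvgrPdist_lt/(_ _ h34) in c2.
  near=> k => n; rewrite /T; case: ltnP => nk; last first.
    by rewrite normc0 mulr_ge0 // invr_ge0 exprn_ge0.
  have n2 : (2 ^+ k.+1 : C) != 0 by rewrite expf_neq0 // pnatr_eq0.
  have [s1 s2] := half_strip x01 nk; have [h1 h2] := Hd n; have [y1 y2] := znz n.
  rewrite -!mulrDr normcM normcN /K -mulrA ler_wpM2l ?normc_ge0 //.
  set a := (z + n%:R) / _ in s1 *; set b := (z - n.+1%:R) / _ in s2 *.
  have abE : a + b = (2 * z - 1) / 2 ^+ k.+1.
    by rewrite /a /b -mulrDl -natr1; congr (_ / _); ring.
  have a0 : a != 0 by rewrite mulf_neq0 ?invr_neq0.
  have b0 : b != 0 by rewrite mulf_neq0 ?invr_neq0.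
  have e4 : 1 / 4 <= normc (ee (a + b)).
    have : `|normc 1 - normc (ee ((2 * z - 1) / 2 ^+ k.+1))| < 3 / 4 by near: k; exact: c2.
    by rewrite normc1 -abE ltr_norml => /andP[_]; lra.
  have pL : normc (p (a + b)) <= L.
    have : `|normc (twopii R) - normc (p ((2 * z - 1) / 2 ^+ k.+1))| < 1 by near: k; exact: c1.
    by rewrite -abE ltr_norml /L => /andP[]; lra.
  rewrite normcM normcX normcV normc_nat.
  have p2 : 0 <= (2^-1 : R) ^+ k.+1 by rewrite exprn_ge0 // invr_ge0.
  apply: le_trans (ler_wpM2l p2 (kappa_add s1 s2 a0 b0 e4)) _.
  rewrite normc_distC Hp normcM abE !normcM !normcV !normcX !normc_nat exprVn.
  have N0 : 0 < (2 : R) ^+ k.+1 by rewrite exprn_gt0.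
  have [m1 m2] : 0 < normc (z + n%:R) /\ 0 < normc (z - n.+1%:R) by rewrite !normc_gt0.
  rewrite -abE; set P := normc (p _) in pL *; set W := normc (2 * z - 1).
  rewrite [X in X <= _](_ : _ = P * W / (2 * (normc (z + n%:R) * normc (z - n.+1%:R)))); last first.
    by field; rewrite !gt_eqF.
  have dn : 0 < d * n.+1%:R by rewrite mulr_gt0.
  rewrite -(mulrA (L * W)); apply: ler_pM; rewrite ?mulr_ge0 ?normc_ge0 ?invr_ge0 ?mulr_ge0 ?normc_ge0 //.
    by rewrite ler_wpM2r ?normc_ge0.
  rewrite -invfM lef_pV2 ?posrE ?mulr_gt0 ?exprn_gt0 //.
  rewrite -mulrA -exprMn ler_wpM2l // expr2 ler_pM // ltW //.
have lim1 : cvC \oo (fun k => csum (T k)) (csum (fun n => (z + n%:R)^-1 + (z - n.+1%:R)^-1)).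
  apply: (tannery _ TM (bounded_sumsZ K0 bounded_inv_sqr)).
  move=> n; have [y1 y2] := znz n.
  apply: cvC_near (cvgCD (kappa_scale y1) (kappa_scale y2)).
  by exists n => // k /= nk; rewrite /T (leq_ltn_trans nk) // ltn_expl.
refine (limC_unique _ lim1).
apply: (@cvC_near _ _ _ _ (fun=> - twopii R * kappa z)); last exact: cvgC_cst.
exists 0%N => // k _; rewrite (@csum_fin _ _ (2 ^ k)); last first.
  by move=> n nk; rewrite /T ltnNge nk.
rewrite (dyadic_pairs kappa_periodic kappa_double k z1) /psum !mulr_sumr.
by apply: eq_bigr => n _; rewrite /T ltn_ord; ring.
Unshelve. all: by end_near. Qed.

Lemma ee_neq1_upper z : 0 < im z -> ee z != 1.
Proof.
move=> z0; have := normc_ee_lt1 z0; apply: contraTneq => ->.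
by rewrite normc1 ltxx.
Qed.

(** The imaginary part of x t + y controls |x|, and then the triangle inequality controls |y|; [S]
    adds up the two constants. *)
Lemma lattice_far t : 0 < im t ->
  exists2 d : R, 0 < d & forall x y, d * (`|x| + `|y|) <= normc (x%:C * t + y%:C).
Proof.
move=> t0; set v := im t in t0 *.
have n0 := normc_ge0 t.
pose S := v^-1 + 1 + normc t / v.
have iv : 0 < v^-1 by rewrite invr_gt0.
have tv : 0 <= normc t / v by apply: divr_ge0 => //; exact: ltW.
have S0 : 0 < S by rewrite /S; lra.
exists S^-1; first by rewrite invr_gt0.
move=> x y; set w := x%:C * t + y%:C; rewrite ler_pdivrMl //.
have hx : `|x| * v <= normc w.
  have -> : `|x| * v = `|im w| by rewrite /w imD imM /= mul0r !addr0 normrM (gtr0_norm t0).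
  exact: im_le.
have hy : `|y| <= normc w + `|x| * normc t.
  have -> : `|y| = normc (w - x%:C * t) by rewrite /w addrAC subrr add0r normc_real.
  by apply: le_trans (normcB _ _) _; rewrite normcM normc_real.
have hx' : `|x| <= normc w / v by rewrite ler_pdivlMr.
have := ler_wpM2r n0 hx'; rewrite /S; lra.
Qed.

Definition symsum (g : C -> C) z : C := g z + csum (fun n => g (z + n.+1%:R) + g (z - n.+1%:R)).

(** Passing from the pairs (n, -n-1) to the pairs (n, -n) changes the partial sums by the central
    term, already in [symsum], and one boundary term tending to 0. *)
Lemma symsum_pairs (g : C -> C) z l :
  cvC \oo (psum (fun n => g (z + n%:R) + g (z - n.+1%:R))) l ->
  cvC \oo (fun n => g (z + n%:R)) 0 -> symsum g z = l.
Proof.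
move=> cl c0; have -> : l = g z + (l - g z - 0) by ring.
congr (_ + _); apply: psum_lim_csum.
have E n : psum (fun n => g (z + n.+1%:R) + g (z - n.+1%:R)) n =
    psum (fun n => g (z + n%:R) + g (z - n.+1%:R)) n - g z + g (z + n%:R).
  elim: n => [|n IH]; first by rewrite /psum !big_ord0 addr0; ring.
  by rewrite /psum in IH *; rewrite !big_ord_recr /= IH; ring.
have -> : l - g z - 0 = l - g z + 0 by ring.
apply: cvC_near (cvgCD (cvgCB cl (cvgC_cst (g z))) c0).
by exists 0%N => // n _; rewrite E.
Qed.

Lemma bounded_inv_sqr_shift : bounded_sums (fun n => (n.+2%:R : R) ^- 2).
Proof.
apply: bounded_sums_le bounded_inv_sqr => n.
by rewrite lef_pV2 ?posrE ?exprn_gt0 // lerXn2r ?nnegrE // ler_nat.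
Qed.

Lemma lattice_far_nat z : 0 < im z -> exists2 d : R, 0 < d & forall n,
  d * n.+1%:R <= normc (z + n%:R) /\ d * n.+1%:R <= normc (z - n%:R).
Proof.
move=> /lattice_far [d d0 H]; exists d => // n.
have := H 1 n%:R; have := H 1 (- n%:R).
rewrite rmorphN !rmorph_nat mul1r normrN normr1 ger0_norm // -nat1r.
by split.
Qed.

Lemma cvg_inv_nat (d : R) : 0 < d -> (fun n => (d * n.+1%:R)^-1 : R) @ \oo --> (0 : R).
Proof.
move=> d0; have -> : (0 : R) = d^-1 * 0 by rewrite mulr0.
rewrite (_ : (fun n => _) = fun n => d^-1 * harmonic n); last first.
  by apply/funext => n; rewrite /= invfM.
by apply: cvgM; [exact: cvg_cst|exact: cvg_harmonic].
Qed.

Lemma upper_inv_cvg z : 0 < im z ->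
  cvC \oo (fun n => (z + n%:R)^-1) 0 /\ cvC \oo (fun n => (z - n%:R)^-1) 0.
Proof.
move=> /lattice_far_nat [d d0 H].
have K (f : nat -> C) : (forall n, d * n.+1%:R <= normc (f n)) -> cvC \oo (fun n => (f n)^-1) 0.
  move=> Hf; apply/cvgC_norm; apply: (@squeeze_cvgr _ _ _ _ (cst 0) (fun n => (d * n.+1%:R)^-1)) => //.
  - exists 0%N => // n _; rewrite normc_ge0 sub0r normcN normcV lef_pV2 ?posrE ?mulr_gt0 //.
      exact: Hf.
    by apply: lt_le_trans (Hf n); rewrite mulr_gt0.
  - exact: cvg_cst.
  - exact: cvg_inv_nat.
by split; apply: K => n; case: (H n).
Qed.

(** Shifting a symmetric window by one trades one boundary term for another, and both tend to 0. *)
Lemma symsum_shift (g : C -> C) z l :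
  cvC \oo (psum (fun n => g (z + n.+1%:R) + g (z - n.+1%:R))) l ->
  cvC \oo (fun n => g (z + n%:R)) 0 -> cvC \oo (fun n => g (z - n%:R)) 0 ->
  symsum g (z + 1) = symsum g z.
Proof.
move=> cl c1 c2.
have El : csum (fun n => g (z + n.+1%:R) + g (z - n.+1%:R)) = l by exact: psum_lim_csum.
have sh (f : nat -> C) (b : C) : cvC \oo f b -> cvC \oo (fun n => f n.+1) b.
  move=> /cvgCP H; apply/cvgCP => e /H [N _ HN]; exists N => // n /= Nn.
  by apply: HN; rewrite /= ltnW.
rewrite /symsum El; have -> : g z + l = g (z + 1) + (l + g z - g (z + 1) + 0 - 0) by ring.
congr (_ + _); apply: psum_lim_csum.
have E n : psum (fun n => g (z + 1 + n.+1%:R) + g (z + 1 - n.+1%:R)) n =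
    psum (fun n => g (z + n.+1%:R) + g (z - n.+1%:R)) n + g z - g (z + 1) + g (z + n.+1%:R) - g (z - n%:R).
  elim: n => [|n IH]; first by rewrite /psum !big_ord0 subr0; ring.
  rewrite /psum in IH *; rewrite !big_ord_recr /= IH.
  have -> : z + 1 + n.+1%:R = z + n.+2%:R by rewrite -[n.+2%:R]nat1r addrA.
  have -> : z + 1 - n.+1%:R = z - n%:R by rewrite -[n.+1%:R]nat1r; ring.
  by ring.
apply: cvC_near (cvgCB (cvgCD (cvgCB (cvgCD cl (cvgC_cst (g z))) (cvgC_cst (g (z + 1)))) (sh _ _ c1)) c2).
by exists 0%N => // n _; rewrite E.
Qed.

Definition inv_sqr (z : C) : C := z ^- 2.
Definition inv (z : C) : C := z^-1.

Lemma invD (a b : C) : a != 0 -> b != 0 -> a^-1 + b^-1 = (a + b) / (a * b).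
Proof. by move=> a0 b0; field; rewrite a0 b0. Qed.

Lemma inv_sqr_dominated z : 0 < im z -> exists2 K, 0 <= K &
  dominated_by (fun n => inv_sqr (z + n.+1%:R) + inv_sqr (z - n.+1%:R)) (fun n => K * n.+2%:R ^- 2).
Proof.
move=> /lattice_far_nat [d d0 H]; exists (2 * d ^- 2).
  by rewrite mulr_ge0 // invr_ge0 exprn_ge0 // ltW.
move=> n; have [h1 h2] := H n.+1.
have dn : 0 < d * n.+2%:R by rewrite mulr_gt0.
have K w : d * n.+2%:R <= normc w -> normc (inv_sqr w) <= d ^- 2 * n.+2%:R ^- 2.
  move=> h; rewrite /inv_sqr normcV normcX -invfM -exprMn lef_pV2 ?posrE ?exprn_gt0 //.
    by rewrite lerXn2r // nnegrE ?normc_ge0 // ltW.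
  exact: lt_le_trans dn h.
apply: le_trans (normcD _ _) _; have := lerD (K _ h1) (K _ h2).
by move=> h; rewrite -(mulrA 2) mulr_natl mulr2n.
Qed.

(** In pairs, the terms combine to 2 z / ((z + n) (z - n)), of order n^-2. *)
Lemma inv_dominated z : 0 < im z -> exists2 K, 0 <= K &
  dominated_by (fun n => inv (z + n.+1%:R) + inv (z - n.+1%:R)) (fun n => K * n.+2%:R ^- 2).
Proof.
move=> /lattice_far_nat [d d0 H]; exists (normc (2 * z) * d ^- 2).
  by rewrite mulr_ge0 ?normc_ge0 // invr_ge0 exprn_ge0 // ltW.
move=> n; have [h1 h2] := H n.+1.
have dn : 0 < d * n.+2%:R by rewrite mulr_gt0.
have [p1 p2] : z + n.+1%:R != 0 /\ z - n.+1%:R != 0.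
  by rewrite -!normc_gt0; split; apply: lt_le_trans dn _.
rewrite /inv (invD p1 p2) (_ : _ + _ = 2 * z); last by ring.
rewrite normcM -mulrA ler_wpM2l ?normc_ge0 // normcV normcM -invfM -exprMn lef_pV2 ?posrE ?mulr_gt0 ?exprn_gt0 //.
- by rewrite expr2 ler_pM // ltW.
- exact: lt_le_trans dn h1.
- exact: lt_le_trans dn h2.
Qed.

Lemma inv_sqr_cvg0 (f : nat -> C) : cvC \oo (fun n => (f n)^-1) 0 ->
  cvC \oo (fun n => inv_sqr (f n)) 0.
Proof.
move=> H; pose proof (cvgCX 2 H) as K; rewrite expr0n in K.
by apply: cvC_near K; exists 0%N => // n _; rewrite exprVn.
Qed.

(** The expansions are known on the strip 0 <= re z < 1; periodicity carries them to the half
    plane. *)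
Lemma strip_ind (P : C -> Prop) : (forall z, 0 < im z -> 0 <= re z < 1 -> P z) ->
  (forall z, 0 < im z -> P z <-> P (z + 1)) -> forall z, 0 < im z -> P z.
Proof.
move=> base step.
have imn z n : im (z + n%:R) = im z by rewrite imD im_nat addr0.
have nn n z : 0 < im z -> P z <-> P (z + n%:R).
  elim: n => [|n IH] z0; first by rewrite addr0.
  by rewrite -natr1 addrA IH // step // imn.
move=> z z0; set m := Num.floor (re z).
have m1 := ge_floor (re z); have m2 := floorD1_gt (re z); rewrite -/m in m1 m2.
case: m m1 m2 => n; rewrite ?NegzE ?intrD.
  move=> m1 m2; rewrite -(subrK n%:R z) -nn.
    by apply: base; rewrite ?imD ?reD ?imN ?reN ?im_nat ?re_nat ?subr0 //; lra.
  by rewrite imD imN im_nat subr0.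
rewrite intrN => m1 m2; apply/(nn n.+1) => //.
by apply: base; rewrite ?imD ?reD ?im_nat ?re_nat ?addr0 //; lra.
Qed.

Lemma phi_pairs_cvg z : 0 < im z -> exists l,
  cvC \oo (psum (fun n => inv_sqr (z + n%:R) + inv_sqr (z - n.+1%:R))) l.
Proof.
move=> /lattice_far_nat [d d0 H].
exists (csum (fun n => inv_sqr (z + n%:R) + inv_sqr (z - n.+1%:R))).
apply: (@psum_cvg _ _ (fun n => 2 * d ^- 2 * n.+1%:R ^- 2)); last first.
  apply: (bounded_sumsZ _ bounded_inv_sqr).
  by rewrite mulr_ge0 // invr_ge0 exprn_ge0 // ltW.
move=> n; have [h1 _] := H n; have [_ h2] := H n.+1.
have dn : 0 < d * n.+1%:R by rewrite mulr_gt0.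
have K w : d * n.+1%:R <= normc w -> normc (inv_sqr w) <= d ^- 2 * n.+1%:R ^- 2.
  move=> h; rewrite /inv_sqr normcV normcX -invfM -exprMn lef_pV2 ?posrE ?exprn_gt0 //.
    by rewrite lerXn2r // nnegrE ?normc_ge0 // ltW.
  exact: lt_le_trans dn h.
have h2' : d * n.+1%:R <= normc (z - n.+1%:R).
  by apply: le_trans h2; rewrite ler_wpM2l ?ler_nat // ltW.
apply: le_trans (normcD _ _) _; have := lerD (K _ h1) (K _ h2').
by move=> h; rewrite -(mulrA 2) mulr_natl mulr2n.
Qed.

Lemma kappa_pairs_cvg z : 0 < im z -> exists l,
  cvC \oo (psum (fun n => inv (z + n%:R) + inv (z - n.+1%:R))) l.
Proof.
move=> /lattice_far_nat [d d0 H].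
exists (csum (fun n => inv (z + n%:R) + inv (z - n.+1%:R))).
apply: (@psum_cvg _ _ (fun n => normc (2 * z - 1) * d ^- 2 * n.+1%:R ^- 2)); last first.
  apply: (bounded_sumsZ _ bounded_inv_sqr).
  by rewrite mulr_ge0 ?normc_ge0 // invr_ge0 exprn_ge0 // ltW.
move=> n; have [h1 _] := H n; have [_ h2] := H n.+1.
have dn : 0 < d * n.+1%:R by rewrite mulr_gt0.
have h2' : d * n.+1%:R <= normc (z - n.+1%:R).
  by apply: le_trans h2; rewrite ler_wpM2l ?ler_nat // ltW.
have [p1 p2] : z + n%:R != 0 /\ z - n.+1%:R != 0.
  by rewrite -!normc_gt0; split; apply: lt_le_trans dn _.
rewrite /inv (invD p1 p2) (_ : _ + _ = 2 * z - 1); last by rewrite -natr1; ring.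
rewrite normcM -mulrA ler_wpM2l ?normc_ge0 // normcV normcM -invfM -exprMn lef_pV2 ?posrE ?mulr_gt0 ?exprn_gt0 //.
- by rewrite expr2 ler_pM // ltW.
- exact: lt_le_trans dn h1.
- exact: lt_le_trans dn h2'.
Qed.

Lemma lipschitz_phi z : 0 < im z -> symsum inv_sqr z = twopii R ^+ 2 * phi z.
Proof.
move: z; apply: strip_ind => [z z0 x01|z z0].
  rewrite phi_pairs ?ee_neq1_upper //; apply: symsum_pairs.
    have [l cl] := phi_pairs_cvg z0.
    by have := cl; rewrite -[X in cvC _ _ X -> _](psum_lim_csum cl).
  exact: (inv_sqr_cvg0 (upper_inv_cvg z0).1).
rewrite phi_periodic; have [K K0 HK] := inv_sqr_dominated z0.
have [c1 c2] := upper_inv_cvg z0.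
rewrite (symsum_shift (psum_cvg HK (bounded_sumsZ K0 bounded_inv_sqr_shift))) //; exact: inv_sqr_cvg0.
Qed.

Lemma lipschitz_kappa z : 0 < im z -> symsum inv z = - twopii R * kappa z.
Proof.
move: z; apply: strip_ind => [z z0 x01|z z0].
  rewrite kappa_pairs ?ee_neq1_upper //; apply: symsum_pairs.
    have [l cl] := kappa_pairs_cvg z0.
    by have := cl; rewrite -[X in cvC _ _ X -> _](psum_lim_csum cl).
  exact: (upper_inv_cvg z0).1.
rewrite kappa_periodic; have [K K0 HK] := inv_dominated z0.
have [c1 c2] := upper_inv_cvg z0.
by rewrite (symsum_shift (psum_cvg HK (bounded_sumsZ K0 bounded_inv_sqr_shift))).
Qed.

Lemma psumS (a : nat -> C) n : psum a n.+1 = psum a n + a n.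
Proof. exact: big_ord_recr. Qed.

Definition zeta2 : C := csum (fun n => (n.+1%:R : C) ^- 2).

Lemma zeta2_dominated : dominated_by (fun n => (n.+1%:R : C) ^- 2) (fun n => n.+1%:R ^- 2).
Proof. by move=> n; rewrite normcV normcX normc_nat. Qed.

(* The expansion at [z = 1/2] sums the odd inverse squares. *)
Lemma zeta2E : zeta2 = - twopii R ^+ 2 / 24.
Proof.
have h0 : 0 <= re (2^-1 : C) < 1.
  have -> : (2^-1 : C) = (2^-1 : R)%:C by rewrite fmorphV rmorph_nat.
  by rewrite /=; lra.
have h1 : ee (2^-1 : C) != 1 by rewrite ee_half eq_sym -subr_eq0 opprK -(natrD _ 1 1) pnatr_eq0.
have := phi_pairs h0 h1; rewrite /phi ee_half.
pose o n : C := (n.*2.+1%:R : C) ^- 2.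
have od : dominated_by o (fun n => n.+1%:R ^- 2).
  move=> n; rewrite normcV normcX normc_nat lef_pV2 ?posrE ?exprn_gt0 //.
  by rewrite lerXn2r ?nnegrE // ler_nat ltnS -addnn leq_addr.
have co := psum_cvg od bounded_inv_sqr.
(* At z = 1/2 the two terms of a pair coincide, each being 4 / (2n+1)^2. *)
rewrite (eq_csum (b := fun n => 8 * o n)); last first.
  move=> n; rewrite /o -addnn -[n.+1%:R]natr1 -[(n + n).+1%:R]natr1 natrD.
  have n0 : (2 * n%:R + 1 : C) != 0 by rewrite -(natrM _ 2) natr1 pnatr_eq0.
  have -> : 2^-1 - (n%:R + 1) = - ((2 * n%:R + 1) / 2) :> C by field.
  have -> : 2^-1 + n%:R = (2 * n%:R + 1) / 2 :> C by field.
  have -> : n%:R + n%:R + 1 = 2 * n%:R + 1 :> C by ring.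
  by rewrite sqrrN; field.
rewrite (csumZ _ od bounded_inv_sqr) => E.
have cz := psum_cvg zeta2_dominated bounded_inv_sqr.
(* The even terms make up a quarter of the series, so zeta(2) is 4/3 of the odd part. *)
have split_ n : psum (fun n => (n.+1%:R : C) ^- 2) n.*2 =
    psum o n + 4^-1 * psum (fun n => (n.+1%:R : C) ^- 2) n.
  elim: n => [|n IH]; first by rewrite /psum !big_ord0 mulr0 addr0.
  rewrite doubleS !psumS IH /o.
  have -> : n.*2.+2%:R = 2 * n.+1%:R :> C by rewrite -natrM mul2n doubleS.
  have n0 : (n.+1%:R : C) != 0 by rewrite pnatr_eq0.
  have n1 : (n.*2.+1%:R : C) != 0 by rewrite pnatr_eq0.
  have -> : (2 * n.+1%:R) ^- 2 = 4^-1 * n.+1%:R ^- 2 :> C.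
    by rewrite exprMn invfM; congr (_^-1 * _); ring.
  by rewrite [4^-1 * (_ + _)]mulrDr -!addrA; congr (_ + _); rewrite addrCA.
have cz2 : cvC \oo (fun n => psum (fun n => (n.+1%:R : C) ^- 2) n.*2) zeta2.
  move/cvgCP: cz => H; apply/cvgCP => e /H [N _ HN]; exists N => // n /= Nn.
  by apply: HN => /=; rewrite (leq_trans Nn) // -addnn leq_addr.
have : zeta2 = csum o + 4^-1 * zeta2.
  refine (limC_unique cz2 _).
  by apply: cvC_near (cvgCD co (cvgCM (cvgC_cst 4^-1) cz)); exists 0%N => // n _; rewrite split_.
have -> : csum o = - twopii R ^+ 2 / 32.
  have -> : csum o = 8^-1 * (8 * csum o) by field.
  by rewrite -E; field.
by move=> Z; have -> : zeta2 = 4 / 3 * (zeta2 - 4^-1 * zeta2); [field|rewrite {1}Z; field].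
Qed.

End Lipschitz.

(** * The transformation of eta under t -> -1/t *)

Section EisensteinSummation.
Variable R : realType.
Local Notation C := (Cplx R).
Variable t : C.
Hypothesis t0 : 0 < im t.

Lemma lef_inv (a b : R) : 0 < a -> a <= b -> b^-1 <= a^-1.
Proof. by move=> a0 ab; rewrite lef_pV2 ?posrE // (lt_le_trans a0). Qed.

Let ss (m k : nat) : C := inv_sqr (m.+1%:R * t - k.+1%:R) + inv_sqr (m.+1%:R * t + k.+1%:R).
Let vv (m : nat) (x : R) : C := (m.+1%:R * t + x%:C)^-1 - (m.+1%:R * t - x%:C)^-1.
Let hk (k : nat) : R := k%:R + 2^-1.
(** The integral of ((m+1) t + x)^-2 + ((m+1) t - x)^-2 over the unit interval centred at x = k + 1.
    It telescopes in k and approximates [ss m k] by the midpoint rule; hence the half-integers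
    [hk]. *)
Let bb m k : C := vv m (hk k) - vv m (hk k.+1).
Let VV (x : R) : C := csum (fun m => vv m x).

Lemma far_nat_real : exists2 d : R, 0 < d & forall m (x : R), 0 <= x ->
  d * (m.+1%:R + x) <= normc (m.+1%:R * t + x%:C) /\ d * (m.+1%:R + x) <= normc (m.+1%:R * t - x%:C).
Proof.
have [d d0 H] := lattice_far t0; exists d => // m x x0.
have := H m.+1%:R x; have := H m.+1%:R (- x).
by rewrite rmorphN !rmorph_nat normrN !ger0_norm.
Qed.

Lemma vv_dominated (x : R) : 0 <= x -> exists2 K, 0 <= K &
  dominated_by (fun m => vv m x) (fun m => K * m.+1%:R ^- 2).
Proof.
move=> x0; have [d d0 H] := far_nat_real; exists (normc (2 * x%:C : C) * d ^- 2).
  by rewrite mulr_ge0 ?normc_ge0 // invr_ge0 exprn_ge0 // ltW.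
move=> m; have [h1 h2] := H m x x0.
have dn : 0 < d * m.+1%:R by rewrite mulr_gt0.
have h0 : d * m.+1%:R <= d * (m.+1%:R + x) by rewrite ler_wpM2l ?lerDl // ltW.
have h1' := le_trans h0 h1; have h2' := le_trans h0 h2.
have p1 : m.+1%:R * t + x%:C != 0 by rewrite -normc_gt0; apply: lt_le_trans dn _.
have p2 : m.+1%:R * t - x%:C != 0 by rewrite -normc_gt0; apply: lt_le_trans dn _.
rewrite /vv -[- _^-1]invrN (invD p1) ?oppr_eq0 // (_ : _ + _ = 2 * x%:C); last by ring.
rewrite normcM -mulrA ler_wpM2l ?normc_ge0 // normcV normcM normcN -invfM -exprMn lef_pV2 ?posrE ?mulr_gt0 ?exprn_gt0 ?normc_gt0 //.
by rewrite expr2 ler_pM // ltW.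
Qed.

Lemma vv_cvg0 m : cvC \oo (fun k => vv m (hk k)) 0.
Proof.
have [d d0 H] := far_nat_real; apply/cvgC_norm.
apply: (@squeeze_cvgr _ _ _ _ (cst 0) (fun k => 4 * (d * k.+1%:R)^-1)) => //.
- exists 0%N => // k _; rewrite normc_ge0 sub0r normcN /=.
  have x0 : 0 <= hk k by rewrite /hk; have := ler0n R k; lra.
  have [h1 h2] := H m _ x0.
  have dn : 0 < d * k.+1%:R / 2 by rewrite divr_gt0 ?mulr_gt0.
  have h0 : d * k.+1%:R / 2 <= d * (m.+1%:R + hk k).
    rewrite -mulrA ler_wpM2l ?(ltW d0) // /hk -[k.+1%:R]natr1.
    by have := ler0n R k; have := ler0n R m.+1; lra.
  apply: le_trans (normcB _ _) _; rewrite !normcV.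
  have a1 : (normc (m.+1%:R * t + (hk k)%:C))^-1 <= (d * k.+1%:R / 2)^-1.
    exact: lef_inv dn (le_trans h0 h1).
  have a2 : (normc (m.+1%:R * t - (hk k)%:C))^-1 <= (d * k.+1%:R / 2)^-1.
    exact: lef_inv dn (le_trans h0 h2).
  have E : (d * k.+1%:R / 2)^-1 = 2 * (d * k.+1%:R)^-1 by rewrite invf_div.
  by move: a1 a2; rewrite E; set y := (d * _)^-1; lra.
- exact: cvg_cst.
- have -> : (0 : R) = 4 * 0 by rewrite mulr0.
  by apply: cvgM; [exact: cvg_cst|exact: cvg_inv_nat].
Qed.

(** The midpoint error w^-2 - 1/(w^2 - 1/4) = -(1/4) / (w^2 (w^2 - 1/4)) has order |w|^-4. With |w|
    at least a multiple of m + k + 2 it is summable over the quadrant. *)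
Lemma rr_bound : exists2 K, 0 <= K & forall m k,
  normc (ss m k - bb m k) <= K * m.+1%:R ^- 2 * k.+1%:R ^- 2.
Proof.
have [d d0 H] := lattice_far t0.
have H' m (x : R) : d * (m.+1%:R + `|x|) <= normc (m.+1%:R * t + x%:C).
  by have := H m.+1%:R x; rewrite rmorph_nat ger0_norm.
exists (2 * d ^- 4); first by rewrite mulr_ge0 // invr_ge0 exprn_ge0 // ltW.
move=> m k; set N : R := m.+1%:R + k.+1%:R.
have N0 : 2 <= N by rewrite /N -natrD ler_nat addSn addnS.
have one (x : R) : `|x| = k.+1%:R ->
    normc (inv_sqr (m.+1%:R * t + x%:C) - ((m.+1%:R * t + (x - 2^-1)%:C)^-1 - (m.+1%:R * t + (x + 2^-1)%:C)^-1))
    <= d ^- 4 * N ^- 4.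
  move=> xk; have h1 := H' m x; have h2 := H' m (x - 2^-1); have h3 := H' m (x + 2^-1).
  rewrite xk -/N in h1.
  have dN : 0 < d * (N / 2) by rewrite mulr_gt0 // divr_gt0 //; lra.
  (* As N >= 2, moving x by 1/2 costs at most half of the lower bound. *)
  have g (y : R) : `|x| <= `|y| + 2^-1 -> d * (m.+1%:R + `|y|) <= normc (m.+1%:R * t + y%:C) ->
      d * (N / 2) <= normc (m.+1%:R * t + y%:C).
    move=> xy; apply: le_trans; rewrite ler_wpM2l ?(ltW d0) //; rewrite xk in xy.
    move: xy N0; rewrite /N; lra.
  have h2' := g (x - 2^-1) _ h2; have h3' := g (x + 2^-1) _ h3.
  have k2 : d * (N / 2) <= normc (m.+1%:R * t + (x - 2^-1)%:C).
    by apply: h2'; have := ler_normD (x - 2^-1) 2^-1; rewrite subrK (@ger0_norm _ 2^-1) //.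
  have k3 : d * (N / 2) <= normc (m.+1%:R * t + (x + 2^-1)%:C).
    by apply: h3'; have := ler_normB (x + 2^-1) 2^-1; rewrite addrK (@ger0_norm _ 2^-1) //.
  set w := m.+1%:R * t + x%:C in h1 *.
  have e2 : m.+1%:R * t + (x - 2^-1)%:C = w - 2^-1.
    by rewrite rmorphB fmorphV rmorph_nat addrA.
  have e3 : m.+1%:R * t + (x + 2^-1)%:C = w + 2^-1.
    by rewrite rmorphD fmorphV rmorph_nat addrA.
  rewrite e2 in k2; rewrite e3 in k3; rewrite e2 e3 {h2 h3 h2' h3' e2 e3}.
  have dN1 : 0 < d * N by rewrite mulr_gt0 //; lra.
  have w0 : w != 0 by rewrite -normc_gt0; apply: lt_le_trans dN1 _.
  have w2 : w - 2^-1 != 0 by rewrite -normc_gt0; apply: lt_le_trans dN _.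
  have w3 : w + 2^-1 != 0 by rewrite -normc_gt0; apply: lt_le_trans dN _.
  have -> : inv_sqr w - ((w - 2^-1)^-1 - (w + 2^-1)^-1) =
      - 4^-1 / (w ^+ 2 * ((w - 2^-1) * (w + 2^-1))).
    move: w2 w3; rewrite /inv_sqr; set a := w - _; set b := w + _ => a0 b0.
    have -> : a^-1 - b^-1 = (b - a) / (a * b) by field; rewrite a0 b0.
    have -> : b - a = 1 by rewrite /a /b; field.
    have -> : w ^- 2 - 1 / (a * b) = (a * b - w ^+ 2) / (w ^+ 2 * (a * b)).
      by field; rewrite a0 b0 w0.
    by congr (_ / _); rewrite /a /b; field.
  rewrite normcM normcN normcV normc_nat normcV (normcM (w ^+ 2)) normcX (normcM (w - _)).
  have -> : d ^- 4 * N ^- 4 = 4^-1 * ((d * N) ^+ 2 * ((d * (N / 2)) * (d * (N / 2))))^-1.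
    by field; rewrite !gt_eqF //; lra.
  have a1 : (d * N) ^+ 2 <= normc w ^+ 2.
    by rewrite lerXn2r // nnegrE ?normc_ge0 // ltW.
  have a2 : d * (N / 2) * (d * (N / 2)) <= normc (w - 2^-1) * normc (w + 2^-1).
    by rewrite ler_pM // ltW.
  rewrite ler_wpM2l ?invr_ge0 //; apply: lef_inv.
    by apply: mulr_gt0; [exact: exprn_gt0|exact: mulr_gt0].
  apply: ler_pM => //; first exact: exprn_ge0 (ltW dN1).
  by apply: mulr_ge0; exact: ltW.
have o1 := one (k.+1%:R) (ger0_norm (ler0n _ _)).
have o2 : normc (inv_sqr (m.+1%:R * t + (- k.+1%:R)%:C) - ((m.+1%:R * t + (- k.+1%:R - 2^-1)%:C)^-1 - (m.+1%:R * t + (- k.+1%:R + 2^-1)%:C)^-1))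
    <= d ^- 4 * N ^- 4.
  by apply: one; rewrite normrN ger0_norm.
have -> : ss m k - bb m k =
  (inv_sqr (m.+1%:R * t + (k.+1%:R)%:C) - ((m.+1%:R * t + (k.+1%:R - 2^-1)%:C)^-1 - (m.+1%:R * t + (k.+1%:R + 2^-1)%:C)^-1)) +
  (inv_sqr (m.+1%:R * t + (- k.+1%:R)%:C) - ((m.+1%:R * t + (- k.+1%:R - 2^-1)%:C)^-1 - (m.+1%:R * t + (- k.+1%:R + 2^-1)%:C)^-1)).
  have E1 : hk k = k.+1%:R - 2^-1 by rewrite /hk -[k.+1%:R]natr1; field.
  have E2 : hk k.+1 = k.+1%:R + 2^-1 by [].
  have F1 : - k.+1%:R - 2^-1 = - (k.+1%:R + 2^-1) :> R by ring.
  have F2 : - k.+1%:R + 2^-1 = - (k.+1%:R - 2^-1) :> R by ring.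
  rewrite /ss /bb /vv E1 E2 F1 F2 !(rmorphN _ (_ : R)) !rmorph_nat.
  by ring.
apply: le_trans (normcD _ _) _; apply: le_trans (lerD o1 o2) _.
have -> : d ^- 4 * N ^- 4 + d ^- 4 * N ^- 4 = 2 * d ^- 4 * N ^- 4 by ring.
rewrite -[leRHS]mulrA; apply: ler_wpM2l.
  by apply: mulr_ge0 => //; rewrite invr_ge0 exprn_ge0 // ltW.
have [m1 k1] : 1 <= m.+1%:R :> R /\ 1 <= k.+1%:R :> R by rewrite !ler1n.
rewrite -invfM; apply: lef_inv; first by apply: mulr_gt0; apply: exprn_gt0.
rewrite -exprMn -[4%N]/(2 * 2)%N exprM.
have p0 : 0 <= m.+1%:R * k.+1%:R :> R by exact: mulr_ge0.
have p1 : m.+1%:R * k.+1%:R <= N ^+ 2 by rewrite /N; nra.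
by rewrite lerXn2r // nnegrE exprn_ge0 //; lra.
Qed.

Lemma bounded_inv_sqr_tail (K : R) : 0 <= K -> bounded_sums (fun n => K * n.+1%:R ^- 2).
Proof. by move=> K0; exact: bounded_sumsZ K0 (bounded_inv_sqr R). Qed.

(** For fixed x the sum over m is the cotangent series at z = -x/t without its central term. As x
    grows, im z tends to infinity and [kappa z] to 1/2, which leaves pi i / t. *)
Lemma VV_limit : cvC \oo (fun k => VV (hk k)) (twopii R / (2 * t)).
Proof.
have tn0 : t != 0 by apply: contraTneq t0 => ->; rewrite ltxx.
pose z k : C := - (hk k)%:C / t.
have hk0 k : 0 < hk k by rewrite /hk ltr_wpDl // invr_gt0.
have imz k : im (z k) = hk k * (im t / normc t ^+ 2).
  rewrite /z; case: (t) tn0 => a b tn0 /=.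
  rewrite (_ : Num.ExtraDef.sqrtr _ ^+ 2 = a ^+ 2 + b ^+ 2); last first.
    by rewrite sqr_sqrtr // addr_ge0 ?sqr_ge0.
  by rewrite oppr0 mul0r addr0 mulrN mulNr opprK.
have c0 : 0 < im t / normc t ^+ 2 by rewrite divr_gt0 ?exprn_gt0 ?normc_gt0.
have z0 k : 0 < im (z k) by rewrite imz mulr_gt0.
have E k : VV (hk k) = t^-1 * (twopii R * kappa (z k) + inv (z k)).
  have [K K0 HK] := inv_dominated (z0 k).
  have := lipschitz_kappa (z0 k); rewrite /symsum => H.
  have -> : twopii R * kappa (z k) + inv (z k) = - csum (fun n => inv (z k + n.+1%:R) + inv (z k - n.+1%:R)).
    by rewrite -[twopii R * _]opprK -mulNr -H; ring.
  rewrite -mulN1r mulrA mulrN1.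
  rewrite -(csumZ _ HK (bounded_sumsZ K0 (bounded_inv_sqr_shift R))).
  apply: eq_csum => m; rewrite /vv /inv /z.
  have -> : m.+1%:R * t + (hk k)%:C = - (- (hk k)%:C / t - m.+1%:R) * t by field.
  have -> : m.+1%:R * t - (hk k)%:C = (- (hk k)%:C / t + m.+1%:R) * t by field.
  by rewrite !invfM invrN; ring.
have hkinf (A : R) : \forall k \near \oo, A < hk k.
  have [N HN] : exists N : nat, A < N%:R.
    exists (Num.truncn A).+1; exact: truncnS_gt.
  exists N => // k /= Nk; apply: lt_le_trans HN _.
  apply: (@le_trans _ _ k%:R); first by rewrite ler_nat.
  by rewrite /hk lerDl invr_ge0.
have c1 : cvC \oo (fun k => ee (z k)) 0.
  apply/cvgCP => e e0.
  have := hkinf ((2 * pi * (im t / normc t ^+ 2))^-1 * e^-1).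
  apply: filterS => k; rewrite sub0r normcN normc_ee imz expRN => h.
  have p0 : 0 < 2 * pi * (im t / normc t ^+ 2) by apply: mulr_gt0 => //; rewrite mulr_gt0 ?pi_gt0.
  rewrite ltr_pdivrMl // in h.
  have h2 : e^-1 < expR (2 * pi * (im t / normc t ^+ 2) * hk k).
    by apply: lt_le_trans h _; apply: le_trans (expR_ge1Dx _); rewrite lerDr.
  rewrite invf_plt ?posrE ?expR_gt0 // (mulrC (hk k)) mulrA //.
have c2 : cvC \oo (fun k => inv (z k)) 0.
  apply/cvgCP => e e0; have := hkinf (normc t / e); apply: filterS => k h.
  rewrite sub0r normcN /inv /z normcV normcM normcN normc_real normcV gtr0_norm //.
  by rewrite invfM invrK mulrC ltr_pdivrMr // mulrC -ltr_pdivrMr.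
have c3 : cvC \oo (fun k => kappa (z k)) 2^-1.
  have one : (1 - 0 : C) != 0 by rewrite subr0 oner_eq0.
  pose proof (cvgCB (cvgCV one (cvgCB (cvgC_cst 1) c1)) (cvgC_cst 2^-1)) as H.
  have -> : (2^-1 : C) = (1 - 0)^-1 - 2^-1 by field.
  exact: H.
pose proof (cvgCM (cvgC_cst t^-1) (cvgCD (cvgCM (cvgC_cst (twopii R)) c3) c2)) as H.
have -> : twopii R / (2 * t) = t^-1 * (twopii R * 2^-1 + 0) by field.
by apply: cvC_near H; exists 0%N => // k _; rewrite E.
Qed.

(* The double series is not absolutely convergent. Subtracting the telescoping terms [bb]
   makes it so, and the anomaly [- pi i / t] is the sum over [m] of the boundary terms. *)
Lemma eisenstein_exchange :
  csum (fun k => csum (fun m => ss m k)) - csum (fun m => csum (ss m)) = - twopii R / (2 * t).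
Proof.
have [K K0 HK] := rr_bound.
pose rr m k : C := ss m k - bb m k.
have Am m : 0 <= K * m.+1%:R ^- 2 by rewrite mulr_ge0 // invr_ge0 exprn_ge0.
have Bk k : 0 <= (k.+1%:R : R) ^- 2 by rewrite invr_ge0 exprn_ge0.
have bA := bounded_inv_sqr_tail K0; have bB := bounded_inv_sqr R.
have fub := csum_fubini HK Am Bk bA bB; rewrite -/rr in fub.
have rk m : dominated_by (rr m) (fun k => K * m.+1%:R ^- 2 * k.+1%:R ^- 2) by exact: HK.
have rm k : dominated_by (fun m => rr m k) (fun m => k.+1%:R ^- 2 * (K * m.+1%:R ^- 2)).
  by move=> m; rewrite mulrC; exact: HK.
have srk m : cvC \oo (psum (rr m)) (csum (rr m)) := psum_cvg (rk m) (bounded_sumsZ (Am m) bB).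
have srm k : cvC \oo (psum (fun m => rr m k)) (csum (fun m => rr m k)) := psum_cvg (rm k) (bounded_sumsZ (Bk k) bA).
have hk0 k : 0 <= hk k by rewrite /hk addr_ge0.
have vcvg k : cvC \oo (psum (fun m => vv m (hk k))) (VV (hk k)).
  have [K' K'0 H'] := vv_dominated (hk0 k).
  exact: psum_cvg H' (bounded_inv_sqr_tail K'0).
(* In a row the [bb m k] telescope completely, because [vv m x] tends to 0. *)
have R1 m : csum (ss m) = csum (rr m) + vv m (hk 0).
  apply: psum_lim_csum.
  have vb : cvC \oo (psum (bb m)) (vv m (hk 0)).
    have -> : vv m (hk 0) = vv m (hk 0) - 0 by rewrite subr0.
    apply: cvC_near (cvgCB (cvgC_cst _) (vv_cvg0 m)); exists 0%N => // n _.
    by elim: n => [|n IH]; rewrite ?psumS -?IH /psum ?big_ord0 ?subrr // /bb addrA subrK.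
  apply: cvC_near (cvgCD (srk m) vb); exists 0%N => // n _.
  by rewrite -psumD; apply: eq_bigr => k _; rewrite /rr subrK.
have R2 k : csum (fun m => ss m k) = csum (fun m => rr m k) + (VV (hk k) - VV (hk k.+1)).
  apply: psum_lim_csum.
  apply: cvC_near (cvgCD (srm k) (cvgCB (vcvg k) (vcvg k.+1))); exists 0%N => // n _.
  by rewrite /psum -sumrB -big_split; apply: eq_bigr => m _; rewrite /rr /bb /=; ring.
have S1 : cvC \oo (psum (fun m => csum (rr m))) (csum (fun m => csum (rr m))).
  have [B HB] := bB; have B0 : 0 <= B by apply: le_trans (HB 0%N); rewrite big_ord0.
  apply: (@psum_cvg _ _ (fun m => B * (K * m.+1%:R ^- 2))); last exact: bounded_sumsZ.
  move=> m; apply: csum_le (rk m) _ => n; rewrite -mulr_sumr mulrC.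
  by apply: ler_wpM2r; [exact: Am|exact: HB].
have S2 : cvC \oo (psum (fun k => csum (fun m => rr m k))) (csum (fun k => csum (fun m => rr m k))).
  have [B HB] := bA; have B0 : 0 <= B by apply: le_trans (HB 0%N); rewrite big_ord0.
  apply: (@psum_cvg _ _ (fun k => B * k.+1%:R ^- 2)); last exact: bounded_sumsZ.
  move=> k; apply: csum_le (rm k) _ => n; rewrite -mulr_sumr mulrC.
  by apply: ler_wpM2r; [exact: Bk|exact: HB].
have T1 : csum (fun m => csum (ss m)) = csum (fun m => csum (rr m)) + VV (hk 0).
  apply: psum_lim_csum; apply: cvC_near (cvgCD S1 (vcvg 0%N)); exists 0%N => // n _.
  by rewrite -psumD; apply: eq_bigr => m _; rewrite R1.
(* The column sums also telescope, but now down to the nonzero limit of [VV]: this is the whole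
   difference from [T1]. *)
have T2 : csum (fun k => csum (fun m => ss m k)) =
    csum (fun k => csum (fun m => rr m k)) + (VV (hk 0) - twopii R / (2 * t)).
  apply: psum_lim_csum.
  apply: cvC_near (cvgCD S2 (cvgCB (cvgC_cst (VV (hk 0))) VV_limit)); exists 0%N => // n _.
  elim: n => [|n IH]; first by rewrite /psum !big_ord0 subrr addr0.
  by rewrite !psumS -IH R2; ring.
by rewrite T1 T2 fub; ring.
Qed.

End EisensteinSummation.

Section EtaTransformation.
Variable R : realType.
Local Notation C := (Cplx R).
Implicit Types t z : C.

Lemma upper_neq0 t : 0 < im t -> t != 0.
Proof. by apply: contraTneq => ->; rewrite ltxx. Qed.

Lemma imV t : im (- t^-1) = im t / normc t ^+ 2.
Proof.
case: t => a b /=; rewrite (_ : Num.ExtraDef.sqrtr _ ^+ 2 = a ^+ 2 + b ^+ 2).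
  by rewrite opprK.
by rewrite sqr_sqrtr // addr_ge0 ?sqr_ge0.
Qed.

Lemma upper_inv t : 0 < im t -> 0 < im (- t^-1).
Proof. by move=> t0; rewrite imV divr_gt0 ?exprn_gt0 ?normc_gt0 ?upper_neq0. Qed.

Lemma im_natM n z : im (n%:R * z) = n%:R * im z.
Proof. by rewrite imM re_nat im_nat mul0r addr0. Qed.

Lemma upper_natM n t : 0 < im t -> 0 < im (n.+1%:R * t).
Proof. by move=> t0; rewrite im_natM mulr_gt0. Qed.

Lemma phi_dominated t : 0 < im t -> exists2 M, dominated_by (fun c => phi (c.+1%:R * t)) M & bounded_sums M.
Proof.
move=> t0; have q1 := normc_ee_lt1 t0.
have q0 : 0 < normc (ee t) by rewrite normc_gt0 ee_neq0.
have p0 : 0 < (1 - normc (ee t)) ^+ 2 by rewrite exprn_gt0 // subr_gt0.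
exists (fun c => ((1 - normc (ee t)) ^+ 2)^-1 * normc (ee t) ^+ c).
  move=> c; rewrite /phi eeMn normcM normcV (normcX (1 - _)) mulrC; apply: ler_pM.
  - by rewrite invr_ge0 exprn_ge0 ?normc_ge0.
  - exact: normc_ge0.
  - apply: lef_inv => //; rewrite lerXn2r ?nnegrE ?normc_ge0 ?subr_ge0 //; first exact: ltW.
    exact: one_minus_pow_ge.
  - by rewrite normcX exprS ler_piMl ?exprn_ge0 ?ltW.
apply: bounded_sumsZ; first by rewrite invr_ge0 ltW.
by apply: bounded_geometric; rewrite q1 ltW.
Qed.

(** Each row is the Lipschitz formula at a multiple of t without its central term; the central terms
    add up to t^-2 zeta(2). *)
Lemma eisen_rows t : 0 < im t ->
  csum (fun m => csum (fun k => inv_sqr (m.+1%:R * t - k.+1%:R) + inv_sqr (m.+1%:R * t + k.+1%:R)))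
  = twopii R ^+ 2 * eisen t - t ^- 2 * zeta2 R.
Proof.
move=> t0; have [M HM bM] := phi_dominated t0.
have zd := @zeta2_dominated R; have zb := bounded_inv_sqr R.
rewrite /eisen /zeta2 -(csumZ _ HM bM) -(csumZ _ zd zb).
have d1 : dominated_by (fun i => twopii R ^+ 2 * phi (i.+1%:R * t)) (fun i => normc (twopii R ^+ 2) * M i).
  by move=> i; rewrite normcM ler_wpM2l ?normc_ge0.
have d2 : dominated_by (fun i => t ^- 2 * (i.+1%:R : C) ^- 2) (fun i => normc (t ^- 2) * i.+1%:R ^- 2).
  by move=> i; rewrite normcM ler_wpM2l ?normc_ge0.
rewrite -(csumB d1 _ d2); try exact: bounded_sumsZ (normc_ge0 _) _.
apply: eq_csum => m; rewrite -(lipschitz_phi (upper_natM m t0)) /symsum.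
have -> : inv_sqr (m.+1%:R * t) = t ^- 2 * m.+1%:R ^- 2.
  by rewrite /inv_sqr exprMn invfM mulrC.
by rewrite addrC addKr; apply: eq_csum => k; rewrite addrC.
Qed.

(** With u = -1/t, t (k u - m) = -(m t + k) and t (k u + m) = m t - k: up to the factor t^-2, the
    columns for t are the rows for u. *)
Lemma eisen_columns t : 0 < im t ->
  csum (fun k => csum (fun m => inv_sqr (m.+1%:R * t - k.+1%:R) + inv_sqr (m.+1%:R * t + k.+1%:R)))
  = t ^- 2 * (twopii R ^+ 2 * eisen (- t^-1)) - zeta2 R.
Proof.
move=> t0; have u0 := upper_inv t0; have tn0 := upper_neq0 t0.
rewrite (_ : _ - zeta2 R = t ^- 2 * (twopii R ^+ 2 * eisen (- t^-1) - (- t^-1) ^- 2 * zeta2 R)); last first.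
  have -> : (- t^-1) ^- 2 = t ^+ 2 by rewrite sqrrN exprVn invrK.
  by rewrite mulrBr; congr (_ - _); rewrite mulrA mulVf ?mul1r // expf_neq0.
rewrite -eisen_rows //; set u := - t^-1.
have [M HM bM] : exists2 M, dominated_by (fun k => csum (fun m => inv_sqr (k.+1%:R * u - m.+1%:R) + inv_sqr (k.+1%:R * u + m.+1%:R))) M & bounded_sums M.
  have [M HM bM] := phi_dominated u0.
  exists (fun i => normc (twopii R ^+ 2) * M i + normc (u ^- 2) * i.+1%:R ^- 2).
    move=> i; rewrite (_ : csum _ = twopii R ^+ 2 * phi (i.+1%:R * u) - u ^- 2 * i.+1%:R ^- 2).
      apply: le_trans (normcB _ _) _; rewrite (normcM (twopii R ^+ 2)) (normcM (u ^- 2)).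
      apply: lerD; (apply: ler_wpM2l; first exact: normc_ge0); first exact: HM.
      exact: zeta2_dominated.
    rewrite -(lipschitz_phi (upper_natM i u0)) /symsum /inv_sqr exprMn invfM (mulrC (i.+1%:R ^- 2)).
    by rewrite addrC addKr; apply: eq_csum => k; rewrite addrC.
  have [B1 H1] := bounded_sumsZ (normc_ge0 (twopii R ^+ 2)) bM.
  have [B2 H2] := bounded_sumsZ (normc_ge0 (u ^- 2)) (bounded_inv_sqr R).
  by exists (B1 + B2) => n; rewrite big_split lerD.
rewrite -(csumZ _ HM bM); apply: eq_csum => k.
have [K K0 HK] := inv_sqr_dominated (upper_natM k u0).
have HK' : dominated_by (fun n => inv_sqr (k.+1%:R * u - n.+1%:R) + inv_sqr (k.+1%:R * u + n.+1%:R)) (fun n => K * n.+2%:R ^- 2).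
  by move=> n; rewrite addrC; exact: HK.
rewrite -(csumZ _ HK' (bounded_sumsZ K0 (bounded_inv_sqr_shift R))).
apply: eq_csum => m; rewrite /inv_sqr mulrDr -!invfM -!exprMn addrC.
have -> : t * (k.+1%:R * u - m.+1%:R) = - (m.+1%:R * t + k.+1%:R) by rewrite /u; field.
have -> : t * (k.+1%:R * u + m.+1%:R) = m.+1%:R * t - k.+1%:R by rewrite /u; field.
by rewrite sqrrN.
Qed.

(** The value of zeta(2) turns the two sums of central terms into the constants 1/24 of E_2 / 24. *)
Lemma eisen_transformation t : 0 < im t ->
  (24^-1 - eisen (- t^-1)) / t ^+ 2 - (24^-1 - eisen t) = (2 * twopii R * t)^-1.
Proof.
move=> t0; have tn0 := upper_neq0 t0; have p0 := twopii_neq0 R.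
have := eisenstein_exchange t0; rewrite /= eisen_rows // eisen_columns // zeta2E => H.
have -> : (24^-1 - eisen (- t^-1)) / t ^+ 2 - (24^-1 - eisen t) =
  - (t ^- 2 * (twopii R ^+ 2 * eisen (- t^-1)) - - twopii R ^+ 2 / 24 -
    (twopii R ^+ 2 * eisen t - t ^- 2 * (- twopii R ^+ 2 / 24))) / twopii R ^+ 2.
  by field; rewrite p0 tn0.
by rewrite H; field; rewrite p0 tn0.
Qed.

Definition eta_ratio t : C := eta (- t^-1) / eta t.

Lemma has_deriv_eta_ratio t : 0 < im t -> has_deriv eta_ratio t (eta_ratio t / (2 * t)).
Proof.
move=> t0; have tn0 := upper_neq0 t0; have u0 := upper_inv t0.
have D1 := has_derivN (has_derivV (has_deriv_id t) tn0).
have D2 := has_deriv_comp D1 (has_deriv_eta u0).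
have D3 := has_derivM D2 (has_derivV (has_deriv_eta t0) (eta_neq0 t0)).
have e0 := eta_neq0 t0; have p0 := twopii_neq0 R.
move: D3; rewrite /eta_ratio; congr has_deriv.
set E := eta (- t^-1); set A := 24^-1 - eisen _; set B := 24^-1 - eisen t.
have -> : B = A / t ^+ 2 - (2 * twopii R * t)^-1.
  by rewrite -(eisen_transformation t0) -/A -/B; ring.
by field; rewrite e0 p0 tn0.
Qed.

Lemma upper_segment z w (x : R) : 0 < im z -> 0 < im w -> 0 <= x <= 1 ->
  0 < im (z + x%:C * (w - z)).
Proof.
move=> z0 w0 /andP[x0 x1]; rewrite imD imM imD imN /= mul0r addr0.
by have [/eqP->|xn] := boolP (x == 0); nra.
Qed.

Lemma upper_const (f : C -> C) : (forall t, 0 < im t -> has_deriv f t 0) ->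
  forall z w, 0 < im z -> 0 < im w -> f z = f w.
Proof.
move=> df z w z0 w0; apply: has_deriv0_const => x x01; apply: df.
exact: upper_segment.
Qed.

Lemma eta_ratio_neq0 t : 0 < im t -> eta_ratio t != 0.
Proof. by move=> t0; rewrite mulf_neq0 ?invr_neq0 ?eta_neq0 ?upper_inv. Qed.

Lemma eta_ratioV t : 0 < im t -> eta_ratio (- t^-1) = (eta_ratio t)^-1.
Proof.
move=> t0; rewrite /eta_ratio invrN invrK opprK invf_div.
by [].
Qed.

Let I : C := 'i%C.

Lemma I_neq0 : I != 0.
Proof. by rewrite eq_complex /= oner_eq0 andbF. Qed.

Lemma I_sqr : I * I = -1.
Proof. by rewrite -expr2 sqr_i. Qed.

Lemma I_inv : I^-1 = - I.
Proof. by apply: (mulfI I_neq0); rewrite mulfV ?I_neq0 // mulrN I_sqr opprK. Qed.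

(** r^2 / t has zero derivative, and r = 1 at the point i, which is fixed by t -> -1/t. *)
Lemma eta_ratio_sqr t : 0 < im t -> eta_ratio t ^+ 2 = - I * t.
Proof.
move=> t0; have tn0 := upper_neq0 t0.
have i0 : 0 < im I by rewrite /= ltr01.
have cst z : 0 < im z -> has_deriv (fun w => eta_ratio w ^+ 2 * w^-1) z 0.
  move=> z0; have zn0 := upper_neq0 z0.
  have := has_derivM (has_derivX 2 (has_deriv_eta_ratio z0)) (has_derivV (has_deriv_id z) zn0).
  by congr has_deriv; rewrite expr1; field.
have := upper_const cst t0 i0; rewrite /eta_ratio.
have -> : - I^-1 = I by rewrite I_inv opprK.
rewrite mulfV ?eta_neq0 // expr1n mul1r => /(canRL (mulfVK tn0)) ->.
by rewrite I_inv.
Qed.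

(* Both sides have the same logarithmic derivative, and they agree at [I * sqrt a]. *)
Lemma eta_ratio_scale t (a : R) : 0 < im t -> 0 < a ->
  eta_ratio t = (Num.sqrt a)%:C * eta_ratio (t / a%:C).
Proof.
move=> t0 a0; have tn0 := upper_neq0 t0.
have ac0 : a%:C != 0 :> C by rewrite fmorph_eq0 gt_eqF.
have sc z : 0 < im z -> 0 < im (z / a%:C).
  move=> z0; rewrite -fmorphV imM /= mulr0 add0r mulr_gt0 ?invr_gt0 //.
have cst z : 0 < im z -> has_deriv (fun w => eta_ratio w * (eta_ratio (w / a%:C))^-1) z 0.
  move=> z0; have zn0 := upper_neq0 z0; have s0 := sc z z0.
  have D0 : has_deriv (fun w => w / a%:C) z (a%:C)^-1.
    have := has_derivZ (a%:C)^-1 (has_deriv_id z); rewrite mulr1; apply: has_deriv_near.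
    by apply: nearC_all => w; rewrite mulrC.
  have D1 := has_derivV (has_deriv_comp D0 (has_deriv_eta_ratio s0)) (eta_ratio_neq0 s0).
  have := has_derivM (has_deriv_eta_ratio z0) D1; congr has_deriv.
  by have h := eta_ratio_neq0 s0; field; rewrite ac0 zn0 h.
pose s : R := Num.sqrt a.
have s0 : 0 < s by rewrite sqrtr_gt0.
have sa : s ^+ 2 = a by rewrite sqr_sqrtr // ltW.
pose z : C := I * s%:C.
have z0 : 0 < im z by rewrite /z imM /= mul0r add0r mul1r.
have sc0 : s%:C != 0 :> C by rewrite fmorph_eq0 gt_eqF.
have h0 := eta_ratio_neq0 (sc t t0).
have zE : z / a%:C = - z^-1.
  have aE : a%:C = s%:C ^+ 2 :> C by rewrite -rmorphXn sa.
  by rewrite /z aE (invfM I) I_inv; field.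
have := upper_const cst t0 z0; rewrite zE eta_ratioV // invrK -expr2 eta_ratio_sqr // => E.
rewrite -[LHS](mulfVK h0) E /z; congr (_ * _).
by rewrite mulrA mulNr I_sqr opprK mul1r.
Qed.

Lemma eta_S t : 0 < im t -> eta (- t^-1) = eta_ratio t * eta t.
Proof. by move=> t0; rewrite /eta_ratio mulfVK ?eta_neq0. Qed.

End EtaTransformation.

(** * Generators and cosets of Gamma_1(N) *)

Section Matrices2.
Implicit Types (a b c d : int) (M A B : 'M[int]_2).

Definition mk2 a b c d : 'M[int]_2 :=
  \matrix_(i, j) if i == 0 then (if j == 0 then a else b) else (if j == 0 then c else d).

Lemma mk2E a b c d : [/\ mk2 a b c d 0 0 = a, mk2 a b c d 0 1 = b,
  mk2 a b c d 1 0 = c & mk2 a b c d 1 1 = d].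
Proof. by rewrite !mxE. Qed.

Lemma mk2P M : M = mk2 (M 0 0) (M 0 1) (M 1 0) (M 1 1).
Proof.
apply/matrixP => i j; rewrite mxE.
by case: i => [[|[|//]] hi]; case: j => [[|[|//]] hj] /=; congr (M _ _); apply: val_inj.
Qed.

Lemma mk2_inj a b c d a' b' c' d' : mk2 a b c d = mk2 a' b' c' d' ->
  [/\ a = a', b = b', c = c' & d = d'].
Proof.
move=> /matrixP E; have := E 0 0; have := E 0 1; have := E 1 0; have := E 1 1.
by rewrite !mxE /=.
Qed.

Lemma mk2_mul a b c d a' b' c' d' : mk2 a b c d * mk2 a' b' c' d' =
  mk2 (a * a' + b * c') (a * b' + b * d') (c * a' + d * c') (c * b' + d * d').
Proof.
apply/matrixP => i j; rewrite mxE !big_ord_recr big_ord0 /= !mxE add0r.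
by case: i => [[|[|//]] hi]; case: j => [[|[|//]] hj].
Qed.

Lemma mk2_1 : mk2 1 0 0 1 = 1.
Proof. by rewrite [RHS]mk2P !mxE. Qed.

Lemma mk2_N a b c d : - mk2 a b c d = mk2 (- a) (- b) (- c) (- d).
Proof. by rewrite [LHS]mk2P !mxE. Qed.

Lemma det_mk2 a b c d : \det (mk2 a b c d) = a * d - b * c.
Proof.
rewrite (expand_det_row _ 0) !big_ord_recr big_ord0 /= add0r /cofactor !det_mx11 !mxE /=.
by rewrite expr0 mul1r expr1 mulN1r mulrN.
Qed.

Lemma matT_mk2 : matT = mk2 1 1 0 1.
Proof. by rewrite [LHS]mk2P !mxE. Qed.

Lemma matS_mk2 : matS = mk2 0 (-1) 1 0.
Proof. by rewrite [LHS]mk2P !mxE. Qed.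

Lemma SL2Z_mk2 a b c d : SL2Z (mk2 a b c d) <-> a * d - b * c = 1.
Proof. by rewrite /SL2Z /= det_mk2. Qed.

Lemma SL2ZM A B : SL2Z A -> SL2Z B -> SL2Z (A * B).
Proof. by rewrite /SL2Z /= det_mulmx => -> ->; rewrite mulr1. Qed.

Lemma SL2Z_unit A : SL2Z A -> A \in unitmx.
Proof. by rewrite /SL2Z /= unitmxE => ->; rewrite unitr1. Qed.

Lemma SL2ZV A : SL2Z A -> SL2Z (invmx A).
Proof. by rewrite /SL2Z /= det_inv => ->; rewrite invr1. Qed.

Lemma invmx_mk2 a b c d : a * d - b * c = 1 -> invmx (mk2 a b c d) = mk2 d (- b) (- c) a.
Proof.
move=> h; have u : mk2 a b c d \in unitmx by apply: SL2Z_unit; apply/SL2Z_mk2.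
apply: (can_inj (mulKmx u)); rewrite mulmxV //.
change (1 = mk2 a b c d * mk2 d (- b) (- c) a).
by rewrite mk2_mul -mk2_1; congr mk2; lia.
Qed.

Lemma mulKSL A B : SL2Z A -> invmx A * (A * B) = B.
Proof. by move=> /SL2Z_unit u; exact: mulKmx. Qed.

Lemma mulKVSL A B : SL2Z A -> B * A * invmx A = B.
Proof. by move=> /SL2Z_unit u; exact: mulmxK. Qed.

Lemma mulVSL A : SL2Z A -> invmx A * A = 1.
Proof. by move=> /SL2Z_unit u; exact: mulVmx. Qed.

Lemma mulSLV A : SL2Z A -> A * invmx A = 1.
Proof. by move=> /SL2Z_unit u; exact: mulmxV. Qed.

Lemma invmxMSL A B : SL2Z A -> SL2Z B -> invmx (A * B) = invmx B * invmx A.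
Proof.
move=> hA hB; have hAB := SL2ZM hA hB.
by rewrite -[RHS]mulr1 -(mulSLV hAB) mulrA -(mulrA _ (invmx A)) (mulKSL _ hA) mulVSL // mul1r.
Qed.

Lemma Gamma1_mk2 N a b c d : Gamma1 N (mk2 a b c d) <->
  [/\ a * d - b * c = 1, (a = 1 %[mod N])%Z, (d = 1 %[mod N])%Z & (c = 0 %[mod N])%Z].
Proof.
have [e1 _ e3 e4] := mk2E a b c d; rewrite /Gamma1 /= e1 e3 e4.
by split=> -[h1 h2 h3 h4]; split => //; apply/SL2Z_mk2.
Qed.

Lemma Gamma1_SL2Z N A : Gamma1 N A -> SL2Z A.
Proof. by case. Qed.

Lemma modzE (N : nat) a b : (a = b %[mod N])%Z <-> exists k : int, a = b + k * N.
Proof.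
split=> [/eqP|[k ->]]; last by rewrite addrC modzMDl.
rewrite eqz_mod_dvd => /dvdzP[k hk]; exists k; lia.
Qed.

Lemma Gamma1M N A B : Gamma1 N A -> Gamma1 N B -> Gamma1 N (A * B).
Proof.
move=> hA hB; have hS := SL2ZM (Gamma1_SL2Z hA) (Gamma1_SL2Z hB); move: hA hB hS.
rewrite (mk2P A) (mk2P B) mk2_mul.
move: (A 0 0) (A 0 1) (A 1 0) (A 1 1) (B 0 0) (B 0 1) (B 1 0) (B 1 1) => a b c d a' b' c' d'.
move=> /Gamma1_mk2[_ /modzE[x xE] /modzE[y yE] /modzE[z zE]].
move=> /Gamma1_mk2[_ /modzE[x' xE'] /modzE[y' yE'] /modzE[z' zE']] /SL2Z_mk2 hS.
apply/Gamma1_mk2; split => //; apply/modzE.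
- by exists (x + x' + x * x' * N + b * z'); rewrite xE xE' zE'; ring.
- by exists (y + y' + y * y' * N + z * b'); rewrite yE yE' zE; ring.
- by exists (z * a' + d * z'); rewrite zE zE'; ring.
Qed.

Lemma Gamma1V N A : Gamma1 N A -> Gamma1 N (invmx A).
Proof.
rewrite (mk2P A); move: (A 0 0) (A 0 1) (A 1 0) (A 1 1) => a b c d.
move=> /Gamma1_mk2[h /modzE[x xE] /modzE[y yE] /modzE[z zE]].
rewrite invmx_mk2 //; apply/Gamma1_mk2; split; first by lia.
- by apply/modzE; exists y.
- by apply/modzE; exists x.
- by apply/modzE; exists (- z); rewrite zE; ring.
Qed.

(** [Gamma1 N] is the stabilizer of the row (0, 1) modulo N, so its right cosets are told apart by
    bottom rows modulo N. *)
Lemma Gamma1_div (N : nat) A B : SL2Z A -> SL2Z B ->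
  ((A 1 0)%R = (B 1 0)%R %[mod N])%Z -> ((A 1 1)%R = (B 1 1)%R %[mod N])%Z ->
  Gamma1 N (A * invmx B).
Proof.
rewrite (mk2P A) (mk2P B).
move: (A 0 0) (A 0 1) (A 1 0) (A 1 1) (B 0 0) (B 0 1) (B 1 0) (B 1 1) => a b c d a' b' c' d'.
move=> /SL2Z_mk2 hA /SL2Z_mk2 hB; have [_ _ -> ->] := mk2E a b c d; have [_ _ -> ->] := mk2E a' b' c' d'.
move=> /modzE[x xE] /modzE[y yE]; rewrite invmx_mk2 // mk2_mul.
apply/Gamma1_mk2; split; first by nia.
- apply/modzE; exists (b * x - a * y); rewrite -hA.
  have -> : c' = c - x * N by rewrite xE addrK.
  have -> : d' = d - y * N by rewrite yE addrK.
  by ring.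
- by apply/modzE; exists (a' * y - b' * x); rewrite -hB xE yE; ring.
- by apply/modzE; exists (x * d' - y * c'); rewrite xE yE; ring.
Qed.

Lemma near_mod (d c : int) : c != 0 -> exists j : int, 2 * `|d + j * c| <= `|c|.
Proof.
move=> c0; have e := divz_eq d c; have m0 := modz_ge0 d c0; have m1 := ltz_mod d c0.
have eq1 : d + - (d %/ c)%Z * c = (d %% c)%Z by lia.
have [h|h] := leP (2 * (d %% c)%Z) `|c|.
  by exists (- (d %/ c)%Z); lia.
have [cp|cn] := ltP 0 c; [exists (- (d %/ c)%Z - 1)|exists (- (d %/ c)%Z + 1)].
  by rewrite (_ : d + _ * c = (d %% c)%Z - c); lia.
by rewrite (_ : d + _ * c = (d %% c)%Z + c); lia.
Qed.

(* Euclid's algorithm on the bottom row, where the steps on [c] are multiples of [N d]: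
   it terminates because [|d| <= |c|/2] and [|c| <= N|d|/2] with [N <= 3]. *)
Lemma Gamma1_ind (N : nat) (P : 'M[int]_2 -> Prop) : (1 < N <= 3)%N -> P 1 ->
  (forall A, Gamma1 N A -> P (A * mk2 1 1 0 1) <-> P A) ->
  (forall A, Gamma1 N A -> P (A * mk2 1 0 N 1) <-> P A) ->
  forall A, Gamma1 N A -> P A.
Proof.
move=> N13 P1 PT PU.
have g1 : Gamma1 N 1 by rewrite -mk2_1; apply/Gamma1_mk2.
have GT : Gamma1 N (mk2 1 1 0 1) by apply/Gamma1_mk2.
have GU : Gamma1 N (mk2 1 0 N 1) by apply/Gamma1_mk2; split => //; apply/modzE; exists 1; lia.
have step (U : int -> 'M[int]_2) : (forall j k, U (j + k) = U j * U k) -> U 0 = 1 ->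
    (forall j, Gamma1 N (U j)) ->
    (forall A, Gamma1 N A -> P (A * U 1) <-> P A) ->
    forall j A, Gamma1 N A -> P (A * U j) <-> P A.
  move=> UD U0 GUj U1.
  have pos (n : nat) A : Gamma1 N A -> P (A * U n) <-> P A.
    elim: n => [|n IH] hA; first by rewrite U0 mulr1.
    rewrite (_ : U n.+1 = U n * U 1); last by rewrite -UD; congr U; lia.
    by rewrite mulrA U1 ?IH //; apply: Gamma1M.
  move=> j A hA; have [n [->|->]] : exists n : nat, j = n \/ j = - n%:Z by exists `|j|%N; lia.
    exact: pos.
  rewrite -(pos n (A * _)); last exact: Gamma1M.
  by rewrite -mulrA -UD addNr U0 mulr1.
have TD j k : mk2 1 (j + k) 0 1 = mk2 1 j 0 1 * mk2 1 k 0 1.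
  by rewrite mk2_mul; congr mk2; lia.
have GTj j : Gamma1 N (mk2 1 j 0 1) by apply/Gamma1_mk2; split => //; lia.
have PTj := @step (fun j => mk2 1 j 0 1) TD mk2_1 GTj PT.
have UD (j k : int) : mk2 1 0 (N%:Z * (j + k)) 1 = mk2 1 0 (N%:Z * j) 1 * mk2 1 0 (N%:Z * k) 1.
  by rewrite mk2_mul; congr mk2; lia.
have GUj (j : int) : Gamma1 N (mk2 1 0 (N%:Z * j) 1).
  by apply/Gamma1_mk2; split => //; [lia|apply/modzE; exists j; lia].
have U0 : mk2 1 0 (N%:Z * 0) 1 = 1 by rewrite mulr0 mk2_1.
have PU' A : Gamma1 N A -> P (A * mk2 1 0 (N%:Z * 1) 1) <-> P A by rewrite mulr1; exact: PU.
have PUj := @step (fun j => mk2 1 0 (N%:Z * j) 1) UD U0 GUj PU'.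
move=> A; have [k] := ubnP (absz (A 1 0)); elim: k A => // k IH A.
rewrite (mk2P A); move: (A 0 0) (A 0 1) (A 1 0) (A 1 1) => a b c d.
have [_ _ -> _] := mk2E a b c d; rewrite ltnS => ck hA.
have /Gamma1_mk2[dt /modzE[x xE] /modzE[y yE] /modzE[z zE]] := hA.
have [c0|c0] := eqVneq c 0.
  rewrite c0 mulr0 subr0 in dt.
  have /eqP := congr1 absz dt; rewrite abszM muln_eq1 => /andP[/eqP a1 /eqP d1].
  have [[-> ->]|[{}a1 {}d1]] : (a = 1 /\ d = 1) \/ (a = -1 /\ d = -1) by nia.
    by rewrite c0 -[mk2 _ _ _ _]mul1r PTj.
  (* The diagonal entries are -1, congruent to 1 modulo N only for N = 2. There the matrix is
     written as the word U T^-1 U T^(-1-b). *)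
  have N2 : N = 2%N.
    have [//|N3] : N = 2%N \/ N = 3%N by lia.
    by move: xE; rewrite a1 N3; lia.
  have -> : mk2 a b c d = 1 * mk2 1 0 (N%:Z * 1) 1 * mk2 1 (-1) 0 1 * mk2 1 0 (N%:Z * 1) 1 * mk2 1 (-1 - b) 0 1.
    by rewrite -mk2_1 !mk2_mul N2 a1 c0 d1; congr mk2; lia.
  have g2 := Gamma1M g1 (GUj 1); have g3 := Gamma1M g2 (GTj (-1)).
  have g4 := Gamma1M g3 (GUj 1).
  by rewrite PTj // PUj // PTj // PUj.
have [j hj] := near_mod d c0.
set d' := d + j * c in hj.
(* Otherwise N, which divides c, would divide the determinant. *)
have d'0 : d' != 0.
  apply/eqP => d'0; have dE : d = - (j * c) by rewrite /d' in d'0; lia.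
  have h : N%:Z * (z * (- a * j - b)) = 1 by rewrite -dt dE zE; ring.
  have /eqP := congr1 absz h; rewrite abszM muln_eq1 => /andP[/eqP N1 _].
  by move: N13 N1; rewrite absz_nat => N13 N1; rewrite N1 in N13.
have Nd0 : N%:Z * d' != 0 by rewrite mulf_neq0 //; lia.
have [l hl] := near_mod c Nd0.
have g2 := Gamma1M hA (GTj j); have g3 := Gamma1M g2 (GUj l).
rewrite -(PTj j _ hA) -(PUj l _ g2); apply: IH => //.
have -> : (mk2 a b c d * mk2 1 j 0 1 * mk2 1 0 (N%:Z * l) 1) 1 0 = c + l * (N%:Z * d').
  by rewrite !mk2_mul [LHS]mxE /= /d'; ring.
have h3 : `|N%:Z * d'| <= 3 * `|d'|.
  by rewrite normrM ler_wpM2r // ger0_norm // lez_nat; case/andP: N13.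
by lia.
Qed.

End Matrices2.

(** * Moebius action and slash operator *)

Section SlashOperator.
Variable R : realType.
Local Notation C := (Cplx R).
Implicit Types (t : C) (A B M : 'M[int]_2) (f : C -> C) (k : int).

Lemma intC (n : int) : (n%:~R : C) = (n%:~R : R)%:C.
Proof. by rewrite rmorph_int. Qed.

Lemma im_intM (n : int) t : im (n%:~R * t) = n%:~R * im t.
Proof. by rewrite intC imM /= mul0r addr0. Qed.

Lemma im_int (n : int) : im (n%:~R : C) = 0.
Proof. by rewrite intC. Qed.

Lemma autj_neq0 M t : SL2Z M -> 0 < im t -> autj M t != 0.
Proof.
rewrite (mk2P M); move: (M 0 0) (M 0 1) (M 1 0) (M 1 1) => a b c d /SL2Z_mk2 h t0.
rewrite /autj; have [_ _ -> ->] := mk2E a b c d.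
have [c0|c0] := eqVneq c 0.
  rewrite c0 mul0r add0r intr_eq0; apply: contra_eq_neq h => ->.
  by rewrite c0 !mulr0 subr0.
apply/eqP => /(congr1 (@complex.Im R)); rewrite imD im_intM im_int addr0 /= => /eqP.
by rewrite mulf_eq0 intr_eq0 (negPf c0) gt_eqF.
Qed.

Lemma im_mobius M t : SL2Z M -> 0 < im t -> im (mobius M t) = im t / normc (autj M t) ^+ 2.
Proof.
rewrite (mk2P M); move: (M 0 0) (M 0 1) (M 1 0) (M 1 1) => a b c d hM t0.
have j0 := autj_neq0 hM t0; move/SL2Z_mk2: hM => h.
rewrite /mobius normcE; move: j0; rewrite /autj.
have [-> -> -> ->] := mk2E a b c d; rewrite !intC.
have hR : a%:~R * d%:~R - b%:~R * c%:~R = 1 :> R by rewrite -!intrM -intrB h.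
case: t t0 => x y /= y0; rewrite -normc_eq0 -sqrf_eq0 normcE /=.
rewrite !mul0r !subr0 !addr0.
set u := _ ^+ 2 + _ ^+ 2 => u0.
have -> : y / u = (a%:~R * d%:~R - b%:~R * c%:~R) * y / u by rewrite hR mul1r.
by field.
Qed.

Lemma upper_mobius M t : SL2Z M -> 0 < im t -> 0 < im (mobius M t).
Proof.
by move=> hM t0; rewrite im_mobius // divr_gt0 // exprn_gt0 // normc_gt0 autj_neq0.
Qed.

Lemma autjM A B t : SL2Z B -> 0 < im t -> autj (A * B) t = autj A (mobius B t) * autj B t.
Proof.
move=> hB t0; have j0 := autj_neq0 hB t0; move: j0; rewrite /mobius {hB}.
rewrite (mk2P A) (mk2P B) mk2_mul /autj !mxE /= !(intrD, intrM) => j0.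
by field.
Qed.

Lemma mobiusM A B t : SL2Z A -> SL2Z B -> 0 < im t -> mobius (A * B) t = mobius A (mobius B t).
Proof.
move=> hA hB t0; have h := autj_neq0 hA (upper_mobius hB t0); have j0 := autj_neq0 hB t0.
rewrite /mobius (autjM _ hB t0); move: h; rewrite -/(mobius B t); set J := autj A _ => h.
move: j0; rewrite /mobius {hA hB}.
have e i : ((A * B) 0 i)%:~R = (A 0 0)%:~R * (B 0 i)%:~R + (A 0 1)%:~R * (B 1 i)%:~R :> C.
  by rewrite mxE !big_ord_recr big_ord0 /= add0r intrD !intrM;
     congr (_%:~R * _%:~R + _%:~R * _%:~R); congr (_ _ _); apply: val_inj.
rewrite !e => j0; apply: (mulIf (mulf_neq0 h j0)); rewrite divfK ?mulf_neq0 //.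
transitivity ((A 0 0)%:~R * ((B 0 0)%:~R * t + (B 0 1)%:~R) + (A 0 1)%:~R * autj B t).
  by rewrite {j0} /autj; ring.
by move: j0; move: (autj B t) => j j0; field; rewrite h j0.
Qed.

Lemma slashM k f A B t : SL2Z A -> SL2Z B -> 0 < im t ->
  slash k f (A * B) t = slash k (slash k f A) B t.
Proof.
move=> hA hB t0; rewrite /slash autjM // mobiusM //.
by rewrite [autj A _ * _]mulrC expfzMl mulrA.
Qed.

Lemma slash1 k f t : slash k f 1 t = f t.
Proof.
by rewrite /slash /mobius /autj -mk2_1 !mxE /= mul0r add0r exp1rz !mul1r addr0 divr1.
Qed.

Lemma slash_modular k f M t (c : C) : SL2Z M -> 0 < im t ->
  slash k f M t = c * f t <-> f (mobius M t) = c * autj M t ^ k * f t.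
Proof.
move=> hM t0; have j0 := autj_neq0 hM t0; rewrite /slash.
have jk : autj M t ^ k != 0 by rewrite expfz_neq0.
rewrite -invr_expz; split=> [h|->]; last by field.
by rewrite mulrAC -h; field.
Qed.

End SlashOperator.

(** * The lift, its independence of representatives, and its modularity *)

Section Lift.
Variables (R : realType) (n : nat) (L : even_lattice n).
Local Notation C := (Cplx R).
Variable rho : 'M[int]_2 -> {linear group_ring R L -> group_ring R L}.
Hypothesis hrho : weil_representation rho.
Variables (N : nat) (k : int) (f : C -> C) (g : disc L) (ch : 'M[int]_2 -> C).
Hypothesis ch_neq0 : forall A, ch A != 0.
Hypothesis f_slash : forall A, Gamma1 N A -> forall t, 0 < im t -> slash k f A t = ch A * f t.
Hypothesis rho_char : forall A, Gamma1 N A -> rho A (basis_elt R g) = ch A *: basis_elt R g.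
Variable s : set 'M[int]_2 -> 'M[int]_2.
Hypothesis s_section : coset_section N s.

Definition lift_term (t : C) (A : 'M[int]_2) : group_ring R L :=
  slash k f A t *: rho (invmx A) (basis_elt R g).

Definition right_coset (A : 'M[int]_2) : set 'M[int]_2 := [set B *m A | B in Gamma1 N].

(** The slash action on f produces [ch A] and the inverse of A acting on e_gamma produces its
    inverse, so a term depends only on the coset. *)
Lemma lift_term_inv A B t : Gamma1 N A -> SL2Z B -> 0 < im t ->
  lift_term t (A * B) = lift_term t B.
Proof.
move=> hA hB t0; have sA := Gamma1_SL2Z hA.
have [_ rM _ _] := hrho.
have e1 : slash k f (A * B) t = ch A * slash k f B t.
  rewrite (slashM k f sA hB t0) {1}/slash (f_slash hA (upper_mobius hB t0)) /slash.
  by rewrite mulrCA.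
rewrite /lift_term e1 (invmxMSL sA hB) (rM _ _ (SL2ZV hB) (SL2ZV sA)).
have -> : rho (invmx A) (basis_elt R g) = (ch A)^-1 *: basis_elt R g.
  have [r1 _ _ _] := hrho.
  rewrite -[X in rho (invmx A) X](scalerK (ch_neq0 A)) -rho_char // linearZ /=.
  by rewrite -(rM _ _ (SL2ZV sA) sA) (mulVSL sA) r1.
rewrite linearZ /= scalerA mulrAC mulfV ?mul1r //; exact: ch_neq0.
Qed.

Lemma lift_term_section M t : SL2Z M -> 0 < im t ->
  lift_term t (s (right_coset M)) = lift_term t M.
Proof.
move=> hM t0; have hK : Gamma1_cosets N (right_coset M) by exists M.
by have [A hA <-] := s_section hK; rewrite (lift_term_inv hA).
Qed.

Lemma right_cosetP A B : SL2Z A -> SL2Z B ->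
  right_coset A = right_coset B <-> Gamma1 N (A * invmx B).
Proof.
move=> hA hB; split=> [E|h].
  have : right_coset A A.
    exists 1; last exact: mul1mx.
    by rewrite -mk2_1; apply/Gamma1_mk2.
  by rewrite E => -[D hD <-]; change (Gamma1 N (D * B * invmx B)); rewrite mulKVSL.
have iA : invmx B * B = 1 by exact: mulVSL.
apply/seteqP; split=> _ [D hD <-].
  exists (D * (A * invmx B)); first exact: Gamma1M.
  by change (D * (A * invmx B) * B = D * A); rewrite -!mulrA iA mulr1.
exists (D * invmx (A * invmx B)); first by apply: Gamma1M => //; exact: Gamma1V.
change (D * invmx (A * invmx B) * A = D * B).
have AE : A = A * invmx B * B by rewrite -mulrA iA mulr1.
by rewrite {2}AE -(mulrA D) (mulKSL _ (Gamma1_SL2Z h)).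
Qed.

(** A list meeting each right coset exactly once, by which the sum over [Gamma1_cosets] with the
    section [s] becomes a sum over explicit matrices. *)
Definition coset_reps (r : seq 'M[int]_2) : Prop :=
  [/\ uniq r, (forall A, A \in r -> SL2Z A),
      (forall A B, A \in r -> B \in r -> Gamma1 N (A * invmx B) -> A = B) &
      (forall M, SL2Z M -> exists2 A, A \in r & Gamma1 N (M * invmx A))].

Local Notation F := (Gamma1_lift rho N k f g s).

Lemma eq_big_mem (V : nmodType) (I : eqType) (r : seq I) (E E' : I -> V) :
  (forall i, i \in r -> E i = E' i) -> \sum_(i <- r) E i = \sum_(i <- r) E' i.
Proof. by move=> h; rewrite big_seq [RHS]big_seq; apply: eq_bigr. Qed.

Lemma fsum_image (V : nmodType) (I J : choiceType) (r : seq I) (h : I -> J) (E : J -> V) :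
  uniq r -> {in r &, injective h} ->
  \sum_(K \in [set h A | A in [set` r]]) E K = \sum_(A <- r) E (h A).
Proof.
move=> ur hinj; rewrite (@reindex_fsbig _ _ _ _ _ h [set` r]).
  by rewrite (fsbig_seq _ _ ur).
split=> [A hA|A B|K [A hA <-]]; [by exists A| |by exists A].
by rewrite !inE => hA hB E'; apply: hinj.
Qed.

Lemma lift_reps r t : coset_reps r -> 0 < im t -> F t = \sum_(A <- r) lift_term t A.
Proof.
move=> [ur rS rinj rcov] t0.
have -> : F t = \sum_(K \in Gamma1_cosets N) lift_term t (s K) by [].
have -> : Gamma1_cosets N = [set right_coset A | A in [set` r]].
  apply/seteqP; split=> [_ [M hM <-]|_ [A hA <-]].
    have [A Ar h] := rcov M hM; exists A => //; apply/esym.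
    by apply/(right_cosetP hM (rS _ Ar)).
  by exists A => //; exact: rS.
have inj : {in r &, injective right_coset}.
  move=> A B hA hB E; apply: rinj => //.
  by apply/(right_cosetP (rS _ hA) (rS _ hB)).
rewrite (fsum_image _ ur inj).
by apply: eq_big_mem => A hA; exact: (lift_term_section (rS _ hA) t0).
Qed.

Lemma coset_repsM r M : SL2Z M -> coset_reps r -> coset_reps (map (fun A => A * M) r).
Proof.
move=> hM [ur rS rinj rcov].
have inj : injective (fun A => A * M).
  by move=> A B; exact: (can_inj (mulmxK (SL2Z_unit hM))).
have MM A B : SL2Z B -> A * M * invmx (B * M) = A * invmx B.
  by move=> hB; rewrite (invmxMSL hB hM) mulrA (mulKVSL _ hM).
split; first by rewrite map_inj_uniq.
- by move=> _ /mapP[A Ar ->]; exact: SL2ZM (rS _ Ar) hM.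
- move=> _ _ /mapP[A Ar ->] /mapP[B Br ->].
  by rewrite (MM _ _ (rS _ Br)) => h; rewrite (rinj A B).
move=> A hA; have [B Br h] := rcov (A * invmx M) (SL2ZM hA (SL2ZV hM)).
exists (B * M); first by apply/mapP; exists B.
by rewrite (invmxMSL (rS _ Br) hM) mulrA.
Qed.

(** Using the representatives r at the point M t and r M at t matches the two sums term by term. *)
Lemma lift_modular r M t : coset_reps r -> SL2Z M -> 0 < im t ->
  F (mobius M t) = autj M t ^ k *: rho M (F t).
Proof.
move=> hr hM t0; have iM := SL2ZV hM; have j0 := autj_neq0 hM t0.
have [_ rM _ _] := hrho.
have step A : SL2Z A -> lift_term (mobius M t) A = autj M t ^ k *: rho M (lift_term t (A * M)).
  move=> hA; rewrite /lift_term (slashM k f hA hM t0) {2}/slash linearZ scalerA /=.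
  rewrite mulrA -invr_expz mulfV ?expfz_neq0 // mul1r; congr (_ *: _).
  rewrite -(rM _ _ hM (SL2ZV (SL2ZM hA hM))).
  by rewrite (invmxMSL hA hM) mulrA (mulSLV hM) mul1r.
rewrite (lift_reps hr (upper_mobius hM t0)) (lift_reps (coset_repsM hM hr) t0) big_map.
rewrite linear_sum scaler_sumr; apply: eq_big_mem => A hA.
by apply: step; case: hr => _ + _ _; exact.
Qed.

End Lift.

(** * Explicit cosets for N = 2 and N = 3 *)

Section CosetReps.
Implicit Types (A B M : 'M[int]_2).

Definition bottom_row (N : nat) A : int * int := (((A 1 0)%R %% N)%Z, ((A 1 1)%R %% N)%Z).

Lemma bottom_row_Gamma1 N A B : SL2Z B -> Gamma1 N (A * invmx B) ->
  bottom_row N A = bottom_row N B.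
Proof.
move=> hB; have iB : invmx B * B = 1 by exact: mulVSL.
have AE : A = A * invmx B * B by rewrite -mulrA iB mulr1.
rewrite {2}AE; move: (A * invmx B) => X; rewrite (mk2P X) (mk2P B) mk2_mul.
move: (X 0 0) (X 0 1) (X 1 0) (X 1 1) (B 0 0) (B 0 1) (B 1 0) (B 1 1) => a b c d a' b' c' d'.
move=> /Gamma1_mk2[_ _ /modzE[y yE] /modzE[z zE]].
rewrite /bottom_row; have [_ _ -> ->] := mk2E a' b' c' d'.
have [_ _ -> ->] := mk2E (a * a' + b * c') (a * b' + b * d') (c * a' + d * c') (c * b' + d * d').
congr pair; apply/modzE.
  by exists (z * a' + y * c'); rewrite zE yE; ring.
by exists (z * b' + y * d'); rewrite zE yE; ring.
Qed.

Lemma uniq_map_inj (I J : eqType) (h : I -> J) (r : seq I) :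
  uniq (map h r) -> {in r &, injective h}.
Proof.
elim: r => // x r IH /= /andP[hx ur] y z; rewrite !inE.
case/orP=> [/eqP->|yr]; case/orP=> [/eqP->|zr] // E; last exact: IH.
  by case/negP: hx; rewrite E map_f.
by case/negP: hx; rewrite -E map_f.
Qed.

Lemma coset_repsP N (r : seq 'M[int]_2) : (forall A, A \in r -> SL2Z A) ->
  uniq (map (bottom_row N) r) ->
  (forall M, SL2Z M -> bottom_row N M \in map (bottom_row N) r) -> coset_reps N r.
Proof.
move=> rS ru rcov; split => //; first exact: map_uniq ru.
- move=> A B hA hB h; apply: (uniq_map_inj ru) => //.
  by apply: bottom_row_Gamma1 => //; exact: rS.
move=> M hM; have /mapP[A Ar [e1 e2]] := rcov M hM; exists A => //.
by apply: Gamma1_div => //; exact: rS.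
Qed.

Definition reps2 : seq 'M[int]_2 := [:: mk2 1 0 0 1; mk2 0 (-1) 1 0; mk2 0 (-1) 1 1].
Definition reps3 : seq 'M[int]_2 :=
  [:: mk2 1 0 0 1; mk2 0 (-1) 1 0; mk2 0 (-1) 1 1; mk2 0 (-1) 1 2;
      mk2 (-1) 0 0 (-1); mk2 0 1 (-1) 0; mk2 0 1 (-1) (-1); mk2 0 1 (-1) (-2)].

(** The bottom rows are exactly the nonzero vectors modulo 2; the zero vector is excluded by the
    determinant. The case N = 3 is the same with eight vectors. *)
Lemma coset_reps2 : coset_reps 2 reps2.
Proof.
apply: coset_repsP.
- by move=> A; rewrite !inE => /or3P[] /eqP->; apply/SL2Z_mk2.
- by rewrite /= /bottom_row !mxE.
move=> M; rewrite (mk2P M); move: (M 0 0) (M 0 1) (M 1 0) (M 1 1) => a b c d /SL2Z_mk2 h.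
rewrite /= /bottom_row !mxE /= !inE !xpair_eqE.
have : ~ (2 %| c)%Z \/ ~ (2 %| d)%Z.
  have [/dvdzP[x xE]|] := boolP (2 %| c)%Z; last by left; exact/negP.
  have [/dvdzP[y yE]|] := boolP (2 %| d)%Z; last by right; exact/negP.
  have : 2 * (a * y - b * x) = a * d - b * c by rewrite xE yE; ring.
  by rewrite h; clear; lia.
by clear h; lia.
Qed.

Lemma coset_reps3 : coset_reps 3 reps3.
Proof.
apply: coset_repsP.
- by move=> A; rewrite !inE; do 7 ?[case/orP => [/eqP->|]]; last move/eqP->; apply/SL2Z_mk2.
- by rewrite /= /bottom_row !mxE.
move=> M; rewrite (mk2P M); move: (M 0 0) (M 0 1) (M 1 0) (M 1 1) => a b c d /SL2Z_mk2 h.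
have : ~ ((c %% 3)%Z = 0 /\ (d %% 3)%Z = 0).
  move=> [c0 d0]; have := divz_eq c 3; have := divz_eq d 3; rewrite c0 d0 !addr0.
  move: (c %/ 3)%Z (d %/ 3)%Z => x y dE cE.
  have : 3 * (a * y - b * x) = a * d - b * c by rewrite dE cE; ring.
  by rewrite h; clear; lia.
have r3 (z : int) : [\/ (z %% 3)%Z = 0, (z %% 3)%Z = 1 | (z %% 3)%Z = 2].
  have : 0 <= (z %% 3)%Z < 3 by rewrite modz_ge0 ?ltz_pmod.
  by case: (z %% 3)%Z => [[|[|[|]]]|] //= *; [constructor 1|constructor 2|constructor 3].
rewrite /bottom_row; have [_ _ -> ->] := mk2E a b c d.
rewrite /= /bottom_row !mxE /=.
by case: (r3 c) => ->; case: (r3 d) => ->; rewrite // => h0; case: h0.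
Qed.

End CosetReps.

(** * Discriminant forms and the Weil representation *)

Section EvenForms.

(** By symmetry every off-diagonal term occurs twice, and the diagonal entries are even. *)
Lemma even_form m (B : 'M[int]_m) (w : 'rV[int]_m) : even_gram B ->
  exists z : int, (w *m B *m w^T) 0 0 = 2 * z.
Proof.
move=> [sB eB]; pose a i j := w 0 i * B i j * w 0 j.
have aC i j : a i j = a j i.
  by rewrite /a (_ : B i j = B j i); [ring|rewrite -[in LHS]sB mxE].
have -> : (w *m B *m w^T) 0 0 = \sum_i \sum_j a i j.
  rewrite mxE exchange_big; apply: eq_bigr => j _; rewrite !mxE mulr_suml.
  by apply: eq_bigr => i _; rewrite /a.
have -> : \sum_i \sum_j a i j =
    \sum_(i < m) a i i + 2 * \sum_(i < m) \sum_(j < m | (j < i)%N) a i j.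
  have -> : 2 * \sum_(i < m) \sum_(j < m | (j < i)%N) a i j =
      \sum_(i < m) \sum_(j < m | (j < i)%N) a i j + \sum_(i < m) \sum_(j < m | (i < j)%N) a i j.
    rewrite mulrC mulr_natr mulr2n; congr (_ + _).
    rewrite (exchange_big_dep xpredT) //=; apply: eq_bigr => i _.
    by apply: eq_bigr => j _; rewrite aC.
  rewrite -!big_split /=; apply: eq_bigr => i _.
  rewrite (bigD1 i) //=; congr (_ + _); rewrite (bigID (fun j : 'I_m => (j < i)%N)) /=.
  by congr (_ + _); apply: eq_bigl => j; rewrite -val_eqE /=; case: ltngtP.
have aii i : exists z, a i i = 2 * z.
  by have /dvdzP[z zE] := eB i; exists (w 0 i * z * w 0 i); rewrite /a zE; ring.
have [z zE] := boolp.choice aii.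
exists (\sum_i z i + \sum_(i < m) \sum_(j < m | (j < i)%N) a i j).
by rewrite mulrDr; congr (_ + _); rewrite mulr_sumr; apply: eq_bigr.
Qed.

(* Data exhibiting [Z^m / G Z^m] as [(Z/N)^d] through [w |-> w P], where [B] is
   [N] times the inverse of [G]. *)
Definition elementary m (G : 'M[int]_m) (N : int) (d : nat) : Prop :=
  exists (B : 'M[int]_m) (P Z V : 'M[int]_(m, d)) (Q X : 'M[int]_(d, m)) (Y : 'M[int]_m),
    [/\ G *m B = N%:M, even_gram B, B = P *m X + N *: Y & P = B *m Z + N *: V /\ Q *m P = 1%:M].

Lemma elementary_dsum m1 m2 (G1 : 'M[int]_m1) (G2 : 'M[int]_m2) N d1 d2 :
  elementary G1 N d1 -> elementary G2 N d2 -> elementary (dsum G1 G2) N (d1 + d2).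
Proof.
move=> [B1 [P1 [Z1 [V1 [Q1 [X1 [Y1 [h1 e1 x1 [z1 q1]]]]]]]]].
move=> [B2 [P2 [Z2 [V2 [Q2 [X2 [Y2 [h2 e2 x2 [z2 q2]]]]]]]]].
exists (dsum B1 B2), (block_mx P1 0 0 P2), (block_mx Z1 0 0 Z2), (block_mx V1 0 0 V2).
exists (block_mx Q1 0 0 Q2), (block_mx X1 0 0 X2), (block_mx Y1 0 0 Y2).
rewrite /dsum; split; first by rewrite mulmx_block !(mulmx0, mul0mx, addr0, add0r) h1 h2 scalar_mx_block.
- exact: even_dsum.
- by rewrite mulmx_block !(mulmx0, mul0mx, addr0, add0r) scale_block_mx !scaler0 add_block_mx !addr0 -x1 -x2.
split; last by rewrite mulmx_block !(mulmx0, mul0mx, addr0, add0r) q1 q2 -scalar_mx_block.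
by rewrite mulmx_block !(mulmx0, mul0mx, addr0, add0r) scale_block_mx !scaler0 add_block_mx !addr0 -z1 -z2.
Qed.

Lemma elementary_II11 N : elementary (N *: II11) N 2.
Proof.
have h : II11 *m II11 = 1%:M.
  by apply/matrixP => -[[|[|//]] ?] [[|[|//]] ?]; rewrite ?(mxE, big_ord_recr, big_ord0) /=.
exists II11, 1%:M, II11, 0, 1%:M, II11, 0; split.
- by rewrite -scalemxAl h scale_scalar_mx mulr1.
- exact: even_II11.
- by rewrite mul1mx scaler0 addr0.
- by rewrite h scaler0 addr0 mul1mx.
Qed.

Lemma elementary_A2 : elementary (-1 *: A2) 3 1.
Proof.
(* B is -3 times the inverse of A2. Modulo 3 it has rank 1, with column space spanned by P. *)
exists (\matrix_(i, j) if i == j then -2 else -1), (\matrix_(i, j) if i == 0 then 1 else -1).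
exists (\matrix_(i, j) if i == 0 then 0 else -1), (\matrix_(i, j) if i == 0 then 0 else -1).
exists (\matrix_(i, j) if j == 0 then 1 else 0), (\matrix_(i, j) if j == 0 then -2 else -1).
exists (\matrix_(i, j) if i == 0 then 0 else -1); split; [|split=> [|i]| |split].
- by apply/matrixP => -[[|[|//]] ?] [[|[|//]] ?]; rewrite ?(mxE, big_ord_recr, big_ord0) /=.
- by apply/matrixP => -[[|[|//]] ?] [[|[|//]] ?]; rewrite ?(mxE, big_ord_recr, big_ord0) /=.
- by case: i => -[|[|//]] ?; rewrite mxE.
- by apply/matrixP => -[[|[|//]] ?] [[|[|//]] ?]; rewrite ?(mxE, big_ord_recr, big_ord0) /=.
- by apply/matrixP => -[[|[|//]] ?] j; rewrite ord1 ?(mxE, big_ord_recr, big_ord0) /=.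
- by apply/matrixP => i j; rewrite !ord1 ?(mxE, big_ord_recr, big_ord0) /=.
Qed.

Lemma elementary_D4 : elementary (-1 *: D4) 2 2.
Proof.
(* B is -2 times the inverse of D4. Modulo 2 the central row and column vanish and the block of the
   three leaves has rank 2. *)
exists (\matrix_(i, j) if i == j then (if i == 0 then -4 else -2) else if (i == 0) || (j == 0) then -2 else -1).
exists (\matrix_(i, j) nth 0 (nth [::] [:: [:: 0; 0]; [:: 1; 0]; [:: 1; 1]; [:: 0; 1]] i) j).
exists (\matrix_(i, j) nth 0 (nth [::] [:: [:: 0; 0]; [:: 0; 1]; [:: 0; 0]; [:: 1; 0]] i) j).
exists (\matrix_(i, j) nth 0 (nth [::] [:: [:: 1; 1]; [:: 1; 1]; [:: 1; 1]; [:: 1; 1]] i) j).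
exists (\matrix_(i, j) nth 0 (nth [::] [:: [:: 0; 1; 0; 0]; [:: 0; 0; 0; 1]] i) j).
exists (\matrix_(i, j) nth 0 (nth [::] [:: [:: 0; 0; 1; 1]; [:: 0; 1; 1; 0]] i) j).
exists (\matrix_(i, j) nth 0 (nth [::] [:: [:: -2; -1; -1; -1]; [:: -1; -1; -1; -1]; [:: -1; -1; -2; -1]; [:: -1; -1; -1; -1]] i) j).
split; [|split=> [|i]| |split].

- by apply/matrixP => -[[|[|[|[|//]]]] ?] [[|[|[|[|//]]]] ?]; rewrite ?(mxE, big_ord_recr, big_ord0) /=.
- by apply/matrixP => -[[|[|[|[|//]]]] ?] [[|[|[|[|//]]]] ?]; rewrite ?(mxE, big_ord_recr, big_ord0) /=.
- by case: i => -[|[|[|[|//]]]] ?; rewrite mxE.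
- by apply/matrixP => -[[|[|[|[|//]]]] ?] [[|[|[|[|//]]]] ?]; rewrite ?(mxE, big_ord_recr, big_ord0) /=.
- by apply/matrixP => -[[|[|[|[|//]]]] ?] [[|[|//]] ?]; rewrite ?(mxE, big_ord_recr, big_ord0) /=.
- by apply/matrixP => -[[|[|//]] ?] [[|[|//]] ?]; rewrite ?(mxE, big_ord_recr, big_ord0) /=.
Qed.

End EvenForms.

(** * The finite quadratic module D: pairing, order and level *)

Section DiscriminantGroups.
Variables (n : nat) (L : even_lattice n).
Implicit Types (x y z : 'rV[rat]_n.+2) (u v : dual L) (a b g : disc L) (p q r : rat).
Local Notation G := (gramQ (gram L)).

Lemma eqmod1_refl p : eqmod1 p p.
Proof. by rewrite /eqmod1 subrr rpred0. Qed.

Lemma eqmod1_sym p q : eqmod1 p q -> eqmod1 q p.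
Proof. by rewrite /eqmod1 -opprB rpredN. Qed.

Lemma eqmod1_trans q p r : eqmod1 p q -> eqmod1 q r -> eqmod1 p r.
Proof. by rewrite /eqmod1 => h h'; rewrite -(subrKA q) rpredD. Qed.

Lemma eqmod1D p p' q q' : eqmod1 p p' -> eqmod1 q q' -> eqmod1 (p + q) (p' + q').
Proof. by rewrite /eqmod1 => h h'; rewrite opprD addrACA rpredD. Qed.

Lemma eqmod1_int p : p \is a Num.int -> eqmod1 p 0.
Proof. by rewrite /eqmod1 subr0. Qed.

Lemma bilDl x y z : bil L (x + y) z = bil L x z + bil L y z.
Proof. by rewrite /bil /bilQ !mulmxDl mxE. Qed.

Lemma bilC x y : bil L x y = bil L y x.
Proof.
rewrite /bil /bilQ; have [s _] := gram_even L.
have sG : G^T = G by rewrite /gramQ map_trmx s.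
transitivity ((x *m G *m y^T)^T 0 0); first by rewrite !mxE.
by rewrite !trmx_mul trmxK sG mulmxA !mxE.
Qed.

Lemma bilNl x y : bil L (- x) y = - bil L x y.
Proof. by rewrite /bil /bilQ !mulNmx mxE. Qed.

Lemma bilDr x y z : bil L z (x + y) = bil L z x + bil L z y.
Proof. by rewrite bilC bilDl !(bilC z). Qed.

Lemma bilNr x y : bil L y (- x) = - bil L y x.
Proof. by rewrite bilC bilNl bilC. Qed.

Lemma quadD x y : quad L (x + y) = quad L x + quad L y + bil L x y.
Proof. by rewrite /quad bilDl !bilDr (bilC y x); field. Qed.

Lemma quadN x : quad L (- x) = quad L x.
Proof. by rewrite /quad bilNl bilNr opprK. Qed.

Lemma lat_row u : u \in @lat_pred n L -> exists y : 'rV[int]_n.+2, val u = map_mx intr y.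
Proof.
move=> /mxOverP h; exists (map_mx numq (val u)); apply/matrixP => i j.
by rewrite !mxE; have /intrP[z ->] := h i j; rewrite numq_int.
Qed.

Lemma bil_lat u v : v \in @lat_pred n L -> bil L (val u) (val v) \is a Num.int.
Proof. by move=> /lat_row[y ->]; have /asboolP := valP u; exact. Qed.

Lemma quad_lat u : u \in @lat_pred n L -> quad L (val u) \is a Num.int.
Proof.
move=> /lat_row[y ->]; have [z zE] := even_form y (gram_even L).
rewrite /quad /bil /bilQ /gramQ map_trmx -!map_mxM mxE zE /= intrM mulrAC mulfV // mul1r.
exact: rpred_int.
Qed.

Lemma eqmod1_bil u u' v : u - u' \in @lat_pred n L -> eqmod1 (bil L (val u) (val v)) (bil L (val u') (val v)).
Proof.
by move=> h; rewrite /eqmod1 -bilNl -bilDl -GRing.valN -GRing.valD bilC bil_lat.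
Qed.

Lemma eqmod1_quad u u' : u - u' \in @lat_pred n L -> eqmod1 (quad L (val u)) (quad L (val u')).
Proof.
move=> h; rewrite -{1}(subrK u' u) GRing.valD quadD /eqmod1.
have e (p q r : rat) : p + q + r - q = p + r by ring.
by rewrite e rpredD ?quad_lat // bilC bil_lat.
Qed.

Lemma disc_eq u v : \pi_(disc L)%qT u = \pi_(disc L)%qT v <-> u - v \in @lat_pred n L.
Proof. by split=> [/eqP|h]; [|apply/eqP]; rewrite -Quotient.idealrBE. Qed.

Lemma repr_pi u : repr (\pi_(disc L)%qT u) - u \in @lat_pred n L.
Proof. by apply/disc_eq; rewrite reprK. Qed.

Lemma discQ_pi u : eqmod1 (discQ (\pi_(disc L)%qT u)) (quad L (val u)).
Proof. exact: eqmod1_quad (repr_pi u). Qed.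

Lemma discB_pi u v : eqmod1 (discB (\pi_(disc L)%qT u) (\pi_(disc L)%qT v)) (bil L (val u) (val v)).
Proof.
apply: eqmod1_trans (eqmod1_bil _ (repr_pi u)) _; rewrite bilC [X in eqmod1 _ X]bilC.
exact: eqmod1_bil (repr_pi v).
Qed.

Lemma discB_sym a b : discB a b = discB b a.
Proof. exact: bilC. Qed.

Lemma disc_ind (P : disc L -> Prop) : (forall u, P (\pi_(disc L)%qT u)) -> forall a, P a.
Proof. by move=> h a; rewrite -[a]reprK. Qed.

Lemma piD u v : \pi_(disc L)%qT (u + v) = \pi_(disc L)%qT u + \pi_(disc L)%qT v.
Proof. exact: raddfD. Qed.

Lemma piN u : \pi_(disc L)%qT (- u) = - \pi_(disc L)%qT u.
Proof. exact: raddfN. Qed.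

Lemma discBD a b g : eqmod1 (discB (a + b) g) (discB a g + discB b g).
Proof.
elim/disc_ind: a => u; elim/disc_ind: b => v; elim/disc_ind: g => w; rewrite -piD.
apply: eqmod1_trans (discB_pi _ _) _; rewrite GRing.valD bilDl.
by apply/eqmod1_sym/eqmod1D; exact: discB_pi.
Qed.

Lemma discB0 g : eqmod1 (discB 0 g) 0.
Proof.
have := discBD 0 0 g; rewrite addr0 => /eqmod1_sym; rewrite /eqmod1 addrK subr0.
by [].
Qed.

Lemma discBN a g : eqmod1 (discB (- a) g) (- discB a g).
Proof.
have := eqmod1_trans (eqmod1_sym (discBD (- a) a g)) _; rewrite addNr.
by move=> /(_ _ (discB0 g)); rewrite /eqmod1 subr0 opprK.
Qed.

Lemma discQN a : eqmod1 (discQ (- a)) (discQ a).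
Proof.
elim/disc_ind: a => u; rewrite -piN; apply: eqmod1_trans (discQ_pi _) _.
by rewrite GRing.valN quadN; exact/eqmod1_sym/discQ_pi.
Qed.

Lemma discQ0 : eqmod1 (discQ (0 : disc L)) 0.
Proof.
have -> : (0 : disc L) = \pi_(disc L)%qT 0 by rewrite raddf0.
apply: eqmod1_trans (discQ_pi _) _; apply: eqmod1_int; apply: quad_lat.
exact: rpred0.
Qed.

Lemma dual_of_int (w : 'rV[int]_n.+2) : exists u : dual L, val u *m G = map_mx intr w.
Proof.
have h : map_mx intr w *m invmx G \in dual_pred L.
  apply/asboolP => y; rewrite /bil /bilQ mulmxKV ?gramQ_unit // map_trmx -map_mxM mxE.
  exact: rpred_int.
by exists (Dual h) => /=; rewrite mulmxKV ?gramQ_unit.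
Qed.

(** A representative u outside the lattice has a nonintegral coordinate u_j; the dual vector v with
    v G = e_j pairs with u to u_j. *)
Lemma disc_nondegenerate g : g != 0 -> exists b, discB b g \isn't a Num.int.
Proof.
elim/disc_ind: g => u u0.
have [j hj] : exists j, val u 0 j \isn't a Num.int.
  apply: contrapT => h; case/negP: u0; apply/eqP.
  have -> : (0 : disc L) = \pi_(disc L)%qT 0 by rewrite raddf0.
  apply/disc_eq; rewrite subr0; apply/mxOverP => i j; rewrite ord1.
  by apply: contrapT => /negP hj; apply: h; exists j.
have [v vE] := dual_of_int (delta_mx 0 j); exists (\pi_(disc L)%qT v).
apply: contra hj => h; have := discB_pi v u; rewrite /eqmod1 rpredBl //.
rewrite /bil /bilQ vE map_delta_mx -rowE !mxE; exact.
Qed.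

Section Elementary.
Variables (N d : nat).
Hypotheses (N1 : (1 < N)%N) (hG : elementary (gram L) N d).

(** With w = u G, a dual vector u lies in the lattice iff N divides w B. Two injections follow: w ->
    w P modulo N, by B = P X modulo N, and in the other direction v -> v Q, by Q P = 1 and P = B Z
    modulo N. *)
Lemma card_disc : #|{: disc L}| = (N ^ d)%N.
Proof.
have [B [P [Z [V [Q [X [Y [h eB hX [hZ hQ]]]]]]]]] := hG.
have N0 : (N%:R : rat) != 0 by rewrite pnatr_eq0; lia.
have hQ' : G *m map_mx intr B = N%:R%:M by rewrite /gramQ -map_mxM h map_scalar_mx.
have lat_iff u (w : 'rV[int]_n.+2) : val u *m G = map_mx intr w ->
    (u \in @lat_pred n L <-> exists y : 'rV[int]_n.+2, w *m B = N%:Z *: y).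
  move=> e; have eB' : map_mx intr (w *m B) = N%:R *: val u.
    by rewrite map_mxM -e -mulmxA hQ' mul_mx_scalar.
  split=> [/lat_row[y uy]|[y yE]].
    exists y; apply/matrixP => i j; apply: (@intr_inj rat).
    by have /matrixP/(_ i j) := eB'; rewrite uy [LHS]mxE => ->; rewrite !mxE intrM.
  apply/mxOverP => i j; have /matrixP/(_ i j) := eB'; rewrite yE [LHS]mxE !mxE intrM.
  by move/(mulfI N0) <-; exact: rpred_int.
have [K NE] : exists K, N = K.+1 by exists N.-1; lia.
pose red (z : int) : 'I_K.+1 := inord (absz (z %% N)%Z).
have redP (z z' : int) : red z = red z' -> exists y : int, z - z' = N%:Z * y.
  have lt (x : int) : (absz (x %% N)%Z < K.+1)%N.
    have N0' : N%:Z != 0 by rewrite NE.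
    by have := modz_ge0 x N0'; have := ltz_mod x N0'; lia.
  move=> /(congr1 val); rewrite /= !inordK // => e.
  have /modzE[y yE] : (z = z' %[mod N])%Z.
    have N0' : N%:Z != 0 by rewrite NE.
    by rewrite -(gez0_abs (modz_ge0 z N0')) e gez0_abs // modz_ge0.
  by exists y; rewrite yE; ring.
have redmx (w w' : 'rV[int]_d) : map_mx red w = map_mx red w' ->
    exists y : 'rV[int]_d, w - w' = N%:Z *: y.
  move=> /matrixP e; have hc j : exists y : int, w 0 j - w' 0 j = N%:Z * y.
    by apply: redP; have := e 0 j; rewrite !mxE.
  have [y yE] := boolp.choice hc; exists (\row_j y j); apply/matrixP => i j.
  by rewrite ord1 !mxE yE.
have [W WE] := boolp.choice (fun g : disc L => dual_int (repr g)).
pose phi g : 'rV['I_K.+1]_d := map_mx red (W g *m P).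
have phi_inj : injective phi.
  move=> g g' /redmx[y yE]; rewrite -(reprK g) -(reprK g'); apply/disc_eq.
  apply/(lat_iff _ (W g - W g')).
    by rewrite GRing.valB mulmxBl -!WE map_mxB.
  exists (y *m X + (W g - W g') *m Y); rewrite hX mulmxDr mulmxA mulmxBl yE.
  by rewrite -scalemxAl -scalemxAr scalerDr.
pose lft (u : 'rV['I_K.+1]_d) : 'rV[int]_d := map_mx (fun i : 'I_K.+1 => (i : nat)%:Z) u.
have [D DE] := boolp.choice dual_of_int.
pose psi (u : 'rV['I_K.+1]_d) : disc L := \pi_(disc L)%qT (D (lft u *m Q)).
have psi_inj : injective psi.
  move=> u u' /disc_eq/(lat_iff _ ((lft u - lft u') *m Q)) [].
    by rewrite GRing.valB mulmxBl !DE -map_mxB -mulmxBl.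
  move=> y yE; set v := _ - _ in yE.
  have vE : v = N%:Z *: (y *m Z + v *m Q *m V).
    rewrite -[LHS]mulmx1 -hQ mulmxA {1}hZ mulmxDr mulmxA yE -scalemxAl -scalemxAr.
    by rewrite -scalerDr.
  apply/matrixP => i j; apply: val_inj => /=.
  have := congr1 (fun M : 'rV_d => M i j) vE; rewrite !mxE => e.
  have {e} [a] : exists a : int, (u i j : nat)%:Z - (u' i j : nat)%:Z = N%:Z * a by eexists; exact: e.
  have := ltn_ord (u i j); have := ltn_ord (u' i j).
  move: (nat_of_ord _) (nat_of_ord _) => p q hp hq e.
  have a0 : a = 0 by nia.
  by move: e; rewrite a0; lia.
have c : #|{: 'rV['I_K.+1]_d}| = (N ^ d)%N by rewrite card_mx card_ord mul1n NE.
apply/eqP; rewrite eqn_leq -{1}c (leq_card _ phi_inj) -c.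
exact: leq_card psi_inj.
Qed.

(** With w = u G one has N u = w B, so N q(u) = w B w^T / 2, and B is even. *)
Lemma annihilates_elementary : annihilates_discQ L N.
Proof.
have [B [P [Z [V [Q [X [Y [h eB _ _]]]]]]]] := hG; have [sB _] := eB.
move=> g; have [w wE] := dual_int (repr g); rewrite /discQ; move: (val (repr g)) wE => x wE.
have e : N%:R *: x = map_mx intr (w *m B).
  by rewrite map_mxM wE -mulmxA /gramQ -map_mxM h map_scalar_mx mul_mx_scalar.
have [z zE] := even_form w eB.
suff -> : N%:R * quad L x = z%:~R by exact: rpred_int.
rewrite /quad /bil /bilQ -wE mulrA.
have -> : N%:R * (map_mx intr w *m x^T) 0 0 = (map_mx intr w *m (N%:R *: x)^T) 0 0.
  by rewrite linearZ /= -scalemxAr [RHS]mxE.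
rewrite e map_trmx -map_mxM mxE trmx_mul sB mulmxA zE /= intrM.
by field.
Qed.

End Elementary.

(* [v / N] is then a dual vector with [quad = 1 / N]. *)
Definition level_vector m (H : 'M[int]_m) (N : nat) : Prop :=
  exists v w : 'rV[int]_m, v *m H = N%:Z *: w /\ (v *m H *m v^T) 0 0 = 2 * N%:Z.

Lemma level_vector_dsum m1 m2 (H1 : 'M[int]_m1) (H2 : 'M[int]_m2) N :
  level_vector H2 N -> level_vector (dsum H1 H2) N.
Proof.
move=> [v [w [e q]]]; exists (row_mx 0 v), (row_mx 0 w).
rewrite /dsum mul_row_block !(mulmx0, mul0mx, addr0, add0r) e.
split; first by rewrite scale_row_mx scaler0.
by rewrite tr_row_mx mul_row_col mul0mx add0r -e.
Qed.

Lemma level_vector_II11 N : level_vector (N%:Z *: II11) N.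
Proof.
exists (const_mx 1), (const_mx 1); split.
  by apply/matrixP => i -[[|[|//]] ?]; rewrite ?(mxE, big_ord_recr, big_ord0) /=; lia.
by rewrite ?(mxE, big_ord_recr, big_ord0) /=; lia.
Qed.

Lemma is_level_elementary N d : (1 < N)%N -> elementary (gram L) N d ->
  level_vector (gram L) N -> is_level L N.
Proof.
move=> N1 hG [v [w [e q]]]; split; [lia|exact: annihilates_elementary hG|].
have N0 : (N%:R : rat) != 0 by rewrite pnatr_eq0; lia.
move=> M M0 hM; have [u uE] := dual_of_int w.
have uv : val u = N%:R^-1 *: map_mx intr v.
  apply: (can_inj (mulmxK (gramQ_unit L))); rewrite uE -scalemxAl /gramQ -map_mxM e.
  by rewrite map_mxZ scalerA mulVf // scale1r.
have Q1 : quad L (val u) = N%:R^-1.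
  rewrite /quad /bil /bilQ uv linearZ /= -scalemxAr -!scalemxAl map_trmx.
  have -> : gramQ (gram L) = map_mx intr (gram L) by [].
  rewrite -!map_mxM scalerA [LHS]mulrC mxE [X in _ * (_ * X)]mxE q /= intrM.
  by field.
have : M%:R * quad L (val u) \is a Num.int.
  have := discQ_pi u; rewrite /eqmod1 => h.
  have := rpredB (hM (\pi_(disc L)%qT u)) (rpredM (rpred_nat _ M) h).
  by rewrite mulrBr subKr; exact.
rewrite Q1 => /intrP[z zE].
have : M%:R = (z * N%:Z)%:~R :> rat by rewrite intrM -zE divfK.
rewrite -[M%:R]/(M%:Z%:~R) => /eqP; rewrite eqr_int => /eqP zM.
have z0 : 0 < z by nia.
by nia.
Qed.

End DiscriminantGroups.

Lemma elementary_latticeA2 : elementary (gram latticeA2) 3 5.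
Proof.
exact: (elementary_dsum elementary_A2 (elementary_dsum (elementary_II11 3) (elementary_II11 3))).
Qed.

Lemma elementary_latticeD4 : elementary (gram latticeD4) 2 6.
Proof.
exact: (elementary_dsum elementary_D4 (elementary_dsum (elementary_II11 2) (elementary_II11 2))).
Qed.

Lemma is_level_latticeA2 : is_level latticeA2 3.
Proof.
apply: (@is_level_elementary _ _ 3 5 isT elementary_latticeA2).
exact: (level_vector_dsum (-1 *: A2) (level_vector_dsum (3 *: II11) (level_vector_II11 3))).
Qed.

Lemma is_level_latticeD4 : is_level latticeD4 2.
Proof.
apply: (@is_level_elementary _ _ 2 6 isT elementary_latticeD4).
exact: (level_vector_dsum (-1 *: D4) (level_vector_dsum (2 *: II11) (level_vector_II11 2))).
Qed.

Lemma eqmod1N p q : eqmod1 p q -> eqmod1 (- p) (- q).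
Proof. by rewrite /eqmod1 -opprD rpredN. Qed.

(** * The Weil representation: unitarity and the action of Gamma_1(N) *)

Section WeilRepresentation.
Variable R : realType.
Local Notation C := (Cplx R).
Local Notation eeQ := (@eeQ R).

Lemma ratrC (q : rat) : (ratr q : C) = (ratr q : R)%:C.
Proof. by rewrite fmorph_rat. Qed.

Lemma normc_eeQ q : normc (eeQ q) = 1.
Proof. by rewrite normc_ee ratrC /= mulr0 oppr0 expR0. Qed.

Lemma eeQD p q : eeQ (p + q) = eeQ p * eeQ q.
Proof. by rewrite /Defs.eeQ rmorphD eeD. Qed.

Lemma eeQ_neq0 q : eeQ q != 0.
Proof. exact: ee_neq0. Qed.

Lemma eeQN q : eeQ (- q) = (eeQ q)^-1.
Proof. by rewrite /Defs.eeQ rmorphN eeN. Qed.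

Lemma eeQ_int q : q \is a Num.int -> eeQ q = 1.
Proof. by move=> /intrP[z ->]; rewrite /Defs.eeQ ratr_int ee_int. Qed.

Lemma eeQ0 : eeQ 0 = 1.
Proof. exact: eeQ_int. Qed.

Lemma eeQ_eqmod1 p q : eqmod1 p q -> eeQ p = eeQ q.
Proof. by move=> /eeQ_int h; rewrite -(subrK q p) eeQD h mul1r. Qed.

Lemma eeQMn k q : eeQ (k%:R * q) = eeQ q ^+ k.
Proof. by rewrite /Defs.eeQ rmorphM /= ratr_nat eeMn. Qed.

(** For a fractional part 0 < r < 1, the real part of e(r) is 1 - 2 sin(pi r)^2 < 1. *)
Lemma eeQ_eq1 q : eeQ q = 1 -> q \is a Num.int.
Proof.
move=> q1; set r := q - (Num.floor q)%:~R.
have r1 : eeQ r = 1 by rewrite eeQD eeQN q1 mul1r (eeQ_int (rpred_int _ _)) invr1.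
have [r0|r0] := eqVneq r 0.
  by rewrite -(subrK (Num.floor q)%:~R q) -/r r0 add0r rpred_int.
have r01 : 0 < r < 1.
  have := floor_itv q; rewrite intrD1 => /andP[a b].
  by rewrite lt_neqAle eq_sym r0 /= subr_ge0 a /= ltrBlDl.
have [p0 p1] : 0 < (ratr r : R) /\ (ratr r : R) < 1.
  by case/andP: r01 => a b; rewrite ltr0q -[1](rmorph1 (@ratr R)) ltr_rat.
exfalso; move: (congr1 (@complex.Re R) r1); rewrite /Defs.eeQ ratrC /= mulr0 oppr0 expR0 mul1r.
have s0 : 0 < sin (pi * ratr r : R).
  by apply: sin_gt0_pi; rewrite mulr_gt0 ?pi_gt0 //= gtr_pMr ?pi_gt0.
have -> : 2 * pi * ratr r = (pi * ratr r) *+ 2 :> R by rewrite -mulrA mulr_natl.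
rewrite cos_mulr2n cos2sin2; move: (sin _) s0 => s s0 h.
by clear -s0 h; have s2 : 0 < s ^+ 2 by [rewrite exprn_gt0]; move: h s2; rewrite mulr2n => h s2; lra.
Qed.

Variables (n : nat) (L : even_lattice n).
Local Notation V := (group_ring R L).
Implicit Types (b g : disc L) (v w : V).
Local Notation D := (#|{: disc L}|%:R : C).

Lemma sum_character g : \sum_(b : disc L) eeQ (discB b g) = if g == 0 then D else 0.
Proof.
have [->|g0] := eqVneq g 0.
  rewrite (eq_bigr (fun=> 1)); first by rewrite sumr_const.
  by move=> b _; rewrite discB_sym (eeQ_eqmod1 (discB0 b)) eeQ0.
have [b0 hb] := disc_nondegenerate g0.
set X := \sum_b _.
have e : X = eeQ (discB b0 g) * X.
  rewrite {1}/X (reindex_inj (addrI b0)) mulr_sumr; apply: eq_bigr => b _.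
  by rewrite (eeQ_eqmod1 (discBD _ _ _)) eeQD.
have : (1 - eeQ (discB b0 g)) * X = 0 by rewrite mulrBl mul1r -e subrr.
move/eqP; rewrite mulf_eq0 subr_eq0 => /orP[/eqP h|/eqP //].
by case/negP: hb; apply: eeQ_eq1.
Qed.

Lemma sum_pick (I : finType) (A : nmodType) (b : I) (F : I -> A) :
  (forall i, i != b -> F i = 0) -> \sum_i F i = F b.
Proof. by move=> h; rewrite (bigD1 b) //= big1 ?addr0. Qed.

Lemma basis_sum v : v = \sum_g v g *: basis_elt R g.
Proof.
apply/ffunP => b; rewrite sum_ffunE (@sum_pick _ _ b).
  by rewrite !ffunE eqxx /GRing.scale /= mulr1.
by move=> g gb; rewrite !ffunE eq_sym (negPf gb) /GRing.scale /= mulr0.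
Qed.

Variable rho : 'M[int]_2 -> {linear V -> V}.
Hypothesis hrho : weil_representation rho.
Local Notation kappa := (ee (- (2 - n%:R) / 8) / sqrtC D : C).

Lemma rho_T v g : rho matT v g = eeQ (discQ g) * v g.
Proof.
have [_ _ rT _] := hrho.
rewrite {1}(basis_sum v) linear_sum sum_ffunE (@sum_pick _ _ g).
  by rewrite linearZ /= rT !ffunE eqxx /GRing.scale /= mulr1 mulrC.
by move=> b bg; rewrite linearZ /= rT !ffunE eq_sym (negPf bg) /GRing.scale /= !mulr0.
Qed.

Lemma rho_S v b : rho matS v b = kappa * \sum_g v g * eeQ (- discB b g).
Proof.
have [_ _ _ rS] := hrho.
rewrite {1}(basis_sum v) linear_sum sum_ffunE mulr_sumr; apply: eq_bigr => g _.
rewrite linearZ /= rS !ffunE sum_ffunE (@sum_pick _ _ b).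
  by rewrite !ffunE eqxx /GRing.scale /= mulr1 mulrCA.
by move=> c cb; rewrite !ffunE eq_sym (negPf cb) /GRing.scale /= mulr0.
Qed.

Lemma D_neq0 : D != 0.
Proof. by rewrite pnatr_eq0 -lt0n; apply/card_gt0P; exists 0. Qed.

Lemma kappa_sqr : kappa ^+ 2 * D = ee (- (2 - n%:R) / 4).
Proof.
rewrite exprMn exprVn sqrtCK divfK ?D_neq0 // -eeMn; congr ee; by field.
Qed.

(** Fourier inversion on D. *)
Lemma rho_SS g : rho matS (rho matS (basis_elt R g)) = ee (- (2 - n%:R) / 4) *: basis_elt R (- g).
Proof.
apply/ffunP => b; rewrite rho_S.
have e c : rho matS (basis_elt R g) c = kappa * eeQ (- discB c g).
  rewrite rho_S (@sum_pick _ _ g); first by rewrite !ffunE eqxx mul1r.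
  by move=> a ag; rewrite !ffunE (negPf ag) mul0r.
under eq_bigr => c _ do rewrite e -mulrA.
rewrite -mulr_sumr mulrA -expr2.
have -> : \sum_c eeQ (- discB c g) * eeQ (- discB b c) = (b == - g)%:R * D.
  transitivity (\sum_c eeQ (discB c (- (g + b)))).
    apply: eq_bigr => c _; rewrite -eeQD; apply: eeQ_eqmod1.
    rewrite discB_sym (discB_sym c) -opprD; apply: eqmod1_sym.
    by apply: eqmod1_trans (discBN _ _) _; apply/eqmod1N/discBD.
  rewrite sum_character oppr_eq0 addrC addr_eq0; by case: eqP; rewrite ?mul1r ?mul0r.
by rewrite mulrCA kappa_sqr !ffunE mulrC.
Qed.

Definition sqnorm v : R := \sum_g normc (v g) ^+ 2.

Lemma sqnorm_T v : sqnorm (rho matT v) = sqnorm v.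
Proof. by apply: eq_bigr => g _; rewrite rho_T normcM normc_eeQ mul1r. Qed.

Lemma sqnormC v : (sqnorm v)%:C = \sum_g v g * (v g)^*.
Proof.
by rewrite rmorph_sum; apply: eq_bigr => g _; rewrite rmorphXn /= -normE normCK.
Qed.

Lemma conj_eeQ q : (eeQ q)^* = eeQ (- q).
Proof.
apply: (mulfI (eeQ_neq0 q)); rewrite -normCK normE normc_eeQ expr1n eeQN mulfV //.
exact: eeQ_neq0.
Qed.

Lemma normc_kappa : normc kappa ^+ 2 * #|{: disc L}|%:R = 1.
Proof.
have := congr1 (fun z : C => normc z) kappa_sqr; rewrite normcM normcX normc_nat => ->.
have -> : (- (2 - n%:R) / 4 : C) = ratr (- (2 - n%:R) / 4).
  by rewrite fmorph_div rmorphN rmorphB /= !ratr_nat.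
exact: normc_eeQ.
Qed.

(** Parseval's identity on D. The later descent moves t by T and S, so with [sqnorm_T] this makes
    the norm invariant. *)
Lemma sqnorm_S v : sqnorm (rho matS v) = sqnorm v.
Proof.
have e b : (normc (rho matS v b) ^+ 2)%:C = ((normc kappa) ^+ 2)%:C *
    \sum_g \sum_h v g * (v h)^* * eeQ (discB b (h - g)).
  rewrite rho_S normcM exprMn rmorphM; congr (_ * _).
  rewrite rmorphXn /= -normE normCK rmorph_sum mulr_suml; apply: eq_bigr => g _.
  rewrite mulr_sumr; apply: eq_bigr => h _.
  rewrite rmorphM /= conj_eeQ opprK mulrACA; congr (_ * _); rewrite -eeQD; apply: eeQ_eqmod1.
  rewrite !(discB_sym b); apply: eqmod1_sym; apply: eqmod1_trans (discBD _ _ _) _.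
  by rewrite addrC; apply: eqmod1D (discBN _ _) (eqmod1_refl _).
apply: (@complexI R); rewrite !sqnormC.
transitivity (\sum_b (normc (rho matS v b) ^+ 2)%:C).
  by apply: eq_bigr => b _; rewrite rmorphXn /= -normE normCK.
under eq_bigr => b _ do rewrite e.
rewrite -mulr_sumr exchange_big /=.
have -> : \sum_g \sum_b \sum_h v g * (v h)^* * eeQ (discB b (h - g)) =
    \sum_g v g * (v g)^* * D.
  apply: eq_bigr => g _; rewrite exchange_big /=.
  rewrite (@sum_pick _ _ g) => [|h hg]; rewrite -mulr_sumr sum_character.
    by rewrite subrr eqxx.
  by rewrite subr_eq0 (negPf hg) mulr0.
rewrite -mulr_suml mulrCA.
have := congr1 (real_complex R) normc_kappa; rewrite rmorphM rmorph_nat rmorph1 => ->.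
by rewrite mulr1.
Qed.

Section Character.
Variable N : nat.
Hypotheses (N13 : (1 < N <= 3)%N) (hN : annihilates_discQ L N).

Lemma rho_Tn k v g : rho (mk2 1 k%:Z 0 1) v g = eeQ (k%:R * discQ g) * v g.
Proof.
have [r1 rM _ _] := hrho.
elim: k v g => [|k IH] v g; first by rewrite mk2_1 r1 mul0r eeQ0 mul1r.
have -> : mk2 1 k.+1 0 1 = mk2 1 k 0 1 * matT by rewrite matT_mk2 mk2_mul; congr mk2; clear; lia.
rewrite rM ?IH; first 1 last.
- by apply/SL2Z_mk2; clear; lia.
- by rewrite matT_mk2; apply/SL2Z_mk2.
by rewrite rho_T mulrA -eeQD -natr1 mulrDl mul1r.
Qed.

Lemma rho_TN v : rho (mk2 1 N 0 1) v = v.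
Proof. by apply/ffunP => g; rewrite rho_Tn eeQ_int ?mul1r. Qed.

Lemma SL2Z_S : SL2Z matS.
Proof. by rewrite matS_mk2; apply/SL2Z_mk2. Qed.

Lemma SL2Z_T : SL2Z matT.
Proof. by rewrite matT_mk2; apply/SL2Z_mk2. Qed.

(* [U S T^N = S], where [T^N] acts trivially. *)
Lemma rho_U v : rho (mk2 1 0 N 1) v = v.
Proof.
have [r1 rM _ _] := hrho.
have sU : SL2Z (mk2 1 0 N 1) by apply/SL2Z_mk2; lia.
have sT : SL2Z (mk2 1 N 0 1) by apply/SL2Z_mk2; lia.
have E : mk2 1 0 N 1 * (matS * mk2 1 N 0 1) = matS.
  by rewrite matS_mk2 !mk2_mul; congr mk2; lia.
have h w : rho (mk2 1 0 N 1) (rho matS w) = rho matS w.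
  rewrite -{2}E (rM _ _ sU (SL2ZM SL2Z_S sT)) (rM _ _ SL2Z_S sT).
  by rewrite rho_TN.
rewrite -{1 2}[v]r1 -(mulSLV SL2Z_S) !(rM _ _ SL2Z_S (SL2ZV SL2Z_S)).
by rewrite h.
Qed.

Lemma chi_neq0 g M : chi R g M != 0.
Proof. exact: eeQ_neq0. Qed.

(** The upper right entry of A B is a b' + b d', where a and d' are 1 modulo N, and N Q(g) is
    integral. *)
Lemma chiM g A B : Gamma1 N A -> Gamma1 N B -> chi R g (A * B) = chi R g A * chi R g B.
Proof.
rewrite (mk2P A) (mk2P B) mk2_mul /chi -eeQD.
move: (A 0 0) (A 0 1) (A 1 0) (A 1 1) (B 0 0) (B 0 1) (B 1 0) (B 1 1) => a b c d a' b' c' d'.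
move=> /Gamma1_mk2[_ /modzE[x xE] _ _] /Gamma1_mk2[_ _ /modzE[y yE] _].
have [_ -> _ _] := mk2E a b c d; have [_ -> _ _] := mk2E a' b' c' d'.
have [_ -> _ _] := mk2E (a * a' + b * c') (a * b' + b * d') (c * a' + d * c') (c * b' + d * d').
apply: eeQ_eqmod1; rewrite /eqmod1 xE yE.
have -> : ((1 + x * N) * b' + b * (1 + y * N))%:~R * discQ g -
  (b%:~R * discQ g + b'%:~R * discQ g) = (x * b' + b * y)%:~R * (N%:R * discQ g).
  by rewrite !(intrD, intrM); ring.
by rewrite rpredM ?rpred_int.
Qed.

Lemma rho_chi g A : Gamma1 N A -> rho A (basis_elt R g) = chi R g A *: basis_elt R g.
Proof.
have [r1 rM rT _] := hrho.
have GT : Gamma1 N (mk2 1 1 0 1) by apply/Gamma1_mk2.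
have GU : Gamma1 N (mk2 1 0 N 1) by apply/Gamma1_mk2; split => //; apply/modzE; exists 1; lia.
have cT : chi R g (mk2 1 1 0 1) = eeQ (discQ g) by rewrite /chi mxE mul1r.
have cU : chi R g (mk2 1 0 N 1) = 1 by rewrite /chi mxE mul0r eeQ0.
move: A; apply: (Gamma1_ind N13) => [|A hA|A hA].
- by rewrite r1 /chi -mk2_1 mxE mul0r eeQ0 scale1r.
- rewrite (rM _ _ (Gamma1_SL2Z hA) (Gamma1_SL2Z GT)) (chiM _ hA GT) cT -matT_mk2 rT.
  rewrite linearZ /= mulrC -scalerA; split=> [|->//].
  by move/(scalerI (eeQ_neq0 _)).
- rewrite (rM _ _ (Gamma1_SL2Z hA) (Gamma1_SL2Z GU)) (chiM _ hA GU) cU mulr1.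
  by rewrite rho_U.
Qed.

End Character.
End WeilRepresentation.

(** * q-expansions *)

Section QExpansions.
Variable R : realType.
Local Notation C := (Cplx R).
Implicit Types (a b : nat -> C) (t q : C) (f : C -> C) (phi psi : C -> C).

Lemma disc_convZ (c : C) b : disc_conv b -> disc_conv (fun n => c * b n).
Proof.
move=> db r r01; apply: bounded_sums_le (bounded_sumsZ (normc_ge0 c) (db r r01)) => n.
by rewrite normcM mulrA.
Qed.

Lemma disc_convD a b : disc_conv a -> disc_conv b -> disc_conv (fun n => a n + b n).
Proof.
move=> da db r r01; have [A HA] := da r r01; have [B HB] := db r r01.
exists (A + B) => n; apply: le_trans (lerD (HA n) (HB n)); rewrite -big_split /=.
apply: ler_sum => i _; rewrite -mulrDl ler_wpM2r ?exprn_ge0 //; first by case/andP: r01.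
exact: normcD.
Qed.

Lemma disc_conv_dominated a b : (forall n, normc (a n) <= normc (b n)) -> disc_conv b -> disc_conv a.
Proof.
move=> ab db r r01; apply: bounded_sums_le (db r r01) => n.
by rewrite ler_wpM2r ?exprn_ge0 //; case/andP: r01.
Qed.

Lemma pserZ (c : C) b q : disc_conv b -> normc q < 1 -> pser (fun n => c * b n) q = c * pser b q.
Proof.
move=> db q1; have q01 : 0 <= normc q < 1 by rewrite normc_ge0.
rewrite /pser -(csumZ c _ (db _ q01)); last by move=> n; rewrite normcM normcX.
by apply: eq_csum => n; rewrite mulrA.
Qed.

Lemma pserD a b q : disc_conv a -> disc_conv b -> normc q < 1 ->
  pser (fun n => a n + b n) q = pser a q + pser b q.
Proof.
move=> da db q1; have q01 : 0 <= normc q < 1 by rewrite normc_ge0.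
rewrite /pser -(csumD _ (da _ q01) _ (db _ q01)); try by move=> n; rewrite normcM normcX.
by apply: eq_csum => n; rewrite mulrDl.
Qed.

(** Coefficients of the series b(q^d). *)
Definition spread (d : nat) b (n : nat) : C := if (d %| n)%N then b (n %/ d)%N else 0.

Lemma sum_progression (A : nmodType) (F : nat -> A) (d j0 n : nat) : (j0 < d)%N ->
  (forall j, (j %% d)%N != j0 -> F j = 0) ->
  \sum_(j < d * n) F j = \sum_(j < n) F (j0 + d * j)%N.
Proof.
move=> jd F0; elim: n => [|n IH]; first by rewrite muln0 !big_ord0.
rewrite mulnS addnC big_split_ord /= IH big_ord_recr /=; congr (_ + _).
rewrite (bigD1 (Ordinal jd)) //= big1 ?addr0 1?addnC // => i ij.
apply: F0; rewrite mulnC modnMDl modn_small; [by move: ij; rewrite -val_eqE|exact: ltn_ord].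
Qed.

Lemma spread_sum d b q n : (0 < d)%N ->
  \sum_(j < d * n) spread d b j * q ^+ j = \sum_(j < n) b j * (q ^+ d) ^+ j.
Proof.
move=> d0; rewrite (@sum_progression _ (fun j => spread d b j * q ^+ j) d 0) //.
  by apply: eq_bigr => j _; rewrite add0n /spread dvdn_mulr // mulKn // exprM.
by move=> j jd; rewrite /spread /dvdn (negPf jd) mul0r.
Qed.

Lemma disc_conv_spread d b : (0 < d)%N -> disc_conv b -> disc_conv (spread d b).
Proof.
move=> d0 db r r01; have [r0 r1] := andP r01.
have rd : 0 <= r ^+ d < 1 by rewrite exprn_ge0 // exprn_ilt1 // -lt0n.
have [B HB] := db _ rd; exists B => n; apply: le_trans (HB n).
have -> : \sum_(i < n) normc (b i) * (r ^+ d) ^+ i =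
    \sum_(j < d * n) normc (spread d b j) * r ^+ j.
  rewrite (@sum_progression _ (fun j => normc (spread d b j) * r ^+ j) d 0) //.
    by apply: eq_bigr => j _; rewrite add0n /spread dvdn_mulr // mulKn // exprM.
  by move=> j jd; rewrite /spread /dvdn (negPf jd) normc0 mul0r.
have nd : (n <= d * n)%N by rewrite leq_pmull.
rewrite -(subnKC nd) big_split_ord /= lerDl; apply: sumr_ge0 => i _.
by rewrite mulr_ge0 ?normc_ge0 ?exprn_ge0.
Qed.

Lemma cvC_subseq (u : nat -> C) (l : C) d : (0 < d)%N -> cvC \oo u l ->
  cvC \oo (fun n => u (d * n)%N) l.
Proof.
move=> d0 [h]; split; apply: cvg_comp h.
move=> P [A _ HA]; exists A => // n /= An; apply: HA; rewrite /= (leq_trans An) //.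
by rewrite leq_pmull.
Qed.

Lemma pser_spread d b q : (0 < d)%N -> disc_conv b -> normc q < 1 ->
  pser (spread d b) q = pser b (q ^+ d).
Proof.
move=> d0 db q1; have qd : normc (q ^+ d) < 1 by rewrite normcX exprn_ilt1 ?normc_ge0 // -lt0n.
pose proof (cvC_subseq d0 (pser_cvg (disc_conv_spread d0 db) q1)) as H.
pose proof (pser_cvg db qd) as H'.
refine (limC_unique H _).
by apply: cvC_near H'; exists 0%N => // n _; rewrite /psum spread_sum.
Qed.

Definition analytic (c : C) phi : Prop :=
  exists b, [/\ disc_conv b, b 0%N = c & forall q, normc q < 1 -> phi q = pser b q].

Lemma analyticM c d phi psi : analytic c phi -> analytic d psi ->
  analytic (c * d) (fun q => phi q * psi q).
Proof.
move=> [a [da a0 ha]] [b [db b0 hb]]; exists (conv a b); split; first exact: disc_conv_conv.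
  by rewrite /conv big_ord1 a0 b0.
by move=> q q1; rewrite pser_conv // -ha // -hb.
Qed.

Lemma analytic1 : analytic 1 (fun=> 1).
Proof.
exists (delta C 0); split=> [||q _]; last by rewrite pser_delta0.
  apply: disc_conv_bounded1 => n; rewrite /delta; case: eqP => _; rewrite ?normc1 ?normc0 //.
by rewrite /delta eqxx.
Qed.

Lemma analyticX phi n : analytic 1 phi -> analytic 1 (fun q => phi q ^+ n).
Proof.
move=> h; elim: n => [|n IH]; first exact: analytic1.
by have := analyticM h IH; rewrite mul1r; under boolp.eq_fun do rewrite -exprS.
Qed.

Lemma analytic_pow c phi d : (0 < d)%N -> analytic c phi -> analytic c (fun q => phi (q ^+ d)).
Proof.
move=> d0 [b [db b0 hb]]; exists (spread d b); split; first exact: disc_conv_spread.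
  by rewrite /spread dvdn0 div0n.
by move=> q q1; rewrite pser_spread // hb // normcX exprn_ilt1 ?normc_ge0 // -lt0n.
Qed.

Lemma analytic_euler : analytic 1 (@euler_fun R).
Proof.
exists (@pentagonal R); split => //; exact: disc_conv_pentagonal.
Qed.

Lemma analytic_eulerV : analytic 1 (fun q => (euler_fun q)^-1).
Proof.
exists (@partition R); split; first exact: disc_conv_partition.
  by rewrite /partition /partsC /= /delta rmorph1.
move=> q q1; have := partition_euler q1; have := euler_fun_neq0 q1.
by move=> e0 h; apply: (mulIf e0); rewrite h mulVf.
Qed.

Section QExp.
Variable N : nat.
Hypothesis N0 : (0 < N)%N.
Local Notation NC := (N%:R : C).

Let NC0 : NC != 0. Proof. by rewrite pnatr_eq0 -lt0n. Qed.

Lemma im_divN t : im (t / NC) = im t / N%:R.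
Proof.
have -> : NC^-1 = (N%:R^-1 : R)%:C by rewrite fmorphV rmorph_nat.
by rewrite mulrC imM /= mul0r addr0 mulrC.
Qed.

Lemma normc_root t : 0 < im t -> normc (ee (t / NC)) < 1.
Proof. by move=> t0; apply: normc_ee_lt1; rewrite im_divN divr_gt0 // ltr0n. Qed.

(* [f] is the sum of the [b j * e((j - 1) t / N)]. *)
Definition qexp b f : Prop :=
  disc_conv b /\ forall t, 0 < im t -> f t = ee (- (t / NC)) * pser b (ee (t / NC)).

(** The offset places the pole e(-t/N) at index 0 and the constant term at index 1. *)
Definition qidx (j : nat) : rat := (j%:R - 1) / N%:R.

Lemma ee_qidx j t : ee (ratr (qidx j) * t) = ee (- (t / NC)) * ee (t / NC) ^+ j.
Proof.
rewrite -eeMn -eeD; congr ee; rewrite /qidx rmorphM rmorphB /= fmorphV !ratr_nat rmorph1.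
by field.
Qed.

Lemma qexpZ (c : C) b f : qexp b f -> qexp (fun j => c * b j) (fun t => c * f t).
Proof.
move=> [db hb]; split; first exact: disc_convZ.
by move=> t t0; rewrite hb // pserZ // ?normc_root // mulrCA.
Qed.

Lemma qexpD a b f f' : qexp a f -> qexp b f' -> qexp (fun j => a j + b j) (fun t => f t + f' t).
Proof.
move=> [da ha] [db hb]; split; first exact: disc_convD.
by move=> t t0; rewrite ha // hb // pserD // ?normc_root // mulrDr.
Qed.

Lemma qexp0 : qexp (fun=> 0) (fun=> 0).
Proof.
split=> [|t t0]; first by apply: disc_conv_bounded1 => n; rewrite normc0 ler01.
by rewrite /pser (@csum_fin _ _ 0) /psum ?big_ord0 ?mulr0 // => i _; rewrite mul0r.
Qed.

Lemma qexp_sum (I : eqType) (r : seq I) (b : I -> nat -> C) (f : I -> C -> C) :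
  (forall i, i \in r -> qexp (b i) (f i)) ->
  qexp (fun j => \sum_(i <- r) b i j) (fun t => \sum_(i <- r) f i t).
Proof.
elim: r => [_|i r IH h].
  under boolp.eq_fun do rewrite big_nil; under [X in qexp _ X]boolp.eq_fun do rewrite big_nil.
  exact: qexp0.
under boolp.eq_fun do rewrite big_cons; under [X in qexp _ X]boolp.eq_fun do rewrite big_cons.
apply: qexpD; first by apply: h; rewrite mem_head.
by apply: IH => k kr; apply: h; rewrite in_cons kr orbT.
Qed.

Lemma qexp_eq b f f' : (forall t, 0 < im t -> f t = f' t) -> qexp b f -> qexp b f'.
Proof. by move=> e [db hb]; split=> // t t0; rewrite -e // hb. Qed.

Lemma eeQ_qidx j : eeQ R (qidx j) = ee (- NC^-1) * ee NC^-1 ^+ j.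
Proof. by have := ee_qidx j 1; rewrite mulr1 mul1r. Qed.

Lemma qexp_shift b f : qexp b f -> qexp (fun j => eeQ R (qidx j) * b j) (fun t => f (t + 1)).
Proof.
move=> [db hb]; split.
  by apply: disc_conv_dominated db => n; rewrite normcM normc_eeQ mul1r.
move=> t t0; have t1 : 0 < im (t + 1) by rewrite imD /= addr0.
have e1 : (t + 1) / NC = t / NC + NC^-1 by rewrite mulrDl mul1r.
rewrite (hb _ t1) e1 opprD (eeD (- (t / NC)) (- NC^-1)) (eeD (t / NC) NC^-1) -mulrA.
congr (_ * _); have db' : disc_conv (fun j => ee NC^-1 ^+ j * b j).
  apply: disc_conv_dominated db => n; rewrite normcM normcX -(mul1r NC^-1) normc_ee.
  by rewrite im_divN /= mul0r mulr0 oppr0 expR0 expr1n mul1r.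
have -> : (fun j => eeQ R (qidx j) * b j) =
    (fun j => ee (- NC^-1) * (ee NC^-1 ^+ j * b j)).
  by apply/funext => j; rewrite eeQ_qidx mulrA.
refine (etrans _ (esym (pserZ _ db' (normc_root t0)))).
apply: (congr1 (fun z => ee (- NC^-1) * z)).
apply: eq_csum => j; rewrite exprMn.
by move: (ee (t / _) ^+ j) (ee _ ^+ j) => u v; ring.
Qed.

(* Averaging [eeQ (- q r) * f (t + r)] over [r < N] keeps the exponents in [q + Z]. *)
Lemma qexp_filter b f (q : rat) : qexp b f -> N%:R * q \is a Num.int ->
  (forall t, 0 < im t -> f (t + 1) = eeQ R q * f t) ->
  qexp (fun j => if qidx j - q \is a Num.int then b j else 0) f.
Proof.
move=> hb hq hf.
have hr (r : nat) : qexp (fun j => eeQ R (qidx j - q) ^+ r * b j) f.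
  elim: r => [|r IH].
    by under boolp.eq_fun do rewrite expr0 mul1r.
  have := qexpZ (eeQ R (- q)) (qexp_shift IH).
  have -> : (fun j => eeQ R (- q) * (eeQ R (qidx j) * (eeQ R (qidx j - q) ^+ r * b j))) =
      (fun j => eeQ R (qidx j - q) ^+ r.+1 * b j).
    by apply/funext => j; rewrite exprS eeQD !mulrA [eeQ R (- q) * _]mulrC.
  apply: qexp_eq => t t0; rewrite hf // eeQN mulKf //; exact: eeQ_neq0.
have := qexpZ NC^-1 (@qexp_sum nat (iota 0 N) _ _ (fun r _ => hr r)).
set b1 := (X in qexp X _); set f1 := (X in qexp _ X).
have -> : f1 = f.
  apply/funext => t; rewrite /f1 big_const_seq count_predT size_iota iter_addr addr0.
  by rewrite -[f t *+ N]mulr_natl mulKf.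
suff -> : b1 = (fun j => if qidx j - q \is a Num.int then b j else 0) by [].
apply/funext => j; rewrite /b1 -mulr_suml.
have hz : eeQ R (qidx j - q) ^+ N = 1.
  rewrite -eeQMn; apply: eeQ_int; rewrite mulrBr rpredB // /qidx mulrC divfK ?pnatr_eq0 -?lt0n //.
  by rewrite rpredB ?rpred_nat ?rpred1.
case: ifPn => [h|h].
  rewrite (eeQ_int R h); under eq_bigr do rewrite expr1n.
  by rewrite big_const_seq count_predT size_iota iter_addr addr0 mulrA mulVf ?mul1r.
have z1 : eeQ R (qidx j - q) - 1 != 0 by rewrite subr_eq0; apply: contra h => /eqP/eeQ_eq1.
suff -> : \sum_(r <- iota 0 N) eeQ R (qidx j - q) ^+ r = 0 by rewrite mul0r mulr0.
apply: (mulfI z1); rewrite mulr0.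
have -> : \sum_(r <- iota 0 N) eeQ R (qidx j - q) ^+ r = \sum_(r < N) eeQ R (qidx j - q) ^+ r.
  by rewrite -(big_mkord xpredT (fun r => eeQ R (qidx j - q) ^+ r)) /index_iota subn0.
by rewrite -subrX1 hz subrr.
Qed.

(** The inverse of [qidx]: the exponent m sits at index N m + 1. *)
Definition qcoef b (m : rat) : C :=
  let z := N%:R * m + 1 in if z \is a Num.nat then b (Num.truncn z) else 0.

Lemma qcoefE b j : qcoef b (qidx j) = b j.
Proof.
have e : N%:R * qidx j + 1 = j%:R.
  by rewrite /qidx mulrC divfK ?subrK // pnatr_eq0 -lt0n.
by rewrite /qcoef e rpred_nat natrK.
Qed.

Lemma qcoefP b m : qcoef b m != 0 -> exists2 j, m = qidx j & b j != 0.
Proof.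
rewrite /qcoef; case: ifPn => [/natrP[j jE]|]; last by rewrite eqxx.
rewrite jE natrK => bj; exists j => //; rewrite /qidx -jE addrK mulrC mulKf //.
by rewrite pnatr_eq0 -lt0n.
Qed.

Lemma qcoef0 b : qcoef b 0 = b 1%N.
Proof. by rewrite -(qcoefE b 1) /qidx subrr mul0r. Qed.

Lemma qcoef_neg b m : m < 0 -> qcoef b m = if m == - 1 / N%:R then b 0%N else 0.
Proof.
move=> m0; have q0 : qidx 0 = - 1 / N%:R by rewrite /qidx sub0r.
rewrite -q0; case: eqP => [->|h]; first exact: qcoefE.
apply/eqP; apply: contrapT => /negP/qcoefP[[|j] mj _]; first by rewrite mj in h.
by move: m0; rewrite mj /qidx ltNge divr_ge0 // subr_ge0 ler1n.
Qed.

Lemma qexp_psum_cvg b f t : qexp b f -> 0 < im t ->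
  cvC \oo (fun n => \sum_(j < n) b j * ee (ratr (qidx j) * t)) (f t).
Proof.
move=> [db hb] t0; rewrite hb //.
pose proof (cvgCM (cvgC_cst (F := \oo) (ee (- (t / NC)))) (pser_cvg db (normc_root t0))) as H.
apply: cvC_near H; exists 0%N => // n _; rewrite /psum mulr_sumr; apply: eq_bigr => j _.
by rewrite ee_qidx mulrCA.
Qed.

Lemma qexp_fourier b f : qexp b f -> fourier_expansion N 0 (qcoef b) f.
Proof.
move=> hb; have NQ : (N%:R : rat) != 0 by rewrite pnatr_eq0 -lt0n.
split=> [m /qcoefP[j -> _]|].
  by rewrite subr0 /qidx divfK // rpredB ?rpred_nat ?rpred1.
exists (-1); have idxE j : 0 + ((-1)%:~R + j%:R) / N%:R = qidx j.
  by rewrite add0r /qidx addrC.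
split=> [m|t t0].
  rewrite idxE => mi; apply/eqP; apply: contrapT => /negP/qcoefP[j mj _].
  by move: mi; rewrite mj /qidx ltNge ler_pM2r ?invr_gt0 ?ltr0n // lerD2r ler0n.
have [h] := qexp_psum_cvg hb t0; apply: cvg_trans h; apply: near_eq_cvg.
exists 0%N => // n _; rewrite big_mkord; apply: eq_bigr => j _.
by rewrite idxE qcoefE.
Qed.

Lemma qexp_fourier1 b f (q : rat) : qexp b f -> N%:R * q \is a Num.int ->
  (forall j, b j != 0 -> qidx j - q \is a Num.int) -> fourier_expansion 1 q (qcoef b) f.
Proof.
move=> hb /intrP[m mE] bq; have NQ : (N%:R : rat) != 0 by rewrite pnatr_eq0 -lt0n.
split=> [p /qcoefP[j -> /bq]|]; first by rewrite mulr1.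
(* With q = m / N, the indices of nonzero coefficients are congruent to m + 1 modulo N. [j0] is the
   least index in this class, and q + n0 = (j0 - 1) / N. *)
set n0 : int := - ((m + 1) %/ N)%Z; exists n0.
pose j0 := `|((m + 1) %% N)%Z|%N.
have NZ : N%:Z != 0 by rewrite eqz_nat -lt0n.
have j0E : j0%:Z = ((m + 1) %% N)%Z by rewrite /j0 gez0_abs // modz_ge0.
have j0N : (j0 < N)%N by rewrite -ltz_nat j0E -[ltRHS]gez0_abs // ltz_mod.
have qE : q = m%:~R / N%:R by rewrite -mE mulrC mulKf.
have idxE j : q + (n0%:~R + j%:R) / 1 = qidx (j0 + N * j).
  have e : (m + 1)%:~R = (- n0)%:~R * N%:R + j0%:R :> rat.
    by rewrite -[j0%:R]/(j0%:Z%:~R) j0E -[N%:R]/(N%:Z%:~R) -intrM -intrD /n0 opprK -divz_eq.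
  move: e; rewrite intrD intrN => e; rewrite /qidx qE natrD natrM.
  have -> : j0%:R = m%:~R + 1 + n0%:~R * N%:R :> rat by rewrite e; ring.
  by field.
have jmod j : b j != 0 -> (j %% N)%N = j0.
  move=> /bq /intrP[z zE]; have : (j%:Z = m + 1 + z * N)%R.
    apply/eqP; rewrite -(eqr_int rat) !intrD intrM -zE /qidx qE; apply/eqP.
    by rewrite -[j%:Z%:~R]/(j%:R : rat) -[N%:Z%:~R]/(N%:R : rat); field.
  move=> jE; apply/eqP; rewrite -eqz_nat j0E -modz_nat jE addrC modzMDl.
  by [].
split=> [p|t t0].
  rewrite idxE => pi; apply/eqP; apply: contrapT => /negP/qcoefP[j pj /jmod jm].
  move: pi; rewrite pj /qidx muln0 addn0 ltNge ler_pM2r ?invr_gt0 ?ltr0n // lerD2r ler_nat.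
  by rewrite -jm leq_mod.
pose proof (cvC_subseq N0 (qexp_psum_cvg hb t0)) as [h]; apply: cvg_trans h.
apply: near_eq_cvg; exists 0%N => // n _; rewrite big_mkord.
rewrite (@sum_progression _ (fun j => b j * ee (ratr (qidx j) * t)) N j0) //.
  by apply: eq_bigr => j _; rewrite idxE qcoefE.
move=> j jm; have [->|/jmod e] := eqVneq (b j) 0; first by rewrite mul0r.
by rewrite e eqxx in jm.
Qed.

End QExp.
End QExpansions.

(** * Coefficient estimates, and power series from Fourier expansions *)

Section Uniqueness.
Variable R : realType.
Local Notation C := (Cplx R).
Implicit Types (a b : nat -> C) (t q : C) (f : C -> C).

Lemma pser_sum (M : nat) (a : nat -> nat -> C) q : (forall s, disc_conv (a s)) -> normc q < 1 ->
  disc_conv (fun j => \sum_(s < M) a s j) /\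
  \sum_(s < M) pser (a s) q = pser (fun j => \sum_(s < M) a s j) q.
Proof.
move=> da q1; elim: M => [|M [IHd IH]].
  have -> : (fun j => \sum_(s < 0) a s j) = (fun=> 0).
    by apply/funext => j; rewrite big_ord0.
  split; first by apply: disc_conv_bounded1 => n; rewrite normc0 ler01.
  by rewrite big_ord0 /pser (@csum_fin _ _ 0) /psum ?big_ord0 // => i _; rewrite mul0r.
have -> : (fun j => \sum_(s < M.+1) a s j) = (fun j => \sum_(s < M) a s j + a M j).
  by apply/funext => j; rewrite big_ord_recr.
split; first exact: disc_convD.
by rewrite big_ord_recr /= IH pserD.
Qed.

Lemma ee_nat_quotient_eq1 (j m M : nat) : (j < M)%N -> (m < M)%N ->
  (ee (M%:R^-1 : C) ^+ j = ee (M%:R^-1 : C) ^+ m) -> j = m.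
Proof.
wlog jm : j m / (m <= j)%N.
  move=> W jM mM e; have [h|/ltnW h] := leqP m j; first exact: W.
  by apply/esym; exact: W.
move=> jM mM e; have M0 : (0 < M)%N by exact: leq_trans jM.
have : eeQ R ((j - m)%N%:R / M%:R) = 1.
  rewrite /eeQ rmorphM fmorphV /= !ratr_nat eeMn; apply: (mulfI (expf_neq0 m (ee_neq0 (M%:R^-1 : C)))).
  by rewrite -exprD subnKC // mulr1; exact: e.
move/eeQ_eq1 => /intrP[z zE].
have h : ((j - m)%N%:Z = z * M)%R.
  apply/eqP; rewrite -(eqr_int rat) intrM -zE -[_%:Z%:~R]/(_%:R : rat).
  by rewrite -[M%:Z%:~R]/(M%:R : rat) divfK // pnatr_eq0 -lt0n.
have : (j - m < M)%N by rewrite (leq_ltn_trans (leq_subr _ _)).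
have z0 : z = 0 by nia.
by move: h; rewrite z0; lia.
Qed.

(* Averaging over [M]-th roots of unity leaves the coefficients congruent to [m] modulo [M],
   and those beyond [M] are negligible. *)
Lemma cauchy_estimate b t (B : R) m : disc_conv b -> 0 < im t ->
  (forall x : R, normc (pser b (ee (t + x%:C))) <= B) -> normc (b m) * normc (ee t) ^+ m <= B.
Proof.
move=> db t0 hB; set r := normc (ee t); have r1 : r < 1 by exact: normc_ee_lt1.
have r01 : 0 <= r < 1 by rewrite /r normc_ge0.
apply/ler_addgt0Pr => e e0.
have [N HN] := bounded_sums_tail (fun n => mulr_ge0 (normc_ge0 _) (exprn_ge0 n (normc_ge0 (ee t)))) (db r r01) e0.
(* Beyond N the tail is at most e. As M exceeds both N and m, the only index below M congruent to m
   is m itself. *)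
pose M := (N + m).+1; pose z : C := ee M%:R^-1.
have M0 : (M%:R : C) != 0 by rewrite pnatr_eq0.
pose a s j : C := (z ^+ j / z ^+ m) ^+ s * b j.
have nz : normc z = 1.
  rewrite /z normc_ee (_ : im _ = 0) ?mulr0 ?oppr0 ?expR0 //.
  by rewrite -(mul1r _^-1) im_divN // /= mul0r.
have da s : disc_conv (a s).
  by apply: disc_conv_dominated db => j; rewrite normcM !(normcX, normcM, normcV) nz !expr1n invr1 mulr1 expr1n mul1r.
have [dX X] := @pser_sum M a _ da r1.
have hs s : normc (pser (a s) (ee t)) <= B.
  have ws : z ^+ s * ee t = ee (t + (s%:R / M%:R : R)%:C).
    rewrite -eeMn -eeD addrC; congr (ee (_ + _)).
    by rewrite rmorphM fmorphV !rmorph_nat.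
  have db' : disc_conv (fun j => z ^+ s ^+ j * b j).
    by apply: disc_conv_dominated db => j; rewrite normcM !normcX nz !expr1n mul1r.
  suff -> : pser (a s) (ee t) = (z ^+ m ^+ s)^-1 * pser b (z ^+ s * ee t).
    by rewrite normcM normcV !normcX nz !expr1n invr1 mul1r ws.
  transitivity ((z ^+ m ^+ s)^-1 * pser (fun j => z ^+ s ^+ j * b j) (ee t)).
    refine (etrans _ (pserZ _ db' r1)); apply: eq_csum => j; congr (_ * _).
    by rewrite /a expr_div_n -!exprM [(s * j)%N]mulnC mulrA [_^-1 * _]mulrC.
  by apply: (congr1 (fun w => (z ^+ m ^+ s)^-1 * w)); apply: eq_csum => j;
     rewrite exprMn mulrAC [_ * b j]mulrC mulrA.
pose c j : C := M%:R^-1 * \sum_(s < M) a s j.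
have dc : disc_conv c by exact: disc_convZ.
have cE j : c j = if z ^+ j == z ^+ m then b j else 0.
  rewrite /c /a -mulr_suml; have zm : z ^+ m != 0 by rewrite expf_neq0 ?ee_neq0.
  have zM : z ^+ M = 1 by rewrite -eeMn mulfV // ee1.
  case: eqP => [->|/eqP h].
    under eq_bigr do rewrite mulfV // expr1n.
    by rewrite sumr_const card_ord mulrA mulVf ?mul1r.
  have w1 : z ^+ j / z ^+ m - 1 != 0.
    by rewrite subr_eq0; apply: contra h => /eqP h; rewrite -[z ^+ j](divfK zm) h mul1r.
  suff -> : \sum_(s < M) (z ^+ j / z ^+ m) ^+ s = 0 by rewrite mul0r mulr0.
  apply: (mulfI w1); rewrite mulr0 -subrX1 expr_div_n -!exprM !(mulnC _ M) !exprM zM !expr1n.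
  by rewrite divr1 subrr.
have nX : normc (pser c (ee t)) <= B.
  rewrite (pserZ _ dX r1) -X normcM normcV normc_nat.
  rewrite ler_pdivrMl ?ltr0n //; apply: le_trans (normc_sum _ _ _) _.
  have -> : M%:R * B = \sum_(s < M) B by rewrite sumr_const card_ord mulr_natl.
  by apply: ler_sum => s _; exact: hs.
have cb j : normc (c j) <= normc (b j) by rewrite cE; case: ifP; rewrite ?normc0 ?normc_ge0.
have pc : psum (fun j => c j * ee t ^+ j) M = b m * ee t ^+ m.
  have mM : (m < M)%N by rewrite ltnS leq_addl.
  rewrite /psum (bigD1 (Ordinal mM)) //= cE eqxx big1 ?addr0 // => j jm.
  rewrite cE; case: eqP => [h|]; last by rewrite mul0r.
  by case/negP: jm; rewrite -val_eqE /=; apply/eqP/(ee_nat_quotient_eq1 (ltn_ord j) mM).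
have tail n : \sum_(i < n) normc (b (M + i)%N) * normc (ee t) ^+ (M + i) <= e.
  have := HN (m.+1 + n)%N; rewrite big_split_ord /=; apply: le_trans.
  have -> : M = (N + m.+1)%N by rewrite addnS.
  rewrite -[leLHS]add0r; apply: lerD; last by apply: ler_sum => i _; rewrite addnA.
  by apply: sumr_ge0 => i _; rewrite mulr_ge0 ?exprn_ge0 ?normc_ge0.
have dom : dominated_by (fun j => c j * ee t ^+ j) (fun j => normc (b j) * normc (ee t) ^+ j).
  by move=> j; rewrite normcM normcX ler_wpM2r ?exprn_ge0 ?normc_ge0.
have := csum_tail dom (db r r01) tail; rewrite -/(pser c _) pc => h.
rewrite -normcX -normcM.
have -> : b m * ee t ^+ m = pser c (ee t) - (pser c (ee t) - b m * ee t ^+ m) by rewrite subKr.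
by apply: le_trans (normcB _ _) _; rewrite lerD.
Qed.

(** Abel's lemma: boundedness at s, halfway between r and 1, gives geometric decay at r. *)
Lemma disc_conv_of_bounded b : (forall r : R, 0 < r < 1 -> exists B, forall j, normc (b j) * r ^+ j <= B) ->
  disc_conv b.
Proof.
move=> hb r /andP[r0 r1]; pose s := (1 + r) / 2; have s01 : 0 < s < 1 by rewrite /s; lra.
have [B HB] := hb s s01; have [s0 s1] := andP s01.
have B0 : 0 <= B by apply: le_trans (HB 0%N); rewrite mulr_ge0 ?normc_ge0 ?exprn_ge0 // ltW.
have rs : 0 <= r / s < 1.
  rewrite divr_ge0 ?(ltW s0) //= ltr_pdivrMr // mul1r /s; lra.
apply: bounded_sums_le (bounded_sumsZ B0 (bounded_geometric rs)) => j.
rewrite expr_div_n mulrA ler_pdivlMr ?exprn_gt0 // mulrAC ler_wpM2r ?exprn_ge0 //.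
Qed.

(** A [fourier_expansion] only asserts pointwise convergence. On the imaginary axis this bounds the
    terms, and Abel's lemma turns the bound into absolute convergence. *)
Lemma fourier_pser (q : rat) (c : rat -> C) f : fourier_expansion 1 q c f ->
  exists n0 : int, let e := q + n0%:~R in [/\ disc_conv (fun j => c (e + j%:R)),
    (forall m, c m != 0 -> exists j : nat, m = e + j%:R) &
    forall t, 0 < im t -> f t = ee (ratr e * t) * pser (fun j => c (e + j%:R)) (ee t)].
Proof.
move=> [cq [n0 [c0 cf]]]; exists n0; set e := q + n0%:~R; cbv zeta.
have idxE j : q + (n0%:~R + j%:R) / 1%:R = e + j%:R by rewrite divr1 addrA.
have term t j : c (e + j%:R) * ee (ratr (e + j%:R) * t) = ee (ratr e * t) * (c (e + j%:R) * ee t ^+ j).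
  by rewrite rmorphD /= ratr_nat mulrDl eeD eeMn mulrCA.
have cv t : 0 < im t -> cvC \oo (fun n => ee (ratr e * t) * psum (fun j => c (e + j%:R) * ee t ^+ j) n) (f t).
  move=> t0; have h := cf t t0; split; apply: cvg_trans h; apply: near_eq_cvg.
  exists 0%N => // n _; rewrite /psum mulr_sumr big_mkord; apply: eq_bigr => j _.
  by rewrite idxE term.
have cv' t : 0 < im t -> cvC \oo (psum (fun j => c (e + j%:R) * ee t ^+ j)) ((ee (ratr e * t))^-1 * f t).
  move=> t0; pose proof (cvgCM (cvgC_cst (F := \oo) (ee (ratr e * t))^-1) (cv t t0)) as H.
  apply: cvC_near H; exists 0%N => // n _; rewrite mulKf //; exact: ee_neq0.
have db : disc_conv (fun j => c (e + j%:R)).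
  apply: disc_conv_of_bounded => r /andP[r0 r1].
  (* The point of the imaginary axis at which |e(t)| = r. *)
  pose y := - ln r / (2 * pi); pose t : C := (0 +i* y)%C.
  have p0 : 0 < 2 * pi :> R by rewrite mulr_gt0 ?pi_gt0.
  have y0 : 0 < im t by rewrite /= divr_gt0 // oppr_gt0 ln_lt0 // r0.
  have er : normc (ee t) = r.
    by rewrite normc_ee /= /y mulrC divfK ?gt_eqF // opprK lnK.
  have := cv' t y0; move: (_^-1 * f t) => l; set u := fun j => _ => /cvgCP/(_ 1 ltr01) [M _ HM].
  have hu j : normc (c (e + j%:R)) * r ^+ j = normc (u j) by rewrite normcM normcX er.
  exists (2 + \sum_(j < M) normc (u j)) => j; rewrite hu.
  have S0 : 0 <= \sum_(j < M) normc (u j) by apply: sumr_ge0 => i _; exact: normc_ge0.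
  have [jM|Mj] := ltnP j M.
    rewrite (bigD1 (Ordinal jM)) //= addrCA lerDl addr_ge0 //.
    by apply: sumr_ge0 => i _; exact: normc_ge0.
  have h1 := HM j Mj; have h2 := HM j.+1 (leqW Mj).
  have -> : u j = (l - psum u j) - (l - psum u j.+1).
    by rewrite /psum big_ord_recr /=; ring.
  apply: le_trans (normcB _ _) _; rewrite /= in h1 h2.
  by rewrite -[leLHS]addr0 lerD // (_ : 2 = 1 + 1) // lerD // ltW.
split=> // [m /[dup] m0 /cq /intrP [z]|t t0].
  rewrite mulr1 => zE; have mE : m = q + z%:~R by rewrite -zE addrC subrK.
  have : ~ m < q + (n0%:~R + 0%:R) / 1%:R by move=> /c0 h; rewrite h eqxx in m0.
  rewrite idxE addr0 mE /e ltrD2l ltr_int => /negP; rewrite -leNgt => h.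
  exists `|z - n0|%N; rewrite natr_absz ger0_norm ?subr_ge0 // intrB.
  by rewrite -addrA addrC addrA; ring.
have tl := normc_ee_lt1 t0.
pose proof (cvgCM (cvgC_cst (F := \oo) (ee (ratr e * t))) (pser_cvg db tl)) as H.
exact: (limC_unique (cv t t0) H).
Qed.

Lemma pser_delta (k : nat) q : pser (delta C k) q = q ^+ k.
Proof.
rewrite /pser (@csum_fin _ _ k.+1) /psum => [|i ki]; last by rewrite /delta gtn_eqF // mul0r.
rewrite big_ord_recr /= /delta eqxx mul1r big1 ?add0r // => i _.
by rewrite ltn_eqF ?mul0r.
Qed.

(** The initial exponent can be lowered at will, by convolving with a power of q; two forms can then
    be expanded from a common exponent and subtracted. *)
Lemma fourier_pser_low (q : rat) (c : rat -> C) f : fourier_expansion 1 q c f ->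
  exists n0 : int, forall n1, n1 <= n0 -> disc_conv (fun j => c (q + n1%:~R + j%:R)) /\
    forall t, 0 < im t ->
      f t = ee (ratr (q + n1%:~R) * t) * pser (fun j => c (q + n1%:~R + j%:R)) (ee t).
Proof.
move=> /fourier_pser[n0 [db cE hf]]; exists n0 => n1 n10.
set e := q + n0%:~R in db cE hf; pose k := `|n0 - n1|%N.
have eE : q + n1%:~R = e - k%:R.
  by rewrite /k natr_absz ger0_norm ?subr_ge0 // intrB /e; ring.
have bE : (fun j => c (q + n1%:~R + j%:R)) = conv (fun j => c (e + j%:R)) (delta C k).
  apply/funext => j; rewrite conv_delta eE.
  case: leqP => kj; first by rewrite natrB //; congr c; ring.
  apply/eqP; apply: contrapT => /negP h0; case: (cE _ h0) => i; rewrite -addrA => /addrI/eqP.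
  rewrite addrC subr_eq -natrD eqr_nat => /eqP ji; move: kj; rewrite ji.
  by rewrite ltnNge leq_addl.
have dk : disc_conv (delta C k).
  by apply: disc_conv_bounded1 => n; rewrite /delta; case: eqP => _; rewrite ?normc1 ?normc0.
rewrite bE; split=> [|t t0]; first exact: disc_conv_conv.
have t1 := normc_ee_lt1 t0.
rewrite pser_conv // pser_delta hf // eE rmorphB /= ratr_nat mulrBl eeB eeMn.
by rewrite mulrACA mulVf ?mulr1 // expf_neq0 // ee_neq0.
Qed.

End Uniqueness.

(** * Uniqueness in negative weight *)

Section Descent.
Variable R : realType.
Local Notation C := (Cplx R).
Implicit Types (t : C).

Lemma im_addR t (x : R) : im (t + x%:C) = im t.
Proof. by rewrite imD /= addr0. Qed.

Lemma im_add_nat t (j : nat) : im (t + j%:R) = im t.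
Proof. by rewrite imD im_nat addr0. Qed.

(* If [|re t| <= 1/2] and [im t < 1/2] then [t -> -1/t] at least doubles [im t]. *)
Lemma invariant_descent (W : C -> R) (B : R) :
  (forall t, 0 < im t -> W (t + 1) = W t) -> (forall t, 0 < im t -> W (- t^-1) = W t) ->
  (forall t, 2^-1 <= im t -> W t <= B) -> forall t, 0 < im t -> W t <= B.
Proof.
move=> WT WS WB.
have Wn t (j : nat) : 0 < im t -> W (t + j%:R) = W t.
  elim: j => [|j IH] t0; first by rewrite addr0.
  by rewrite -natr1 addrA WT ?IH // im_add_nat.
have Wz t (z : int) : 0 < im t -> W (t + z%:~R) = W t.
  case: z => j t0; first exact: Wn.
  have t1 : 0 < im (t - j.+1%:R) by rewrite imD imN im_nat subr0.
  by rewrite NegzE mulrNz -(Wn _ j.+1 t1) subrK.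
have main (k : nat) t : 0 < im t -> 2^-1 <= 2 ^+ k * im t -> W t <= B.
  elim: k t => [|k IH] t t0; first by rewrite mul1r; exact: WB.
  move=> hk; pose z := - Num.floor (re t + 2^-1); pose u := t + z%:~R.
  have uE : W t = W u by rewrite Wz.
  have iu : im u = im t by rewrite /u intC im_addR.
  have u0 : 0 < im u by rewrite iu.
  rewrite uE; have [h|h] := leP 2^-1 (im u); first exact: WB.
  have ru : `|re u| <= 2^-1.
    have := floor_itv (re t + 2^-1); rewrite intrD1 => /andP[h1 h2].
    rewrite /u intC reD /= /z intrN ler_norml; lra.
  have n2 : 0 < normc u ^+ 2 <= 2^-1.
    rewrite exprn_gt0 ?normc_gt0 ?upper_neq0 //= normcE.
    have : re u ^+ 2 <= 4^-1.
      by rewrite -real_normK ?num_real // (_ : 4^-1 = 2^-1 ^+ 2) ?lerXn2r ?nnegrE ?invr_ge0 //; field.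
    have : im u ^+ 2 <= 4^-1.
      by rewrite (_ : 4^-1 = 2^-1 ^+ 2) ?lerXn2r ?nnegrE ?invr_ge0 // ?ltW //; field.
    by move: (re u ^+ 2) (im u ^+ 2) => a b; lra.
  rewrite -(WS _ u0); apply: IH; first exact: upper_inv.
  rewrite imV iu; apply: le_trans hk _; rewrite exprSr -mulrA ler_wpM2l ?exprn_ge0 //.
  have [m0 m1] := andP n2; rewrite ler_pdivlMr // mulrAC -[leRHS]mul1r ler_wpM2r ?(ltW t0) //.
  lra.
move=> t t0; have [k hk] : exists k : nat, 2^-1 <= 2 ^+ k * im t.
  have [k hk] : exists k : nat, 2^-1 / im t <= k%:R.
    by exists (Num.truncn (2^-1 / im t)).+1; apply/ltW/truncnS_gt.
  exists k; rewrite -ler_pdivrMr //; apply: le_trans hk _.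
  by rewrite -natrX ler_nat ltnW // ltn_expl.
exact: main hk.
Qed.

End Descent.

Section Uniqueness.
Variables (R : realType) (n : nat) (L : even_lattice n).
Local Notation C := (Cplx R).
Local Notation V := (group_ring R L).
Variable rho : 'M[int]_2 -> {linear V -> V}.
Hypothesis hrho : weil_representation rho.
Implicit Types (t : C).

(* [|H|^2 (im t)^-K] is invariant, since the Weil representation is unitary, and bounded on
   [im t >= 1/2], hence everywhere. So [|H|^2 = O((im t)^K)] as [im t] tends to 0, and
   Cauchy's estimate kills every coefficient. *)
Lemma form_vanishing (K : nat) (H : C -> V) : (0 < K)%N ->
  (forall t, 0 < im t -> H (t + 1) = rho matT (H t)) ->
  (forall t, 0 < im t -> H (- t^-1) = (t ^+ K)^-1 *: rho matS (H t)) ->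
  (forall g, exists (e : rat) (b : nat -> C), [/\ disc_conv b,
     (forall j, e + j%:R < 0 -> b j = 0) &
     forall t, 0 < im t -> H t g = ee (ratr e * t) * pser b (ee t)]) ->
  forall t, 0 < im t -> H t = 0.
Proof.
move=> K0 HT HS /boolp.choice[e /boolp.choice[b hb]].
have bound1 g : exists B, forall t, 2^-1 <= im t -> normc (H t g) ^+ 2 <= B.
  (* [r] is |e(t)| at height 1/2. No exponent is negative, so the terms decrease with im t and are
     majorized by those at height 1/2. *)
  have [db bE bH] := hb g; pose r : R := expR (- pi).
  have r01 : 0 <= r < 1 by rewrite expR_ge0 expR_lt1 oppr_lt0 pi_gt0.
  have [B HB] := db r r01; pose E : R := expR (- (pi * ratr (e g))).
  exists ((E * B) ^+ 2) => t ht; have t0 : 0 < im t by apply: lt_le_trans ht.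
  have t1 := normc_ee_lt1 t0.
  rewrite lerXn2r ?nnegrE ?normc_ge0 //.
    rewrite mulr_ge0 ?expR_ge0 //; apply: le_trans (HB 0%N); by rewrite big_ord0.
  rewrite bH // -(pserZ _ db t1); apply: (csum_le (M := fun j => E * (normc (b g j) * r ^+ j))).
    move=> j; rewrite -mulrA !normcM normcX mulrCA [leRHS]mulrCA.
    have [b0|b0] := eqVneq (b g j) 0; first by rewrite b0 normc0 !mul0r.
    rewrite ler_wpM2l ?normc_ge0 //.
    have m0 : 0 <= e g + j%:R.
      by rewrite leNgt; apply: contra b0 => /bE ->.
    have m0' : 0 <= ratr (e g) + j%:R :> R by rewrite -(ratr_nat R j) -rmorphD ler0q.
    rewrite !normc_ee /r /E -!expRM_natl -!expRD ler_expR ratrC imM /= mul0r addr0.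
    have p0 := pi_gt0 R.
    have : pi * (ratr (e g) + j%:R) * (2 * im t - 1) >= 0 by rewrite !mulr_ge0 ?(ltW p0) //; lra.
    move: (ratr (e g)) (j%:R) (im t) => x y z; nra.
  by move=> k; rewrite -mulr_sumr ler_wpM2l ?expR_ge0.
have [B HB] := boolp.choice bound1.
pose W t := sqnorm (H t) / im t ^+ K.
pose BB := (\sum_g B g) * 2 ^+ K.
have WB t : 0 < im t -> W t <= BB.
  apply: invariant_descent => {}t t0.
  - by rewrite /W HT // sqnorm_T // imD /= addr0.
  - rewrite /W HS // imV; have tn := upper_neq0 t0.
    have -> : sqnorm ((t ^+ K)^-1 *: rho matS (H t)) = (normc t ^+ 2 ^+ K)^-1 * sqnorm (H t).
      rewrite -(sqnorm_S hrho (H t)) /sqnorm mulr_sumr; apply: eq_bigr => g _.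
      by rewrite ffunE normcM normcV normcX exprMn exprVn -!exprM mulnC.
    have nt : normc t ^+ 2 ^+ K != 0 by rewrite !expf_neq0 // normc_eq0.
    have it : im t ^+ K != 0 by rewrite expf_neq0 ?gt_eqF.
    by rewrite expr_div_n; field; rewrite nt it.
  have t1 : 0 < im t by apply: lt_le_trans t0.
  rewrite /W ler_pdivrMr ?exprn_gt0 //.
  have s0 : sqnorm (H t) <= \sum_g B g by apply: ler_sum => g _; exact: HB.
  have B0 : 0 <= \sum_g B g.
    by apply: le_trans s0; apply: sumr_ge0 => g _; rewrite exprn_ge0 ?normc_ge0.
  apply: le_trans s0 _; rewrite /BB -mulrA -exprMn ler_peMr // -[leLHS](expr1n _ K).
  by rewrite lerXn2r ?nnegrE ?mulr_ge0 ?(ltW t1) //; lra.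
have Hb g t : 0 < im t -> normc (H t g) ^+ 2 <= BB * im t ^+ K.
  move=> t0; rewrite -ler_pdivrMr ?exprn_gt0 //; apply: le_trans (WB t t0).
  rewrite ler_pM2r ?invr_gt0 ?exprn_gt0 // /sqnorm (bigD1 g) //= lerDl.
  by apply: sumr_ge0 => i _; rewrite exprn_ge0 ?normc_ge0.
have b0 g j : b g j = 0.
  have [db bE bH] := hb g; apply/eqP; rewrite -normc_eq0 -sqrf_eq0.
  (* Cauchy's estimate at height y bounds |b_j|^2 by exp(4 pi (x + j) y) [BB] y^K, which is at most
     Q y for 0 < y <= 1 and K >= 1. *)
  set x := ratr (e g) : R; pose Q : R := expR (4 * pi * (`|x| + j%:R)) * BB.
  have BB0 : 0 <= BB.
    have := Hb g ('i%C) ltr01; rewrite /= expr1n mulr1; apply: le_trans.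
    by rewrite exprn_ge0 ?normc_ge0.
  have Q0 : 0 <= Q by rewrite mulr_ge0 ?expR_ge0.
  have p0 := pi_gt0 R.
  have main (y : R) : 0 < y <= 1 -> normc (b g j) ^+ 2 <= Q * y.
    move=> /andP[y0 y1]; pose t : C := (0 +i* y)%C; have t0 : 0 < im t by [].
    pose E : R := expR (2 * pi * x * y).
    have hx (z : R) : normc (pser (b g) (ee (t + z%:C))) <= E * Num.sqrt (BB * y ^+ K).
      have z0 : 0 < im (t + z%:C) by rewrite im_addR.
      have -> : pser (b g) (ee (t + z%:C)) = (ee (ratr (e g) * (t + z%:C)))^-1 * H (t + z%:C) g.
        rewrite bH // mulKf //; exact: ee_neq0.
      rewrite normcM normcV normc_ee ratrC imM /= mul0r !addr0 -expRN opprK.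
      have -> : expR (2 * pi * (ratr (e g) * y)) = E by rewrite /E /x mulrA.
      rewrite ler_wpM2l ?expR_ge0 // -[leLHS]ger0_norm ?normc_ge0 // -sqrtr_sqr ler_wsqrtr //.
      by apply: le_trans (Hb g _ z0) _; rewrite im_addR.
    have := cauchy_estimate j db t0 hx; rewrite normc_ee /= -expRM_natl mulrN expRN.
    rewrite ler_pdivrMr ?expR_gt0 // => h.
    have X0 : 0 <= BB * y ^+ K by rewrite mulr_ge0 // exprn_ge0 // ltW.
    have : normc (b g j) ^+ 2 <= (E * Num.sqrt (BB * y ^+ K) * expR (j%:R * (2 * pi * y))) ^+ 2.
      by rewrite lerXn2r ?nnegrE ?normc_ge0 // !mulr_ge0 ?expR_ge0 ?sqrtr_ge0.
    move=> {}h; apply: le_trans h _; rewrite !exprMn sqr_sqrtr // /E -!expRM_natl.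
    rewrite mulrAC -expRD /Q -[leRHS]mulrA; apply: ler_pM; rewrite ?expR_ge0 //.
      rewrite ler_expR; have hx' : x <= `|x| by exact: ler_norm.
      have : (`|x| + j%:R) * (4 * pi) * (1 - y) + (`|x| - x) * (4 * pi) * y >= 0.
        by rewrite addr_ge0 // !mulr_ge0 ?subr_ge0 ?(ltW p0) ?(ltW y0) ?addr_ge0.
      by move: `|x| (j%:R : R) => a k; nra.
    rewrite ler_wpM2l // -[leRHS]expr1 ler_wiXn2l // ltW //.
  rewrite eq_le exprn_ge0 ?normc_ge0 // andbT leNgt; apply/negP => h.
  move: (_ ^+ 2) h main => be be0 main.
  have Q1 : 0 < be + Q + 1 by rewrite addr_gt0 // ltr_wpDr.
  (* At this height, Q y is smaller than [be], the supposedly positive |b_j|^2. *)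
  have y01 : 0 < be / (be + Q + 1) <= 1.
    rewrite divr_gt0 //= ler_pdivrMr // mul1r -addrA lerDl addr_ge0 //.
  have := main _ y01; rewrite mulrA ler_pdivlMr //.
  by clear -be0 Q0; move: Q Q0 => q q0; nra.
move=> t t0; apply/ffunP => g; have [db bE bH] := hb g; rewrite ffunE bH //.
rewrite /pser (@csum_fin _ _ 0) /psum ?big_ord0 ?mulr0 // => i _.
by rewrite b0 mul0r.
Qed.

End Uniqueness.

Section QExpDerivative.
Variable R : realType.
Local Notation C := (Cplx R).
Implicit Types (t : C) (f : C -> C).

Lemma qexp_derivable (N : nat) (b : nat -> C) f t : (0 < N)%N -> qexp N b f -> 0 < im t ->
  derivable f t 1.
Proof.
move=> N0 [db hb] t0; apply: (has_deriv_derivable (d := _)).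
have d1 := has_deriv_eeZ (- N%:R^-1) t; have d2 := has_deriv_eeZ N%:R^-1 t.
have x1 : normc (ee (N%:R^-1 * t)) < 1 by rewrite mulrC; exact: normc_root.
have := has_derivM d1 (has_deriv_comp d2 (has_deriv_pser db x1)).
apply: has_deriv_near; apply: filterS (near_upper t0) => w w0.
have e1 : - (w / N%:R) = - N%:R^-1 * w by rewrite mulNr mulrC.
have e2 : w / N%:R = N%:R^-1 * w by rewrite mulrC.
by rewrite (hb _ w0) e1 e2.
Qed.

End QExpDerivative.

(** * The eta quotients and their lifts *)

Section EtaQuotient.
Variable R : realType.
Local Notation C := (Cplx R).
Implicit Types (t : C).
Variables (N a b K : nat).
(** [bE] makes the leading exponent (a - b/N) / 24 at the cusp 0 vanish, [bK] gives the weight (a -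
    b) / 2 = -K, and [N24] the leading exponent (a - N b) / 24 = -1/N at infinity. *)
Hypotheses (N13 : (1 < N <= 3)%N) (bE : b = (N * a)%N) (bK : b = (a + 2 * K)%N)
  (N24 : (N * (N * b) = 24 + N * a)%N).

(* The two quotients of the theorem are [(N, a, b, K) = (3, 1, 3, 1)] and [(2, 4, 8, 2)], of
   weight [- K]; [etaquo_cusp] is their expansion at the cusp 0, up to a constant. *)
Definition etaquo t : C := eta t ^+ a / eta (N%:R * t) ^+ b.
Definition etaquo_cusp t : C := eta t ^+ a / eta (t / N%:R) ^+ b.
Local Notation f := etaquo.
Local Notation h := etaquo_cusp.

Let N0 : (0 < N)%N. Proof. by case/andP: N13 => /ltnW. Qed.
Let NC : (N%:R : C) != 0. Proof. by rewrite pnatr_eq0 -lt0n. Qed.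

Lemma im_mulN t : 0 < im t -> 0 < im (N%:R * t).
Proof. by move=> t0; rewrite im_natM mulr_gt0 // ltr0n. Qed.

Lemma im_divN_gt0 t : 0 < im t -> 0 < im (t / N%:R).
Proof. by move=> t0; rewrite im_divN // divr_gt0 // ltr0n. Qed.

Lemma quotM (x y z w : C) : (x * y) ^+ a / (z * w) ^+ b = x ^+ a / z ^+ b * (y ^+ a * w^-1 ^+ b).
Proof. by rewrite !exprMn invfM mulrACA exprVn. Qed.

Lemma etaquo_q t : 0 < im t ->
  f t = ee (- (t / N%:R)) * (euler_fun (ee t) ^+ a * (euler_fun (ee t ^+ N))^-1 ^+ b).
Proof.
move=> t0; rewrite /f (etaE t0) (etaE (im_mulN t0)) (eeMn N t) quotM.
apply: (congr1 (fun z => z * _)).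
rewrite -(eeMn a) -(eeMn b) -eeB; congr ee.
have e : N%:R * (N%:R * b%:R) = 24 + N%:R * a%:R :> C by rewrite -!natrM -natrD N24.
have -> : t / N%:R = (N%:R * (N%:R * b%:R) - N%:R * a%:R) * (t / 24 / N%:R).
  by rewrite e addrK; field.
by field.
Qed.

Lemma etaquo_cusp_q t : 0 < im t ->
  h t = euler_fun (ee (t / N%:R) ^+ N) ^+ a * (euler_fun (ee (t / N%:R)))^-1 ^+ b.
Proof.
move=> t0; rewrite /h (etaE t0) (etaE (im_divN_gt0 t0)).
have -> : ee t = ee (t / N%:R) ^+ N by rewrite -eeMn mulrC divfK.
rewrite quotM -[RHS]mul1r; apply: (congr1 (fun z => z * _)).
rewrite -(eeMn a) -(eeMn b) -eeB bE natrM -[RHS]ee0; congr ee.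
by field.
Qed.

Lemma etaquo_cusp_period t : 0 < im t -> h (t + N%:R) = h t.
Proof.
move=> t0; have t1 : 0 < im (t + N%:R) by rewrite im_add_nat.
have e1 : (t + N%:R) / N%:R = t / N%:R + 1%:R by rewrite mulrDl mulfV.
by rewrite (etaquo_cusp_q t1) (etaquo_cusp_q t0) e1 (ee_shift (t / N%:R) 1).
Qed.

Local Notation I := ('i%C : C).
Definition cusp_const : C := (Num.sqrt (N%:R : R))%:C ^+ b * I ^+ K.

(** For u = r(t) and v = r(t/N): since v = u / s, the transformation factor u^a / v^b is s^b
    u^(a-b), and a - b = -2 K leaves only powers of u^2, which is known. *)
Lemma quot_scale (x y u v s : C) : s != 0 -> u = s * v -> u != 0 ->
  (u * x) ^+ a / (v * y) ^+ b = s ^+ b * (u ^+ 2)^-1 ^+ K * (x ^+ a / y ^+ b).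
Proof.
move=> s0 uE u0; have v0 : v != 0 by apply: contra_neq u0 => v0; rewrite uE v0 mulr0.
have -> : v = u / s by rewrite uE mulrAC mulfV // mul1r.
rewrite !exprMn !exprVn invfM [in u ^+ b]bK exprD exprM !invfM !invrK.
have [ua ub] : u ^+ a != 0 /\ (u ^+ 2) ^+ K != 0 by rewrite !expf_neq0.
rewrite bK in s0 *.
move: (u ^+ a) (u ^+ 2 ^+ K) ua ub (x ^+ a) (y ^+ _)^-1 (s ^+ _) => p q p0 q0 X Y S.
by field; rewrite p0 q0.
Qed.

(** N (-1/t) = -1/(t/N), so the numerator transforms by r(t) and the denominator by r(t/N), whose
    ratio is sqrt(N). *)
Lemma etaquo_S t : 0 < im t -> t ^+ K * f (- t^-1) = cusp_const * h t.
Proof.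
move=> t0; have tn0 := upper_neq0 t0; have tN := im_divN_gt0 t0.
have Nr : 0 < (N%:R : R) by rewrite ltr0n.
have s0 : (Num.sqrt (N%:R : R))%:C != 0 :> C by rewrite fmorph_eq0 gt_eqF // sqrtr_gt0.
have uE : eta_ratio t = (Num.sqrt (N%:R : R))%:C * eta_ratio (t / N%:R).
  by rewrite {1}(eta_ratio_scale t0 Nr) (rmorph_nat (real_complex R)).
have eN : N%:R * - t^-1 = - (t / N%:R)^-1 by rewrite invf_div mulrN.
rewrite /f eN (eta_S t0) (eta_S tN) (quot_scale _ _ s0 uE (eta_ratio_neq0 t0)).
rewrite (eta_ratio_sqr t0) -/(h t) /cusp_const.
have -> : (- I * t)^-1 = I / t by rewrite invfM invrN I_inv opprK.
rewrite expr_div_n; have tK : t ^+ K != 0 by rewrite expf_neq0.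
move: (h t) (_ ^+ b) (I ^+ K) (t ^+ K) tK => H S J T T0.
by field.
Qed.

Definition STmx (j : nat) : 'M[int]_2 := mk2 0 (-1) 1 j%:Z.
Local Notation k := (- K%:Z).

Lemma slash_ST j t : 0 < im t -> slash k f (STmx j) t = cusp_const * h (t + j%:R).
Proof.
move=> t0; have t1 : 0 < im (t + j%:R) by rewrite im_add_nat.
rewrite /slash /mobius /autj; have [-> -> -> ->] := mk2E 0 (-1) 1 j%:Z.
rewrite opprK mul0r add0r mul1r -(etaquo_S t1) /exprz; congr (_ * f _).
by rewrite mulrN1z mulN1r.
Qed.

Lemma slash_T t : 0 < im t -> slash k f (mk2 1 1 0 1) t = f (t + 1).
Proof.
move=> t0; rewrite /slash /mobius /autj; have [-> -> -> ->] := mk2E 1 1 0 1.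
by rewrite mul0r add0r exp1rz !mul1r divr1.
Qed.

Lemma etaquo_shift t : 0 < im t -> f (t + 1) = eeQ R (- 1 / N%:R) * f t.
Proof.
move=> t0; have t1 : 0 < im (t + 1) by rewrite (im_add_nat t 1).
have e1 : - ((t + 1) / N%:R) = - 1 / N%:R + - (t / N%:R) :> C by field.
rewrite (etaquo_q t1) (etaquo_q t0) (ee_shift t 1) e1 (eeD (- 1 / N%:R)) -mulrA.
apply: (congr1 (fun z => z * _)).
by rewrite /Defs.eeQ rmorphM fmorphV rmorphN rmorph1 /= ratr_nat.
Qed.

(* [U = S T^-N S^-1] and [f|S] has period [N]. *)
Lemma slash_U t : 0 < im t -> slash k f (mk2 1 0 N 1) t = f t.
Proof.
move=> t0; have tn0 := upper_neq0 t0.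
have sU : SL2Z (mk2 1 0 N 1) by apply/SL2Z_mk2; lia.
have j0 := autj_neq0 sU t0.
have jE : autj (mk2 1 0 N 1) t = N%:R * t + 1.
  by rewrite /autj; have [_ _ -> ->] := mk2E 1 0 N%:Z 1.
have mE : mobius (mk2 1 0 N 1) t = t / (N%:R * t + 1).
  by rewrite /mobius jE; have [-> -> _ _] := mk2E 1 0 N%:Z 1; rewrite mul1r addr0.
rewrite /slash jE mE opprK /=; rewrite jE in j0.
pose s := - t^-1; have s0 : 0 < im s by exact: upper_inv.
pose u := s - N%:R; have u0 : 0 < im u by rewrite /u imD (imN N%:R) im_nat subr0.
have us : u + N%:R = s by rewrite /u subrK.
have uE : u = - ((N%:R * t + 1) / t) by rewrite /u /s; field.
have f1 : f (t / (N%:R * t + 1)) = f (- u^-1) by rewrite uE invrN opprK invf_div.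
have f2 : f t = f (- s^-1) by rewrite /s invrN opprK invrK.
have hh : h u = h s by rewrite -us (etaquo_cusp_period u0).
have := etaquo_S u0; rewrite hh -(etaquo_S s0) -f1 -f2 => e.
have sK : s ^+ K != 0 by rewrite expf_neq0 // upper_neq0.
apply: (mulfI sK); rewrite -e mulrA -exprMn; congr (_ ^+ _ * _).
by rewrite uE /s; field.
Qed.

End EtaQuotient.

Section SlashCharacter.
Variable R : realType.
Local Notation C := (Cplx R).
Variables (k : int) (f : C -> C).
Implicit Types (t x y : C) (A B : 'M[int]_2).

Definition slash_factor A x : Prop := forall t, 0 < im t -> slash k f A t = x * f t.

Lemma slash_factorM A B x y : SL2Z A -> SL2Z B -> slash_factor A x -> slash_factor B y ->
  slash_factor (A * B) (x * y).
Proof.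
move=> hA hB fA fB t t0; rewrite (slashM k f hA hB t0) {1}/slash fA ?upper_mobius //.
by rewrite mulrCA -mulrA -(fB t t0).
Qed.

Lemma slash_factorV B y : SL2Z B -> y != 0 -> slash_factor B y -> slash_factor (invmx B) y^-1.
Proof.
move=> hB y0 fB t t0; have hV := SL2ZV hB.
have := slashM k f hB hV t0; rewrite (mulSLV hB) slash1 {1}/slash fB ?upper_mobius //.
by rewrite mulrCA -/(slash k f (invmx B) t) => ->; rewrite mulKf.
Qed.

(** An equivalence, as [Gamma1_ind] requires: its words also contain inverses of the generators. *)
Lemma slash_factor_mulr A B x y : SL2Z A -> SL2Z B -> y != 0 -> slash_factor B y ->
  slash_factor (A * B) (x * y) <-> slash_factor A x.
Proof.
move=> hA hB y0 fB; split=> [h|h]; last exact: slash_factorM.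
have := slash_factorM (SL2ZM hA hB) (SL2ZV hB) h (slash_factorV hB y0 fB).
by rewrite (mulKVSL _ hB) mulfK.
Qed.

End SlashCharacter.

Section EtaLift.
Variables (R : realType) (n : nat) (L : even_lattice n).
Local Notation C := (Cplx R).
Local Notation V := (group_ring R L).
Variables (N a b K : nat).
Hypotheses (N13 : (1 < N <= 3)%N) (bE : b = (N * a)%N) (bK : b = (a + 2 * K)%N)
  (N24 : (N * (N * b) = 24 + N * a)%N) (K0 : (0 < K)%N).
Hypothesis hN : annihilates_discQ L N.
Local Notation f := (@etaquo R N a b).
Local Notation h := (@etaquo_cusp R N a b).
Local Notation cS := (cusp_const R N b K).
Local Notation k := (- K%:Z).
Implicit Types (t : C) (g : disc L).

Let N0 : (0 < N)%N. Proof. by case/andP: N13 => /ltnW. Qed.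

Lemma slash_chi g A : eqmod1 (discQ g) (- 1 / N%:R) -> Gamma1 N A ->
  slash_factor k f A (chi R g A).
Proof.
move=> hg; move: A.
have GT : Gamma1 N (mk2 1 1 0 1) by apply/Gamma1_mk2.
have GU : Gamma1 N (mk2 1 0 N 1) by apply/Gamma1_mk2; split => //; apply/modzE; exists 1; lia.
have cT : chi R g (mk2 1 1 0 1) = eeQ R (- 1 / N%:R).
  by rewrite /chi mxE mul1r; exact: eeQ_eqmod1.
have cU : chi R g (mk2 1 0 N 1) = 1 by rewrite /chi mxE mul0r eeQ0.
have fT : slash_factor k f (mk2 1 1 0 1) (chi R g (mk2 1 1 0 1)).
  by move=> t t0; rewrite slash_T // (etaquo_shift N13 N24 t0) cT.
have fU : slash_factor k f (mk2 1 0 N 1) (chi R g (mk2 1 0 N 1)).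
  by move=> t t0; rewrite (slash_U N13 bE bK N24 t0) cU mul1r.
apply: (Gamma1_ind N13) => [|A hA|A hA].
- by move=> t t0; rewrite slash1 /chi -mk2_1 mxE mul0r eeQ0 mul1r.
- rewrite (chiM R hN g hA GT); exact (@slash_factor_mulr R k f A _ (chi R g A) _ (Gamma1_SL2Z hA) (Gamma1_SL2Z GT) (chi_neq0 _ _ _) fT).
- rewrite (chiM R hN g hA GU); exact (@slash_factor_mulr R k f A _ (chi R g A) _ (Gamma1_SL2Z hA) (Gamma1_SL2Z GU) (chi_neq0 _ _ _) fU).
Qed.

(** After the factor e(-t/N) only powers of e(t) occur. As N > 1, index 1 is empty, so f contributes
    nothing to the constant term. *)
Lemma etaquo_qexp : exists B, [/\ qexp N B f, B 0%N = 1 & B 1%N = 0].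
Proof.
have [B [dB B0 hB]] := analyticM (analyticX a (@analytic_euler R))
  (analyticX b (analytic_pow N0 (@analytic_eulerV R))).
exists (spread N B); split; last 2 first.
- by rewrite /spread dvdn0 div0n B0 mulr1.
- by rewrite /spread dvdn1 gtn_eqF //; case/andP: N13.
split; first exact: disc_conv_spread.
move=> t t0; rewrite (etaquo_q N13 N24 t0); apply: (congr1 (fun z => _ * z)).
have tr := normc_root N0 t0.
have e : ee (t / N%:R) ^+ N = ee t by rewrite -eeMn mulrC divfK // pnatr_eq0 -lt0n.
by rewrite (pser_spread N0 dB tr) e hB ?normc_ee_lt1.
Qed.

Lemma etaquo_cusp_qexp (j : nat) : exists B, [/\ qexp N B (fun t => h (t + j%:R)), B 0%N = 0 & B 1%N = 1].
Proof.
elim: j => [|j [B [hB B0 B1]]]; last first.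
  exists (fun i => eeQ R (qidx N i) * B i); split; last 2 first.
  - by rewrite B0 mulr0.
  - by rewrite B1 mulr1 /qidx subrr mul0r eeQ0.
  apply: qexp_eq (qexp_shift N0 hB) => t t0; by rewrite -addrA nat1r.
have [B [dB B0 hB]] := analyticM (analyticX a (analytic_pow N0 (@analytic_euler R)))
  (analyticX b (@analytic_eulerV R)).
(* The quotient is 1 at infinity, while [qexp] starts at e(-t/N); the convolution moves its
   coefficients up by one index. *)
exists (conv B (delta C 1)); rewrite !conv_delta /= B0 mulr1; split=> //.
have d1 : disc_conv (delta C 1).
  by apply: disc_conv_bounded1 => i; rewrite /delta; case: eqP => _; rewrite ?normc1 ?normc0.
split; first exact: disc_conv_conv.
move=> t t0; rewrite addr0 (etaquo_cusp_q N13 bE t0).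
have tr := normc_root N0 t0.
rewrite (pser_conv dB d1 tr) pser_delta expr1 -hB // mulrCA -eeD.
by rewrite addNr ee0 mulr1.
Qed.

Definition base : seq 'M[int]_2 := mk2 1 0 0 1 :: map STmx (iota 0 N).

Lemma base_SL2Z A : A \in base -> SL2Z A.
Proof.
rewrite in_cons => /predU1P[->|/mapP[j _ ->]]; apply/SL2Z_mk2; first by [].
by rewrite mul0r mulN1r opprK add0r.
Qed.

Lemma slash_base A : A \in base -> exists B, [/\ qexp N B (slash k f A),
  B 0%N = (A == mk2 1 0 0 1)%:R & B 1%N = if A == mk2 1 0 0 1 then 0 else cS].
Proof.
rewrite in_cons => /predU1P[->|/mapP[j _ ->]].
  have [B [hB B0 B1]] := etaquo_qexp; exists B; rewrite eqxx; split=> //.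
  by apply: qexp_eq hB => t t0; rewrite mk2_1 slash1.
have [B [hB B0 B1]] := etaquo_cusp_qexp j; exists (fun i => cS * B i).
have -> : (STmx j == mk2 1 0 0 1) = false by apply/eqP => /mk2_inj[].
rewrite B0 B1 mulr0 mulr1; split=> //.
by apply: qexp_eq (qexpZ N0 cS hB) => t t0; rewrite (slash_ST N13 bK j t0).
Qed.

Lemma slash_neg A t : slash k f (- A) t = (-1) ^+ K * slash k f A t.
Proof.
have jN : autj (- A) t = - autj A t by rewrite /autj !mxE !intrN mulNr -opprD.
have mN : mobius (- A) t = mobius A t.
  by rewrite /mobius jN !mxE !intrN mulNr -opprD invrN mulrNN.
rewrite /slash mN jN opprK -!exprnP (exprNn (autj A t)). exact: esym (mulrA _ _ _).
Qed.

End EtaLift.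

Section LiftExpansion.
Variables (R : realType) (n : nat) (L : even_lattice n).
Local Notation C := (Cplx R).
Local Notation V := (group_ring R L).
Variable rho : 'M[int]_2 -> {linear V -> V}.
Hypothesis hrho : weil_representation rho.
Variables (N a b K : nat).
Hypotheses (N13 : (1 < N <= 3)%N) (bE : b = (N * a)%N) (bK : b = (a + 2 * K)%N)
  (N24 : (N * (N * b) = 24 + N * a)%N) (K0 : (0 < K)%N).
Hypothesis hN : annihilates_discQ L N.
Local Notation f := (@etaquo R N a b).
Local Notation cS := (cusp_const R N b K).
Local Notation k := (- K%:Z).
Local Notation D := (#|{: disc L}|%:R : C).
Local Notation kappa := (ee (- (2 - n%:R) / 8) / sqrtC D : C).
Local Notation zeta := (ee (- (2 - n%:R) / 4) : C).
Implicit Types (t : C) (g : disc L).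

Let N0 : (0 < N)%N. Proof. by case/andP: N13 => /ltnW. Qed.

Lemma rho_S_inv g : rho (invmx matS) (basis_elt R g) = zeta *: rho matS (basis_elt R (- g)).
Proof.
have [_ rM _ _] := hrho.
have -> : invmx matS = matS * (matS * matS).
  by rewrite matS_mk2 invmx_mk2 // !mk2_mul; congr mk2.
rewrite (rM _ _ SL2Z_S (SL2ZM SL2Z_S SL2Z_S)) (rM _ _ SL2Z_S SL2Z_S) (rho_SS hrho).
by rewrite linearZ.
Qed.

Lemma rho_S_at0 g : rho matS (basis_elt R g) 0 = kappa.
Proof.
rewrite (rho_S hrho) (@sum_pick _ _ g) => [|c cg]; last by rewrite !ffunE (negPf cg) mul0r.
by rewrite !ffunE eqxx mul1r eeQN (eeQ_eqmod1 R (discB0 g)) eeQ0 invr1 mulr1.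
Qed.

(** The inverse of S T^j is T^-j S^-1, and T acts trivially on the zero component: all S T^j
    contribute alike. *)
Lemma rho_ST_at0 j g : rho (invmx (STmx j)) (basis_elt R g) 0 = zeta * kappa.
Proof.
have [_ rM _ _] := hrho.
have sT : SL2Z (mk2 1 j%:Z 0 1) by apply/SL2Z_mk2; clear; lia.
have sA : SL2Z (STmx j) by apply/SL2Z_mk2; clear; lia.
have E : mk2 1 j%:Z 0 1 * invmx (STmx j) = invmx matS.
  have d0 : 0 * j%:Z - -1 * 1 = 1 by clear; lia.
  have d1 : 0 * 0 - -1 * 1 = 1 :> int by [].
  rewrite /STmx matS_mk2 (invmx_mk2 d0) (invmx_mk2 d1).
  by rewrite mk2_mul; congr mk2; clear; lia.
have := congr1 (fun v : V => v 0) (rho_S_inv g).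
rewrite -E (rM _ _ sT (SL2ZV sA)) (rho_Tn hrho).
have -> : eeQ R (j%:R * discQ (0 : disc L)) = 1.
  by rewrite eeQMn (eeQ_eqmod1 R (discQ0 L)) eeQ0 expr1n.
by rewrite mul1r => ->; rewrite ffunE rho_S_at0.
Qed.

Definition lift_sum g t : V := \sum_(A <- base N) lift_term rho k f g t A.

Lemma lift_sum_qexp g : exists B : disc L -> nat -> C, (forall c, qexp N (B c) (fun t => lift_sum g t c)) /\
  (forall c, B c 0%N = (c == g)%:R) /\ B 0 1%N = N%:R * (cS * (zeta * kappa)).
Proof.
have [b1 hb1] : exists b1 : 'M[int]_2 -> nat -> C, forall A, A \in base N ->
    [/\ qexp N (b1 A) (slash k f A), b1 A 0%N = (A == mk2 1 0 0 1)%:R &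
        b1 A 1%N = if A == mk2 1 0 0 1 then 0 else cS].
  have /boolp.choice[b1 hb1] : forall A, exists B, A \in base N ->
      [/\ qexp N B (slash k f A), B 0%N = (A == mk2 1 0 0 1)%:R &
        B 1%N = if A == mk2 1 0 0 1 then 0 else cS].
    move=> A; have [hA|hA] := boolP (A \in base N); last by exists (fun=> 0).
    by have [B hB] := slash_base R N13 bE bK N24 hA; exists B.
  by exists b1.
exists (fun c j => \sum_(A <- base N) rho (invmx A) (basis_elt R g) c * b1 A j); split=> [c|].
  have := @qexp_sum R N N0 _ (base N) (fun A j => rho (invmx A) (basis_elt R g) c * b1 A j)
    (fun A t => rho (invmx A) (basis_elt R g) c * slash k f A t).
  have -> : (fun t => \sum_(A <- base N) rho (invmx A) (basis_elt R g) c * slash k f A t) =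
      (fun t => lift_sum g t c).
    by apply/funext => t; rewrite sum_ffunE; apply: eq_bigr => A _; rewrite ffunE mulrC.
  by apply => A /hb1[hA _ _]; exact: qexpZ.
have ne (j : nat) : (STmx j == mk2 1 0 0 1) = false by apply/eqP => /mk2_inj[].
have hST (j : nat) : j \in iota 0 N -> STmx j \in base N.
  by move=> hj; rewrite in_cons map_f ?orbT.
have h1 : mk2 1 0 0 1 \in base N by rewrite mem_head.
split=> [c|]; rewrite big_cons big_map.
  have [_ -> _] := hb1 _ h1; rewrite eqxx mulr1 mk2_1.
  rewrite big_seq big1 ?addr0 => [|j hj]; last first.
    by have [_ -> _] := hb1 _ (hST j hj); rewrite ne mulr0.
  have [r1 _ _ _] := hrho; have i1 : invmx 1 = 1 :> 'M[int]_2 by exact: invmx1.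
  by rewrite i1 r1 ffunE.
have [_ _ ->] := hb1 _ h1; rewrite eqxx mulr0 add0r big_seq.
rewrite (eq_bigr (fun=> cS * (zeta * kappa))); last first.
  by move=> j hj; have [_ _ ->] := hb1 _ (hST j hj); rewrite ne rho_ST_at0 mulrC.
rewrite -big_seq big_const_seq count_predT size_iota iter_addr addr0 mulr_natl.
by [].
Qed.

(** The inverse of -A is A^-1 S^2, and S^2 reflects gamma; this is how -gamma enters for N = 3. *)
Lemma lift_term_neg g A t : SL2Z A ->
  lift_term rho k f g t (- A) = ((-1) ^+ K * zeta) *: lift_term rho k f (- g) t A.
Proof.
move=> hA; have [_ rM _ _] := hrho.
have E : invmx (- A) = invmx A * (matS * matS).
  move: hA; rewrite (mk2P A); move: (A 0 0) (A 0 1) (A 1 0) (A 1 1) => x y z w /SL2Z_mk2 hA.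
  rewrite mk2_N !invmx_mk2 // ?mulrNN // matS_mk2 !mk2_mul; congr mk2; ring.
rewrite /lift_term slash_neg E (rM _ _ (SL2ZV hA) (SL2ZM SL2Z_S SL2Z_S)) (rM _ _ SL2Z_S SL2Z_S).
rewrite (rho_SS hrho) linearZ /= !scalerA; congr (_ *: _).
by rewrite mulrAC.
Qed.

End LiftExpansion.

(** * The lift as the form with the given principal part *)

Section LiftForm.
Variables (R : realType) (n : nat) (L : even_lattice n).
Local Notation C := (Cplx R).
Local Notation V := (group_ring R L).
Variable rho : 'M[int]_2 -> {linear V -> V}.
Hypothesis hrho : weil_representation rho.
Variables (N a b K : nat).
Hypotheses (N13 : (1 < N <= 3)%N) (bE : b = (N * a)%N) (bK : b = (a + 2 * K)%N)
  (N24 : (N * (N * b) = 24 + N * a)%N) (K0 : (0 < K)%N).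
Hypothesis hN : annihilates_discQ L N.
Local Notation f := (@etaquo R N a b).
Local Notation cS := (cusp_const R N b K).
Local Notation k := (- K%:Z).
Local Notation D := (#|{: disc L}|%:R : C).
Local Notation kappa := (ee (- (2 - n%:R) / 8) / sqrtC D : C).
Local Notation zeta := (ee (- (2 - n%:R) / 4) : C).
Implicit Types (t : C) (g : disc L).

Let N0 : (0 < N)%N. Proof. by case/andP: N13 => /ltnW. Qed.

(** The list will be gamma, -gamma for N = 3 and gamma alone for N = 2, so that both cases share one
    proof. *)
Variables (gs : seq (disc L)) (F : C -> V).
Hypothesis hgs : forall g, g \in gs -> eqmod1 (discQ g) (- 1 / N%:R).
Hypothesis FE : forall t, 0 < im t -> F t = \sum_(g <- gs) lift_sum rho N a b K g t.
Hypothesis Fmod : forall M, SL2Z M -> forall t, 0 < im t -> F (mobius M t) = autj M t ^ k *: rho M (F t).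

Local Notation const := ((size gs)%:R * (N%:R * (cS * (zeta * kappa)))).

Lemma lift_qexp : exists B : disc L -> nat -> C, [/\ forall c, qexp N (B c) (fun t => F t c),
  forall c, B c 0%N = \sum_(g <- gs) (c == g)%:R & B 0 1%N = const].
Proof.
have /boolp.choice[B hB] := lift_sum_qexp hrho N13 bE bK N24.
exists (fun c j => \sum_(g <- gs) B g c j); split=> [c|c|].
- apply: (@qexp_eq _ _ _ (fun t => \sum_(g <- gs) lift_sum rho N a b K g t c)).
    by move=> t t0; rewrite FE // sum_ffunE.
  by apply: qexp_sum => // g _; have [h _] := hB g; exact: h.
- by apply: eq_bigr => g _; have [_ [h _]] := hB g.
rewrite (eq_bigr (fun=> N%:R * (cS * (zeta * kappa)))).
  by rewrite big_const_seq count_predT iter_addr addr0 (mulr_natl _ (size gs)).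
by move=> g _; have [_ [_ h]] := hB g.
Qed.

Lemma mobius_T t : mobius matT t = t + 1.
Proof.
rewrite matT_mk2 /mobius /autj; have [-> -> -> ->] := mk2E 1 1 0 1.
by rewrite mul0r add0r mul1r divr1.
Qed.

Lemma autj_T t : autj matT t = 1.
Proof. by rewrite matT_mk2 /autj; have [_ _ -> ->] := mk2E 1 1 0 1; rewrite mul0r add0r. Qed.

Lemma mobius_S t : mobius matS t = - t^-1.
Proof.
rewrite matS_mk2 /mobius /autj; have [-> -> -> ->] := mk2E 0 (-1) 1 0.
by rewrite mul0r add0r mul1r addr0 mulN1r.
Qed.

Lemma autj_S t : autj matS t = t.
Proof. by rewrite matS_mk2 /autj; have [_ _ -> ->] := mk2E 0 (-1) 1 0; rewrite mul1r addr0. Qed.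

Lemma modular_T (H : C -> V) : (forall M, SL2Z M -> forall t, 0 < im t ->
    H (mobius M t) = autj M t ^ k *: rho M (H t)) ->
  forall t, 0 < im t -> H (t + 1) = rho matT (H t).
Proof.
by move=> h t t0; rewrite -mobius_T (h _ SL2Z_T _ t0) autj_T exp1rz scale1r.
Qed.

Lemma modular_S (H : C -> V) : (forall M, SL2Z M -> forall t, 0 < im t ->
    H (mobius M t) = autj M t ^ k *: rho M (H t)) ->
  forall t, 0 < im t -> H (- t^-1) = (t ^+ K)^-1 *: rho matS (H t).
Proof.
by move=> h t t0; rewrite -mobius_S (h _ SL2Z_S _ t0) autj_S -invr_expz.
Qed.

Lemma lift_coefficients : exists c, [/\ has_coefficients F c,
  forall g m, m < 0 -> c g m = \sum_(g0 <- gs) principal_monomial R (- 1 / N%:R) g0 g m &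
  c 0 0 = const].
Proof.
have [B [hB B0 B1]] := lift_qexp; have FT := modular_T Fmod.
(* [B] allows all exponents in (1/N)Z, whereas component g must have exponents in Q(g) + Z. The
   filtered coefficients represent the same function by T-equivariance. *)
pose B' g j : C := if qidx N j - discQ g \is a Num.int then B g j else 0.
have hB' g : qexp N (B' g) (fun t => F t g).
  apply: (qexp_filter N0 (hB g) (hN g)) => t t0.
  by rewrite FT // (rho_T hrho).
exists (fun g => qcoef N (B' g)); split=> [g|g m m0|].
- apply: (qexp_fourier1 N0 (hB' g) (hN g)) => j; rewrite /B'.
  by case: ifP => //; rewrite eqxx.
- rewrite (qcoef_neg N0 _ m0) /principal_monomial; case: eqP => [_|_]; last first.
    by rewrite big1 // => g0 _; rewrite andbF.
  (* The filter keeps the pole: where [B g 0] is nonzero, g belongs to [gs] and Q(g) is -1/N modulo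
     1. *)
  have -> : B' g 0%N = B g 0%N.
    rewrite /B'; case: ifPn => // h; rewrite B0 big_seq big1 // => g0 /hgs hg0.
    case: eqP => // gg; case/negP: h; rewrite gg.
    have -> : qidx N 0 = - 1 / N%:R by rewrite /qidx sub0r.
    by have := eqmod1_sym hg0.
  by rewrite B0; apply: eq_bigr => g0 _; rewrite andbT.
rewrite (qcoef0 N0) /B' B1; case: ifPn => // /negP[].
by rewrite /qidx subrr mul0r sub0r rpredN; have := discQ0 L; rewrite /eqmod1 subr0.
Qed.

Lemma lift_unique (F' : C -> V) P : weakly_holomorphic rho k F' ->
  has_principal_part F P -> has_principal_part F' P ->
  forall t, 0 < im t -> F' t = F t.
Proof.
move=> [_ F'mod _] [c [hc cP]] [c' [hc' cP']] t t0; apply/eqP; rewrite -subr_eq0; apply/eqP.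
move: t t0; apply: (form_vanishing hrho K0) => [t t0|t t0|g].
- by rewrite (modular_T F'mod t0) (modular_T Fmod t0) linearB.
- by rewrite (modular_S F'mod t0) (modular_S Fmod t0) linearB scalerBr.
have [n1 h1] := fourier_pser_low (hc g); have [n2 h2] := fourier_pser_low (hc' g).
pose m := Num.min n1 n2.
have [m1 m2] : m <= n1 /\ m <= n2 by rewrite !ge_min !lexx orbT.
have [d1 e1] := h1 m m1; have [d2 e2] := h2 m m2.
exists (discQ g + m%:~R), (fun j => c' g (discQ g + m%:~R + j%:R) + -1 * c g (discQ g + m%:~R + j%:R)).
split=> [|j j0|t t0]; first by apply: disc_convD => //; exact: disc_convZ.
- by rewrite cP // cP' // mulN1r subrr.
have t1 := normc_ee_lt1 t0.
rewrite (pserD d2 (disc_convZ _ d1) t1) (pserZ _ d1 t1) !ffunE (e1 _ t0) (e2 _ t0).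
by rewrite mulN1r mulrBr.
Qed.

Lemma lift_holomorphic g : holomorphic_H (fun t => F t g).
Proof.
by have [B [hB _ _]] := lift_qexp => t t0; exact: (qexp_derivable N0 (hB g) t0).
Qed.

Lemma lift_form :
  is_form_with_principal_part rho k
    (fun g m => \sum_(g0 <- gs) principal_monomial R (- 1 / N%:R) g0 g m) F /\
  product_weight F (const / 2).
Proof.
have [c [hc cP c0]] := lift_coefficients; split; last by exists c; rewrite c0.
have hP : has_principal_part F
    (fun g m => \sum_(g0 <- gs) principal_monomial R (- 1 / N%:R) g0 g m) by exists c.
split=> //; last by move=> F' wF' hF'; exact: lift_unique wF' hP hF'.
by split=> //; [exact: lift_holomorphic|exists c].
Qed.

End LiftForm.

Section Gamma1Form.
Variables (R : realType) (n : nat) (L : even_lattice n).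
Local Notation C := (Cplx R).
Variables (N a b K : nat).
Hypotheses (N13 : (1 < N <= 3)%N) (bE : b = (N * a)%N) (bK : b = (a + 2 * K)%N)
  (N24 : (N * (N * b) = 24 + N * a)%N) (K0 : (0 < K)%N).
Hypothesis hN : annihilates_discQ L N.
Local Notation f := (@etaquo R N a b).
Local Notation k := (- K%:Z).
Implicit Types (t : C) (g : disc L).

Let N0 : (0 < N)%N. Proof. by case/andP: N13 => /ltnW. Qed.

Variable reps : seq 'M[int]_2.
Hypotheses (hreps : coset_reps N reps)
  (reps_base : forall A, A \in reps -> A \in base N \/ - A \in base N).

(** At the cusps, M = X A with X in [Gamma1 N] and A a representative, so f|M is a multiple of f|A,
    whose expansion is known for A or -A in [base N]. *)
Lemma etaquo_Gamma1 g : eqmod1 (discQ g) (- 1 / N%:R) ->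
  weakly_holomorphic_Gamma1 N k (chi R g) f.
Proof.
move=> hg; have hs A (hA : Gamma1 N A) : slash_factor k f A (chi R g A) by exact: slash_chi.
split=> [t t0|M hM t t0|M hM].
- by have [B [hB _ _]] := etaquo_qexp R N13 N24; exact: (qexp_derivable N0 hB t0).
- by apply/(slash_modular k f _ (Gamma1_SL2Z hM) t0); exact: hs.
have [_ repsS _ cover] := hreps; have [A hA] := cover M hM.
have sA := repsS A hA; have iA : invmx A * A = 1 by exact: mulVSL.
set X := M * invmx A => hX; have ME : M = X * A by rewrite /X -mulrA iA mulr1.
have eM t : 0 < im t -> chi R g X * slash k f A t = slash k f M t.
  move=> t0; rewrite ME (slashM k f (Gamma1_SL2Z hX) sA t0).
  rewrite [RHS]/slash (hs _ hX _ (upper_mobius sA t0)) mulrCA.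
  by [].
have [B hB] : exists B, qexp N B (slash k f A).
  have [h|h] := reps_base hA; have [B [hB _ _]] := slash_base R N13 bE bK N24 h.
    by exists B.
  exists (fun j => (-1) ^+ K * B j); apply: qexp_eq (qexpZ N0 ((-1) ^+ K) hB) => t t0.
  by rewrite slash_neg mulrA -exprMn mulrNN mulr1 expr1n mul1r.
exists (qcoef N (fun j => chi R g X * B j)); apply: (qexp_fourier N0).
exact: qexp_eq eM (qexpZ N0 (chi R g X) hB).
Qed.

End Gamma1Form.

Section Constants.
Variable R : realType.
Local Notation C := (Cplx R).
Local Notation I := ('i%C : C).

Lemma ee_quarter : ee (4^-1 : C) = I.
Proof.
have -> : (4^-1 : C) = (4^-1 : R)%:C by rewrite fmorphV rmorph_nat.
rewrite /ee /= mulr0 oppr0 expR0 !mul1r.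
have -> : 2 * pi / 4 = pi / 2 :> R by field.
by rewrite cos_pihalf sin_pihalf.
Qed.

Lemma sqrtC_nat (m : nat) (c : R) : 0 <= c -> c ^+ 2 = m%:R -> sqrtC (m%:R : C) = c%:C.
Proof.
move=> c0 cm; rewrite -(rmorph_nat (real_complex R)) -cm rmorphXn.
by rewrite exprCK // ler0c.
Qed.

End Constants.

Section LiftReps.
Variables (R : realType) (n : nat) (L : even_lattice n).
Local Notation C := (Cplx R).
Local Notation V := (group_ring R L).
Variable rho : 'M[int]_2 -> {linear V -> V}.
Hypothesis hrho : weil_representation rho.
Variables (N a b K : nat).
Hypotheses (N13 : (1 < N <= 3)%N) (bE : b = (N * a)%N) (bK : b = (a + 2 * K)%N)
  (N24 : (N * (N * b) = 24 + N * a)%N) (K0 : (0 < K)%N).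
Hypothesis hN : annihilates_discQ L N.
Local Notation f := (@etaquo R N a b).
Local Notation k := (- K%:Z).
Local Notation zeta := (ee (- (2 - n%:R) / 4) : C).
Variables (g : disc L) (s : set 'M[int]_2 -> 'M[int]_2).
Hypotheses (hg : eqmod1 (discQ g) (- 1 / N%:R)) (hs : coset_section N s).
Local Notation F := (Gamma1_lift rho N k f g s).

Let f_slash A (hA : Gamma1 N A) t (t0 : 0 < im t) : slash k f A t = chi R g A * f t.
Proof. by apply: slash_chi. Qed.

Let rho_char A (hA : Gamma1 N A) : rho A (basis_elt R g) = chi R g A *: basis_elt R g.
Proof. exact: (rho_chi hrho N13 hN g hA). Qed.

Lemma lift_base : coset_reps N (base N) -> forall t : C, 0 < im t ->
  F t = lift_sum rho N a b K g t.
Proof.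
by move=> hr t t0; rewrite (lift_reps hrho (chi_neq0 R g) f_slash rho_char hs hr t0).
Qed.

(** The sign condition gives the terms for -gamma the coefficient 1, so that both poles in the
    principal part have coefficient 1. *)
Lemma lift_base_neg : coset_reps N (base N ++ map -%R (base N)) -> (-1) ^+ K * zeta = 1 ->
  forall t : C, 0 < im t -> F t = lift_sum rho N a b K g t + lift_sum rho N a b K (- g) t.
Proof.
move=> hr z1 t t0; rewrite (lift_reps hrho (chi_neq0 R g) f_slash rho_char hs hr t0).
have e2 : \sum_(A <- base N) lift_term rho k f g t (- A) = lift_sum rho N a b K (- g) t.
  apply: eq_big_mem => A hA.
  have sA : SL2Z A by apply: base_SL2Z hA.
  by rewrite (lift_term_neg hrho N a b K g t sA) z1 scale1r.
by rewrite -e2 big_cat big_map.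
Qed.

Lemma lift_mod r : coset_reps N r -> forall M, SL2Z M -> forall t : C, 0 < im t ->
  F (mobius M t) = autj M t ^ k *: rho M (F t).
Proof.
move=> hr M hM t t0.
exact: (lift_modular hrho (chi_neq0 R g) f_slash rho_char hs hr hM t0).
Qed.

End LiftReps.

Lemma reps3E : reps3 = base 3 ++ map -%R (base 3).
Proof. by rewrite /base /= /STmx !mk2_N !oppr0 !opprK. Qed.

Lemma reps2E : reps2 = base 2.
Proof. by []. Qed.

Lemma zeta_latticeA2 (R : realType) : (-1) ^+ 1 * ee (- (2 - 4%:R) / 4) = 1 :> Cplx R.
Proof.
have -> : (- (2 - 4%:R) / 4 : Cplx R) = 2^-1 by field.
by rewrite ee_half expr1 mulrNN mulr1.
Qed.

(** The constant term is 2 * 3 * sqrt(3)^3 i * (-1) * i / (9 sqrt(3)) = 2, where 9 sqrt(3) is the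
    square root of 3^5. *)
Lemma weight_latticeA2 (R : realType) :
  2%:R * (3%:R * (cusp_const R 3 3 1 * (ee (- (2 - 4%:R) / 4) *
    (ee (- (2 - 4%:R) / 8) / sqrtC #|{: disc latticeA2}|%:R)))) / 2 = singular_weight R 4.
Proof.
have s0 : 0 < Num.sqrt (3 : R) by rewrite sqrtr_gt0.
have s3 : Num.sqrt (3 : R) ^+ 2 = 3 by rewrite sqr_sqrtr.
rewrite (card_disc (isT : (1 < 3)%N) elementary_latticeA2).
rewrite (@sqrtC_nat R _ (9 * Num.sqrt 3)); last 2 first.
- by rewrite mulr_ge0 ?(ltW s0).
- by rewrite exprMn s3; ring.
have -> : (- (2 - 4%:R) / 4 : Cplx R) = 2^-1 by field.
have -> : (- (2 - 4%:R) / 8 : Cplx R) = 4^-1 by field.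
rewrite ee_half ee_quarter /cusp_const /singular_weight expr1 rmorphM /=.
have := congr1 (real_complex R) s3; rewrite rmorphXn /= !rmorph_nat.
have := I_sqr R; have : (Num.sqrt (3 : R))%:C != 0 :> Cplx R by rewrite fmorph_eq0 gt_eqF.
move: (_%:C : Cplx R) ('i%C : Cplx R) => S J S0 J2 S2.
have -> : 2%:R * (3%:R * (S ^+ 3 * J * (-1 * (J / (9%:R * S))))) / 2 = - (J * J) * S ^+ 2 / 3 :> Cplx R.
  by field.
by rewrite J2 S2; field.
Qed.

(** The constant term is 2 * sqrt(2)^8 i^2 * 1 * (-1) / 8 = 4, where 8 is the square root of 2^6. *)
Lemma weight_latticeD4 (R : realType) :
  1%:R * (2%:R * (cusp_const R 2 8 2 * (ee (- (2 - 6%:R) / 4) *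
    (ee (- (2 - 6%:R) / 8) / sqrtC #|{: disc latticeD4}|%:R)))) / 2 = singular_weight R 6.
Proof.
have s2 : Num.sqrt (2 : R) ^+ 2 = 2 by rewrite sqr_sqrtr.
rewrite (card_disc (isT : (1 < 2)%N) elementary_latticeD4).
rewrite (@sqrtC_nat R _ 8) //; last by rewrite -natrX.
have -> : (- (2 - 6%:R) / 4 : Cplx R) = 1 by field.
have -> : (- (2 - 6%:R) / 8 : Cplx R) = 2^-1 by field.
rewrite ee_half ee1 /cusp_const /singular_weight rmorph_nat.
have := congr1 (real_complex R) s2; rewrite rmorphXn /= !rmorph_nat.
have := I_sqr R; move: (_%:C : Cplx R) ('i%C : Cplx R) => S J J2 S2.
have -> : S ^+ 8 = 16 by rewrite (exprM S 2 4) S2; ring.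
by rewrite expr2 J2; field.
Qed.

Theorem theorem5p2 (R : realType) :
  (is_level latticeA2 3 /\
   forall (rho : 'M[int]_2 ->
             {linear group_ring R latticeA2 -> group_ring R latticeA2})
     (gamma : disc latticeA2) (s : set 'M[int]_2 -> 'M[int]_2),
   weil_representation rho -> eqmod1 (discQ gamma) (- 1 / 3) ->
   coset_section 3 s ->
   let f := fun t : Cplx R => eta t / eta (3 * t) ^+ 3 in
   let F := Gamma1_lift rho 3 (-1) f gamma s in
   [/\ weakly_holomorphic_Gamma1 3 (-1) (chi R gamma) f,
       is_form_with_principal_part rho (-1)
         (fun b m => principal_monomial R (- 1 / 3) gamma b m +
                     principal_monomial R (- 1 / 3) (- gamma) b m) F,
       product_weight F (singular_weight R 4) & singular_weight R 4 = 1]) /\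
  (is_level latticeD4 2 /\
   forall (rho : 'M[int]_2 ->
             {linear group_ring R latticeD4 -> group_ring R latticeD4})
     (gamma : disc latticeD4) (s : set 'M[int]_2 -> 'M[int]_2),
   weil_representation rho -> eqmod1 (discQ gamma) (1 / 2) ->
   coset_section 2 s ->
   let f := fun t : Cplx R => eta t ^+ 4 / eta (2 * t) ^+ 8 in
   let F := Gamma1_lift rho 2 (-2) f gamma s in
   [/\ weakly_holomorphic_Gamma1 2 (-2) (chi R gamma) f,
       is_form_with_principal_part rho (-2)
         (principal_monomial R (- 1 / 2) gamma) F,
       product_weight F (singular_weight R 6) & singular_weight R 6 = 2]).
Proof.
split; (split; first by [exact: is_level_latticeA2|exact: is_level_latticeD4]).
- move=> rho gamma s hrho hg hs f F.
  have [_ hN _] := is_level_latticeA2.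
  have z1 := zeta_latticeA2 R.
  have hr : coset_reps 3 (base 3 ++ map -%R (base 3)) by rewrite -reps3E; exact: coset_reps3.
  have FE := @lift_base_neg R 4 latticeA2 rho hrho 3 1 3 1 isT erefl erefl erefl isT hN gamma s hg hs hr z1.
  have Fm := @lift_mod R 4 latticeA2 rho hrho 3 1 3 1 isT erefl erefl erefl isT hN gamma s hg hs _ hr.
  have hgs g : g \in [:: gamma; - gamma] -> eqmod1 (discQ g) (- 1 / 3%:R).
    by rewrite !inE => /orP[/eqP->//|/eqP->]; exact: eqmod1_trans (discQN gamma) hg.
  have FE' t : 0 < im t -> F t = \sum_(g <- [:: gamma; - gamma]) lift_sum rho 3 1 3 1 g t.
    by move=> t0; rewrite big_cons big_seq1; exact: FE.
  have [form weight] := @lift_form R 4 latticeA2 rho hrho 3 1 3 1 isT erefl erefl erefl isT hN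
    _ _ hgs FE' Fm.
  split.
  + apply: (@etaquo_Gamma1 R 4 latticeA2 3 1 3 1 isT erefl erefl erefl isT hN _ coset_reps3) => //.
    move=> A; rewrite reps3E mem_cat => /orP[hA|/mapP[B hB ->]]; first by left.
    by right; rewrite opprK.
  + have e : (fun b m => principal_monomial R (- 1 / 3) gamma b m +
        principal_monomial R (- 1 / 3) (- gamma) b m) =
      (fun g m => \sum_(g0 <- [:: gamma; - gamma]) principal_monomial R (- 1 / 3%:R) g0 g m).
      by apply/funext => g; apply/funext => m; rewrite big_cons big_seq1.
    by rewrite e; exact: form.
  + by rewrite -weight_latticeA2; exact: weight.
  by rewrite /singular_weight; field.
move=> rho gamma s hrho hg' hs f F.
have [_ hN _] := is_level_latticeD4.
have hg : eqmod1 (discQ gamma) (- 1 / 2%:R).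
  by apply: eqmod1_trans hg' _; rewrite /eqmod1 (_ : 1 / 2 - _ = 1) ?rpred1 //; field.
have hr : coset_reps 2 (base 2) by rewrite -reps2E; exact: coset_reps2.
have FE := @lift_base R 6 latticeD4 rho hrho 2 4 8 2 isT erefl erefl erefl isT hN gamma s hg hs hr.
have Fm := @lift_mod R 6 latticeD4 rho hrho 2 4 8 2 isT erefl erefl erefl isT hN gamma s hg hs _ hr.
have hgs g : g \in [:: gamma] -> eqmod1 (discQ g) (- 1 / 2%:R) by rewrite inE => /eqP->.
have FE' t : 0 < im t -> F t = \sum_(g <- [:: gamma]) lift_sum rho 2 4 8 2 g t.
  by move=> t0; rewrite big_seq1; exact: FE.
have [form weight] := @lift_form R 6 latticeD4 rho hrho 2 4 8 2 isT erefl erefl erefl isT hN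
  _ _ hgs FE' Fm.
split.
- apply: (@etaquo_Gamma1 R 6 latticeD4 2 4 8 2 isT erefl erefl erefl isT hN _ coset_reps2) => //.
  by move=> A; rewrite reps2E; left.
- have e : principal_monomial R (- 1 / 2) gamma =
      (fun g m => \sum_(g0 <- [:: gamma]) principal_monomial R (- 1 / 2%:R) g0 g m).
    by apply/funext => g; apply/funext => m; rewrite big_seq1.
  by rewrite e; exact: form.
- by rewrite -weight_latticeD4; exact: weight.
by rewrite /singular_weight; field.
Qed.
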